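(* Let $\vec r\in(0,\infty)^m$, $q\in(0,\infty)$, $s\in(q,\infty]$, and let $T$ be an operator defined on $m$-tuples of functions (mapping $m$-tuples of functions in $L^\infty_c(\mathbb{R}^d)$ to measurable functions on $\mathbb{R}^d$) such that for any $f_1,\dots,f_m,g\in L^\infty_c(\mathbb{R}^d)$ $$\big\|T(\vec f)\cdot g\big\|_{L^q(\mathbb{R}^d)}\le C_T\big\|M_{(\vec r,\frac1{\frac1q-\frac1s})}(\vec f,g)\big\|_{L^q(\mathbb{R}^d)},$$ where $C_T>0$ is a constant. Let $\vec X=(X_1,\dots,X_m)$ be an $m$-tuple of quasi-Banach function spaces over a measure space $(\Omega,\mu)$ such that $\vec X^q:=(X_1^q,\dots,X_m^q)\in\mathrm{UMD}_{\frac{\vec r}q,\frac sq}$, and let $X:=\prod_{j=1}^mX_j$. Furthermore suppose that for all simple functions $f_j\in L^\infty_c(\mathbb{R}^d;X_j)$, $1\le j\le m$, the function $\widetilde T(\vec f):\mathbb{R}^d\to X$ given by $$\widetilde T(\vec f)(x,\omega):=T(\vec f(\cdot,\omega))(x),\qquad(x,\omega)\in\mathbb{R}^d\times\Omega,$$ is well-defined and strongly measurable. Then for all simple functions $f_j\in L^\infty_c(\mathbb{R}^d;X_j)$, $1\le j\le m$, and all $g\in L^\infty_c(\mathbb{R}^d)$ $$\big\|\|\widetilde T(\vec f)\|_X\cdot g\big\|_{L^q(\mathbb{R}^d)}\lesssim_{\vec X,q,\vec r,s}C_T\big\|M_{(\vec r,\frac1{\frac1q-\frac1s})}\big(\|f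_1\|_{X_1},\dots,\|f_m\|_{X_m},g\big)\big\|_{L^q(\mathbb{R}^d)}.$$
   Context: Function spaces. Measure spaces $(\Omega,\mu)$ are $\sigma$-finite. A quasi-Banach function space over $\Omega$ is an order ideal $X\subseteq L^0(\Omega)$ with a quasi-norm such that: $|\xi|\le|\eta|$ implies $\|\xi\|_X\le\|\eta\|_X$; there is $\xi\in X$ with $\xi>0$ a.e.; and (Fatou) if $0\le\xi_n\uparrow\xi$, $\xi_n\in X$, $\sup_n\|\xi_n\|_X<\infty$, then $\xi\in X$ and $\|\xi\|_X=\sup_n\|\xi_n\|_X$. It is a Banach function space if $\|\cdot\|_X$ is a norm. It is order-continuous if $0\le\xi_n\uparrow\xi\in X$ implies $\|\xi_n-\xi\|_X\to0$. If $X$ is an order-continuous Banach function space, its dual $X^*$ is again a Banach function space over $\Omega$ (via the pairing $\int_\Omega\xi\eta\,\mathrm d\mu$). $X$ is $p$-convex, $p\in(0,\infty)$, if $\|(\sum_k|\xi_k|^p)^{1/p}\|_X\le(\sum_k\|\xi_k\|_X^p)^{1/p}$ for all finite families. The $p$-concavification is $X^p:=\{\xi\in L^0(\Omega):|\xi|^{1/p}\in X\}$ with $\|\xi\|_{X^p}:=\||\xi|^{1/p}\|_X^p$. The product $\prod_jX_j$ is the space of $\xi$ with $|\xi|\le\prod_j\xi_j$ for some $0\le\xi_j\in X_j$, with $\|\xi\|:=\inf\prod_j\|\xi_j\|_{X_j}$ over such $\xi_j$. An $m$-tuple of quasi-Banach function spaces consists of such spaces over the same measure space whose product is a quasi-Banach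 function space. For a vector $\vec r\in(0,\infty]^m$ put $\frac1r:=\sum_j\frac1{r_j}$; operations and inequalities on vectors are coordinatewise; $\frac1\infty:=0$. Hardy–Littlewood property. Let $\vec X$ be an $n$-tuple of quasi-Banach function spaces with product $X$ and $\vec r\in(0,\infty)^n$, with each $X_j$ being $r_j$-convex. For a finite collection $\mathcal{D}$ of cubes put $\widetilde M^{\mathcal{D}}_{\vec r}(\vec f)(x):=\sup_{Q\in\mathcal{D}}\prod_{j=1}^n\langle f_j\rangle_{r_j,Q}\mathbf 1_Q(x)$ (lattice supremum; $\langle f_j\rangle_{r_j,Q}$ is the function $\omega\mapsto(\frac1{|Q|}\int_Q|f_j(x,\omega)|^{r_j}\mathrm dx)^{1/r_j}$). $\vec X\in\mathrm{HL}_{\vec r}$ means that each $X_j$ is $r_j$-convex and for some $\vec p$ with $\vec r<\vec p\le\infty$ one has $\sup_{\mathcal{D}}\|\widetilde M^{\mathcal{D}}_{\vec r}\|_{L^{p_1}(\mathbb{R};X_1)\times\cdots\times L^{p_n}(\mathbb{R};X_n)\to L^p(\mathbb{R};X)}<\infty$, the supremum being over all finite collections of cubes (intervals) in $\mathbb{R}$. (The property does not depend on the choice of $\vec p$, and one may equivalently use $\mathbb{R}^d$ in place of $\mathbb{R}$.) $\mathrm{UMD}_{\vec r,s}$. For $\vec r\in(0,\infty)^m$ and $s\in(r,\infty]$, $\vec X\in\mathrm{UMD}_{\vec r,s}$ means that $X=\prod_jX_j$ is an order-continuous Banach function space and $(X_1,\dots,X_m,X^* )\in\mathrm{HL}_{(r_1,\dots,r_m,s')}$,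 where $\frac1s+\frac1{s'}=1$. Other notation. $L^\infty_c$: bounded with compact support. Cubes are half-open with sides parallel to the axes. For scalar functions $\langle f\rangle_{r,Q}:=(\frac1{|Q|}\int_Q|f|^r\mathrm dx)^{1/r}$. For $\vec\rho\in(0,\infty)^n$, $M_{\vec\rho}(h_1,\dots,h_n)(x):=\sup_Q\prod_{j=1}^n\langle h_j\rangle_{\rho_j,Q}\mathbf 1_Q(x)$, supremum over all cubes $Q\subseteq\mathbb{R}^d$; $M_{(\vec r,\rho)}$ denotes this operator for the $(m+1)$-vector $(r_1,\dots,r_m,\rho)$. $\lesssim_{a,b,\dots}$: up to a constant depending only on $a,b,\dots$ and possibly $d,m$. *)

(* Defs.v *)
From HB Require Import structures.
From mathcomp Require Import all_boot all_order all_algebra.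
From mathcomp Require Import complex.
From mathcomp Require Import all_classical all_reals all_analysis.

Set Implicit Arguments.
Unset Strict Implicit.
Unset Printing Implicit Defensive.

Import Order.TTheory GRing.Theory Num.Theory.
Import numFieldNormedType.Exports.

Local Open Scope classical_set_scope.
Local Open Scope ring_scope.
Local Open Scope complex_scope.

(* R^n is the type of n-tuples with its Borel sigma-algebra; its Lebesgue
   measure is built by adding one coordinate at a time, and lebesgue_Rd_box
   identifies it. *)
Section lebesgue_Rd.
Variable R : realType.
Local Notation RR := (measurableTypeR R).

Section step.
Variables (n : nat) (m : {sigma_finite_measure set (n.-tuple RR) -> \bar R}).

Definition tcons (p : RR * n.-tuple RR) : n.+1.-tuple RR := [tuple of p.1 :: p.2].

Lemma measurable_tcons : measurable_fun setT tcons.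
Proof. exact: measurable_cons. Qed.

Definition lebesgue_cons (A : set (n.+1.-tuple RR)) : \bar R :=
  (@lebesgue_measure R \x m)%E (tcons @^-1` A).

Let lc0 : lebesgue_cons set0 = 0%E.
Proof. by rewrite /lebesgue_cons preimage_set0 measure0. Qed.

Let lc_ge0 A : (0 <= lebesgue_cons A)%E.
Proof. exact: measure_ge0. Qed.

Let lc_sigma_additive : semi_sigma_additive lebesgue_cons.
Proof.
have mpre A : measurable A -> measurable (tcons @^-1` A).
  by move=> mA; rewrite -[X in measurable X]setTI; exact: measurable_tcons.
move=> F mF tF mUF; rewrite /lebesgue_cons preimage_bigcup.
apply: measure_semi_sigma_additive.
- by move=> k; exact: mpre.
- by apply/trivIsetP => i j _ _ ij; rewrite -preimage_setI;
    move/trivIsetP : tF => /(_ _ _ _ _ ij) ->//; rewrite preimage_set0.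
- by rewrite -preimage_bigcup; exact: mpre.
Qed.

HB.instance Definition _ :=
  isMeasure.Build _ _ _ lebesgue_cons lc0 lc_ge0 lc_sigma_additive.

Definition tuncons (t : n.+1.-tuple RR) : RR * n.-tuple RR :=
  (thead t, [tuple of behead t]).

Lemma measurable_tuncons : measurable_fun setT tuncons.
Proof.
apply: measurable_fun_pair => /=; last exact: measurable_behead.
exact: measurable_tnth.
Qed.

Lemma tconsK : cancel tcons tuncons.
Proof.
by case=> x t; rewrite /tuncons /tcons theadE; congr pair; exact/val_inj.
Qed.

Let sf : sigma_finite setT lebesgue_cons.
Proof.
have /sigma_finiteP[F [TF ndF Foo]] := sigma_finiteT (@lebesgue_measure R).
have /sigma_finiteP[G [TG ndG Goo]] := sigma_finiteT m.
exists (fun k => tuncons @^-1` (F k `*` G k)).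
  rewrite -preimage_bigcup; apply/esym/seteqP; split=> // t _ /=.
  have [i _ Fi] : (\bigcup_i F i) (thead t) by rewrite -TF.
  have [j _ Gj] : (\bigcup_i G i) [tuple of behead t] by rewrite -TG.
  exists (maxn i j) => //; split.
  - have /subsetPset : (F i <= F (maxn i j))%O by apply: ndF; exact: leq_maxl.
    exact.
  - have /subsetPset : (G j <= G (maxn i j))%O by apply: ndG; exact: leq_maxr.
    exact.
move=> k; have [mF Fk] := Foo k; have [mG Gk] := Goo k; split.
  by rewrite -[X in measurable X]setTI; apply: measurable_tuncons => //; exact: measurableX.
rewrite /lebesgue_cons -comp_preimage.
rewrite (_ : tuncons \o tcons = id); last by apply/funext => p /=; rewrite tconsK.
rewrite preimage_id product_measure1E//.
by rewrite lte_mul_pinfty// ge0_fin_numE.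
Qed.

HB.instance Definition _ := Measure_isSigmaFinite.Build _ _ _ lebesgue_cons sf.
End step.

Fixpoint lebesgue_Rd (n : nat) :
    {sigma_finite_measure set (n.-tuple RR) -> \bar R} :=
  match n with
  | 0 => [the {sigma_finite_measure set (0.-tuple RR) -> \bar R} of
           \d_ ([tuple] : 0.-tuple RR)]
  | n'.+1 => [the {sigma_finite_measure set (n'.+1.-tuple RR) -> \bar R} of
               lebesgue_cons (lebesgue_Rd n')]
  end.

Lemma lebesgue_Rd_box n (a b : 'I_n -> R) : (forall i, a i <= b i) ->
  lebesgue_Rd n [set t | forall i, a i <= tnth t i < b i] =
  (\prod_i (b i - a i))%:E.
Proof.
elim: n a b => [|n IH] a b ab.
  by rewrite big_ord0 /= diracE mem_set//; case.
pose A := [set t : n.+1.-tuple RR | forall i, a i <= tnth t i < b i].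
have -> : lebesgue_Rd n.+1 A = lebesgue_cons (lebesgue_Rd n) A by [].
pose B := [set t : n.-tuple RR |
  forall i, a (lift ord0 i) <= tnth t i < b (lift ord0 i)].
have mB : measurable B.
  rewrite (_ : B = \bigcap_(i : 'I_n)
      ((@tnth n RR)^~ i @^-1` `[a (lift ord0 i), b (lift ord0 i)[%classic)).
    apply: fin_bigcap_measurable => // i _.
    by rewrite -[X in measurable X]setTI; apply: measurable_tnth.
  apply/seteqP; split=> t /= tB i.
    by move=> _; rewrite /= in_itv /=; exact: tB.
  by have := tB i I; rewrite /= in_itv.
rewrite /lebesgue_cons (_ : _ @^-1` A = `[a ord0, b ord0[%classic `*` B).
  have itv (x y : R) : x <= y ->
      @lebesgue_measure R (`[x, y[%classic : set R) = (y - x)%:E.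
    move=> xy; rewrite lebesgue_measure_itv/= lte_fin.
    by case: ltP => // yx; rewrite (@le_anti _ _ x y) ?subrr// xy yx.
  rewrite product_measure1E// big_ord_recl EFinM; congr (_ * _)%E.
    exact: itv.
  by apply: IH.
apply/seteqP; split=> -[x t] /=; last first.
  move=> [/=]; rewrite in_itv /= => xab tB i.
  by case: (unliftP ord0 i) => [j ->|->]; rewrite ?tnthS ?tnth0//; exact: tB.
move=> xtA; split; first by have := xtA ord0; rewrite tnth0 /= in_itv.
by move=> i; have := xtA (lift ord0 i); rewrite tnthS.
Qed.

End lebesgue_Rd.

Notation Rd R n := (n.-tuple (measurableTypeR R)).

Section scalars.
Variable R : realType.

(* The scalar field is C = R[i]. Elements of L^0 are represented by everywhere
   defined measurable functions; nonnegative elements by functions to R,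
   which real_fun embeds. *)
Definition cabs (z : R[i]) : R := Normc.normc z.

Definition real_fun T (h : T -> R) : T -> R[i] := fun x => (h x)%:C.

Definition L0 d (T : measurableType d) (f : T -> R[i]) : Prop :=
  measurable_fun setT (fun x => complex.Re (f x)) /\
  measurable_fun setT (fun x => complex.Im (f x)).

Definition cintegral d (T : measurableType d) (mu : {measure set T -> \bar R})
    (f : T -> R[i]) : R[i] :=
  (Rintegral mu setT (fun x => complex.Re (f x))) +i*
  (Rintegral mu setT (fun x => complex.Im (f x))).

Definition snoc A n (f : 'I_n -> A) (a : A) : 'I_n.+1 -> A :=
  fun i => oapp f a (unlift ord_max i).

(* 1/p = sum_j 1/p_j; in \bar R the inverse satisfies +oo^-1 = 0 and
   0^-1 = +oo. *)
Definition hsum n (p : 'I_n -> \bar R) : \bar R :=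
  ((\sum_(j < n) (p j)^-1)^-1)%E.

End scalars.

(* Raw data of a function space: the values of fnorm outside fmem are
   irrelevant. Invariance under a.e. equality is part of the solidity axiom of
   quasi_banach_fs. *)
Record fspace (Omega : Type) (R : realType) := FSpace {
  fmem :> (Omega -> R[i]) -> Prop;
  fnorm : (Omega -> R[i]) -> R }.

Section function_spaces.
Variables (R : realType) (d : measure_display) (Omega : measurableType d).
Variable mu : {measure set Omega -> \bar R}.
Implicit Type X : fspace Omega R.

Definition increases_to (xin : nat -> Omega -> R) (xi : Omega -> R) : Prop :=
  {ae mu, forall w, [/\ forall n, 0 <= xin n w,
    {homo (fun n => xin n w) : k l / (k <= l)%N >-> k <= l} &
    (fun n => xin n w) @ \oo --> xi w]}.

Record quasi_banach_fs X : Prop := {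
  qb_L0 : forall xi, X xi -> L0 xi;
  qb_add : forall xi eta, X xi -> X eta -> X (fun w => xi w + eta w);
  qb_scale : forall (c : R[i]) xi, X xi -> X (fun w => c * xi w);
  qb_solid : forall xi eta, L0 xi -> X eta ->
    {ae mu, forall w, cabs (xi w) <= cabs (eta w)} ->
    X xi /\ fnorm X xi <= fnorm X eta;
  qb_norm_ge0 : forall xi, X xi -> 0 <= fnorm X xi;
  qb_norm_eq0 : forall xi, X xi ->
    (fnorm X xi = 0 <-> {ae mu, forall w, xi w = 0});
  qb_normZ : forall (c : R[i]) xi, X xi ->
    fnorm X (fun w => c * xi w) = cabs c * fnorm X xi;
  qb_normD : exists K : R, forall xi eta, X xi -> X eta ->
    fnorm X (fun w => xi w + eta w) <= K * (fnorm X xi + fnorm X eta);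
  qb_unit : exists2 xi : Omega -> R, X (real_fun xi) &
    {ae mu, forall w, 0 < xi w};
  qb_fatou : forall (xin : nat -> Omega -> R) (xi : Omega -> R),
    (forall n, X (real_fun (xin n))) -> measurable_fun setT xi ->
    increases_to xin xi ->
    has_ubound (range (fun n => fnorm X (real_fun (xin n)))) ->
    X (real_fun xi) /\
    fnorm X (real_fun xi) = sup (range (fun n => fnorm X (real_fun (xin n)))) }.

Definition banach_fs X : Prop :=
  quasi_banach_fs X /\
  forall xi eta, X xi -> X eta ->
    fnorm X (fun w => xi w + eta w) <= fnorm X xi + fnorm X eta.

Definition order_continuous X : Prop :=
  forall (xin : nat -> Omega -> R) (xi : Omega -> R),
    (forall n, measurable_fun setT (xin n)) -> X (real_fun xi) ->
    increases_to xin xi ->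
    (fun n => fnorm X (real_fun (fun w => xin n w - xi w))) @ \oo --> (0 : R).

Definition pairing (xi eta : Omega -> R[i]) : R[i] :=
  cintegral mu (fun w => xi w * eta w).

Definition fs_dual_values X (eta : Omega -> R[i]) : set R :=
  [set cabs (pairing xi eta) | xi in [set xi | X xi /\ fnorm X xi <= 1]].

Definition fs_dual X : fspace Omega R := FSpace
  [set eta | [/\ L0 eta,
     forall xi, X xi ->
       mu.-integrable setT (fun w => (cabs (xi w * eta w))%:E) &
     has_ubound (fs_dual_values X eta)]]
  (fun eta => sup (fs_dual_values X eta)).

Definition pconvex (p : R) X : Prop :=
  forall N (xi : 'I_N -> Omega -> R[i]), (forall k, X (xi k)) ->
    fnorm X (real_fun (fun w => (\sum_k cabs (xi k w) `^ p) `^ p^-1)) <=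
    (\sum_k fnorm X (xi k) `^ p) `^ p^-1.

Definition concavification (p : R) X : fspace Omega R := FSpace
  [set xi | L0 xi /\ X (real_fun (fun w => cabs (xi w) `^ p^-1))]
  (fun xi => fnorm X (real_fun (fun w => cabs (xi w) `^ p^-1)) `^ p).

Definition factors n (X : 'I_n -> fspace Omega R) (xi : Omega -> R[i])
    (xs : 'I_n -> Omega -> R) : Prop :=
  (forall j, X j (real_fun (xs j))) /\
  {ae mu, forall w, (forall j, 0 <= xs j w) /\ cabs (xi w) <= \prod_j xs j w}.

Definition fs_product n (X : 'I_n -> fspace Omega R) : fspace Omega R := FSpace
  [set xi | L0 xi /\ exists xs, factors X xi xs]
  (fun xi => inf [set \prod_j fnorm (X j) (real_fun (xs j))
                 | xs in factors X xi]).

Definition qbfs_tuple n (X : 'I_n -> fspace Omega R) : Prop :=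
  (forall j, quasi_banach_fs (X j)) /\ quasi_banach_fs (fs_product X).

(* Quasi-norm extended by +oo outside X; enorm is the version for
   [0, +oo]-valued functions, which must be a.e. finite to lie in X. *)
Definition vnorm X (xi : Omega -> R[i]) : \bar R :=
  if `[< X xi >] then (fnorm X xi)%:E else +oo%E.

Definition enorm X (h : Omega -> \bar R) : \bar R :=
  if `[< {ae mu, forall w, h w \is a fin_num} >]
  then vnorm X (real_fun (fun w => fine (h w))) else +oo%E.

End function_spaces.

Section vector_valued.
Variables (R : realType) (dS : measure_display) (S : measurableType dS).
Variable lam : {measure set S -> \bar R}.
Variables (d : measure_display) (Omega : measurableType d).
Variable mu : {measure set Omega -> \bar R}.
Implicit Type X : fspace Omega R.

Definition simple_on (G : set (set S)) X (f : S -> Omega -> R[i]) : Prop :=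
  exists N (A : 'I_N -> set S) (xi : 'I_N -> Omega -> R[i]),
    [/\ forall k, measurable (A k) /\ G (A k), forall k, X (xi k) &
        forall x w, f x w = \sum_k (\1_(A k) x)%:C * xi k w].

(* An X-valued strongly measurable function is given by a jointly measurable
   representative on S * Omega. *)
Definition strongly_measurable X (f : S -> Omega -> R[i]) : Prop :=
  L0 (fun xw : S * Omega => f xw.1 xw.2) /\
  exists phi : nat -> S -> Omega -> R[i],
    (forall n, simple_on setT X (phi n)) /\
    {ae lam, forall x, X (f x) /\
      (fun n => fnorm X (fun w => phi n x w - f x w)) @ \oo --> (0 : R)}.

Definition vLnorm (p : \bar R) X (f : S -> Omega -> R[i]) : \bar R :=
  Lnorm lam p (fun x => vnorm X (f x)).

Definition vLp (p : \bar R) X (f : S -> Omega -> R[i]) : Prop :=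
  strongly_measurable X f /\ (vLnorm p X f < +oo)%E.

Definition avg (p : R) (Q : set S) (h : S -> \bar R) : \bar R :=
  (((lam Q)^-1 * \int[lam]_(y in Q) (`|h y| `^ p)) `^ p^-1)%E.

(* The value 0 is added so that the supremum over an empty collection is 0;
   it changes nothing otherwise. *)
Definition multi_maximal (D : set (set S)) n (r : 'I_n -> R) (h : 'I_n -> S -> \bar R)
    (x : S) : \bar R :=
  ereal_sup (0%E |` [set ((\prod_(j < n) avg (r j) Q (h j)) * (\1_Q x)%:E)%E
                    | Q in D]).

Definition lattice_multi_maximal (D : set (set S)) n (r : 'I_n -> R)
    (f : 'I_n -> S -> Omega -> R[i]) (x : S) (w : Omega) : \bar R :=
  multi_maximal D r (fun j y => (cabs (f j y w))%:E) x.

End vector_valued.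

Definition intervals (R : realType) : set (set (measurableTypeR R)) :=
  [set Q | exists a l : R, 0 < l /\ Q = `[a, a + l[%classic].

Definition cubes (R : realType) n : set (set (Rd R n)) :=
  [set Q | exists (a : 'I_n -> R) (l : R), 0 < l /\
     Q = [set t | forall i, a i <= tnth t i < a i + l]].

Definition bounded_Rd (R : realType) n (A : set (Rd R n)) : Prop :=
  exists B : R, forall t, A t -> forall i, `|tnth t i : R| <= B.

Definition Linfty_c (R : realType) n (f : Rd R n -> R[i]) : Prop :=
  [/\ L0 f, exists B : R, forall t, cabs (f t) <= B &
      bounded_Rd [set t | f t != 0]].

Section HL_UMD.
Variables (R : realType) (d : measure_display) (Omega : measurableType d).
Variable mu : {measure set Omega -> \bar R}.

Definition HL n (r : 'I_n -> R) (X : 'I_n -> fspace Omega R) : Prop :=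
  [/\ qbfs_tuple mu X, forall j, 0 < r j, forall j, pconvex (r j) (X j) &
  exists p : 'I_n -> \bar R, (forall j, ((r j)%:E < p j)%E) /\
  exists C : R, forall D : set (set (measurableTypeR R)),
    finite_set D -> D `<=` @intervals R ->
  forall f : 'I_n -> measurableTypeR R -> Omega -> R[i],
    (forall j, vLp (@lebesgue_measure R) (p j) (X j) (f j)) ->
    (Lnorm (@lebesgue_measure R) (hsum p)
       (fun x => enorm mu (fs_product mu X)
                   (lattice_multi_maximal (@lebesgue_measure R) D r f x)) <=
     C%:E * \prod_(j < n)
       vLnorm (@lebesgue_measure R) (p j) (X j) (f j))%E].

(* For s <= 1 the value is nonpositive and hence excluded by HL. *)
Definition conj_exp (s : \bar R) : R := (1 - fine (s^-1)%E)^-1.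

Definition UMD m (r : 'I_m -> R) (s : \bar R)
    (X : 'I_m -> fspace Omega R) : Prop :=
  [/\ forall j, 0 < r j, (hsum (fun j => (r j)%:E) < s)%E,
      banach_fs mu (fs_product mu X), order_continuous mu (fs_product mu X) &
      HL (snoc r (conj_exp s)) (snoc X (fs_dual mu (fs_product mu X)))].

End HL_UMD.

(* F is the function (x, w) |-> T (f (., w)) x. Since T f is only determined
   up to null sets, the identity is required for a.e. w and a.e. x; as F is
   jointly measurable this determines F up to a null set. *)
Definition vector_extension (R : realType) n m (d : measure_display)
    (Omega : measurableType d) (mu : {measure set Omega -> \bar R})
    (X : fspace Omega R)
    (T : ('I_m -> Rd R n -> R[i]) -> Rd R n -> R[i])
    (f : 'I_m -> Rd R n -> Omega -> R[i]) (F : Rd R n -> Omega -> R[i]) : Prop :=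
  strongly_measurable (lebesgue_Rd R n) X F /\
  {ae mu, forall w, {ae lebesgue_Rd R n, forall x,
     F x w = T (fun j y => f j y w) x}}.

(* Main.v *)
(* Write Y_j for the q-concavification of X_j, Y for their product, and D for
   the dual of Y; let F be the extension of T applied to (f_1, ..., f_m).

   Duality. The norm of F(x) in X, raised to the power q, is the norm of
   |F(x)|^q in Y. As F is strongly measurable, countably many elements h_k >= 0
   of the unit ball of D suffice to norm |F(x)|^q in Y up to a constant for
   almost every x. Choosing for each x the best of h_0, ..., h_K gives a
   function h(x, w), and by Tonelli and the scalar hypothesis, applied for fixed
   w with weight (h(., w) |g|^q)^(1/q), everything reduces to the bound
     int int M(|f_1|^q, ..., |f_m|^q, h |g|^q) dx dw
       <= K int M(|f_1|_{X_1}^q, ..., |f_m|_{X_m}^q, |g|^q) dx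
   for the maximal operator with exponents r_j / q and (s / q)'.

   Maximal bound. Every cube is contained in a comparable box of one of 2^n
   shifted grids, and the boxes of a grid form a finite binary tree, bisected
   one coordinate at a time, so that averages over them agree with averages over
   dyadic intervals of R. The HL property yields a bound in terms of L^p norms;
   for functions whose averages are at most a constant times those over the top
   box it gives a set of small measure outside which the integral over Omega of
   the maximal function is at most a constant times the product of the top
   averages. Stop at the maximal boxes where this fails or where some average
   is too large: they fill at most half of the top box, and recursion inside
   them sums to a bound by the scalar maximal function. *)
Require Import Defs.
From HB Require Import structures.
From mathcomp Require Import all_boot all_order all_algebra.
From mathcomp Require Import complex ring lra zify.
From mathcomp Require Import all_classical all_reals all_analysis measurable_realfun ess_sup_inf.

Set Implicit Arguments.
Unset Strict Implicit.
Unset Printing Implicit Defensive.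

Import Order.TTheory GRing.Theory Num.Theory.
Import numFieldNormedType.Exports.
Import HBNNSimple.

Local Open Scope classical_set_scope.
Local Open Scope ring_scope.

(** * Maximal functions on a finite binary tree *)

(** The hypothesis on the spaces concerns intervals of R and one unspecified tuple of exponents p_j,
    some possibly infinite, while the goal is an L^1 bound on R^n by the scalar maximal function.
    Only averages over a binary tree matter, so a tree of intervals can stand for a tree of boxes.
    Of the L^p bound only a restricted weak-type consequence is used: if b_j bounds the j-th
    function on the tree and the integral over Omega of the maximal function is at least beta on a
    proportion theta of the leaves, then beta * theta^e is at most C times the product of the b_j,
    where e is the sum of the 1 / p_j. This requires bounded data, so the functions are first
    replaced by their means over stopping boxes. The recursion does not lose constants from level to
    level: the bound at the top is charged to the leaves outside the stopping boxes, at least half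
    of all, and the bounds inside to the other leaves. The maximal function over all cubes is
    dominated by a lower limit over finite trees. Fatou's lemma, once in x and once in w, then
    yields a majorant that is measurable in w. *)

Section dyadic_tree.
Variable R : realType.
Implicit Types (V : nat -> R) (k i l H : nat).

(* The node [(k, i)] of the binary tree with leaf set [nat] has the leaves
   [i * 2 ^ k, ..., (i + 1) * 2 ^ k - 1]. *)
Definition nodesum k i V : R := \sum_(l < 2 ^ k) V (i * 2 ^ k + l)%N.
Definition nodemean k i V : R := nodesum k i V / (2 ^+ k).

Lemma nodesum0 i V : nodesum 0 i V = V i.
Proof. by rewrite /nodesum expn0 big_ord1 muln1 addn0. Qed.

Lemma nodesumS k i V :
  nodesum k.+1 i V = nodesum k i.*2 V + nodesum k i.*2.+1 V.
Proof.
rewrite /nodesum expnS mul2n -addnn big_split_ord /=.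
by congr (_ + _); apply: eq_bigr => l _; congr V; rewrite -muln2; lia.
Qed.

Lemma eq_nodesum k i V V' : (forall l, (l %/ 2 ^ k = i)%N -> V l = V' l) ->
  nodesum k i V = nodesum k i V'.
Proof.
move=> VV'; apply: eq_bigr => l _; apply: VV'.
by rewrite divnMDl ?expn_gt0// divn_small// addn0.
Qed.

Lemma le_nodesum k i V V' : (forall l, (l %/ 2 ^ k = i)%N -> V l <= V' l) ->
  nodesum k i V <= nodesum k i V'.
Proof.
move=> VV'; apply: ler_sum => l _; apply: VV'.
by rewrite divnMDl ?expn_gt0// divn_small// addn0.
Qed.

Lemma nodesum_ge0 k i V : (forall l, (l %/ 2 ^ k = i)%N -> 0 <= V l) ->
  0 <= nodesum k i V.
Proof.
move=> V0; apply: sumr_ge0 => l _; apply: V0.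
by rewrite divnMDl ?expn_gt0// divn_small// addn0.
Qed.

Lemma nodesum_cst k i (c : R) : nodesum k i (fun=> c) = c * 2 ^+ k.
Proof.
by rewrite /nodesum sumr_const card_ord -[LHS]mulr_natr natrX.
Qed.

Lemma nodesumD k i V V' : nodesum k i (fun l => V l + V' l) =
  nodesum k i V + nodesum k i V'.
Proof. exact: big_split. Qed.

Lemma nodesumZ k i c V : nodesum k i (fun l => c * V l) = c * nodesum k i V.
Proof. by rewrite /nodesum big_distrr. Qed.

Lemma nodesum_nodemean k i V : nodesum k i V = nodemean k i V * 2 ^+ k.
Proof. by rewrite /nodemean mulfVK// gt_eqF// exprn_gt0. Qed.

Lemma nodemean0 i V : nodemean 0 i V = V i.
Proof. by rewrite /nodemean nodesum0 expr0 divr1. Qed.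

Lemma nodemean_ge0 k i V : (forall l, (l %/ 2 ^ k = i)%N -> 0 <= V l) ->
  0 <= nodemean k i V.
Proof. by move=> V0; rewrite divr_ge0 ?nodesum_ge0// exprn_ge0. Qed.

Lemma div2exp_anc k k' l : (k <= k')%N ->
  (l %/ 2 ^ k' = (l %/ 2 ^ k) %/ 2 ^ (k' - k))%N.
Proof. by move=> kk'; rewrite -divnMA -expnD subnKC. Qed.

Lemma anc_eq k k' l l' : (k <= k')%N -> (l %/ 2 ^ k = l' %/ 2 ^ k)%N ->
  (l %/ 2 ^ k' = l' %/ 2 ^ k')%N.
Proof.
move=> kk' ll'; rewrite (div2exp_anc l kk') ll'; symmetry; exact: div2exp_anc.
Qed.

Lemma div2expS k l : (l %/ 2 ^ k.+1 = (l %/ 2 ^ k)./2)%N.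
Proof. by rewrite (@div2exp_anc k)// subSnn expn1 divn2. Qed.

Lemma half_doubleS i : i.*2.+1./2 = i.
Proof. exact: uphalf_double. Qed.

Lemma nodesum_parent k i V : (forall l, (l %/ 2 ^ k.+1 = i./2)%N -> 0 <= V l) ->
  nodesum k i V <= nodesum k.+1 i./2 V.
Proof.
move=> V0; rewrite nodesumS.
have V0' j : (j./2 = i./2)%N -> 0 <= nodesum k j V.
  by move=> ji; apply: nodesum_ge0 => l lj; apply: V0; rewrite div2expS lj.
have := odd_double_half i; case: (odd i) => /= ii.
  by rewrite add1n in ii; rewrite ii lerDr V0'// doubleK.
by rewrite add0n in ii; rewrite ii lerDl V0'// -{1}ii half_doubleS.
Qed.

Lemma nodemean_parent k i V : (forall l, (l %/ 2 ^ k.+1 = i./2)%N -> 0 <= V l) ->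
  nodemean k i V <= 2 * nodemean k.+1 i./2 V.
Proof.
move=> V0; rewrite /nodemean exprS invfM [2 * _]mulrCA mulVKf ?pnatr_eq0//.
by rewrite ler_pM2r ?invr_gt0 ?exprn_gt0//; exact: nodesum_parent.
Qed.

(** The dyadic maximal function is of weak type (1,1) with constant 1: either the mean over the root
    exceeds [lam] and counting all leaves is affordable, or the root is no witness and the two
    children are treated separately. *)
Lemma weak_type H i V (lam : R) : (forall l, (l %/ 2 ^ H = i)%N -> 0 <= V l) ->
  0 <= lam ->
  lam * nodesum H i (fun l =>
     [exists k : 'I_H.+1, lam < nodemean k (l %/ 2 ^ k) V]%:R) <=
  nodesum H i V.
Proof.
move=> + lam0; elim: H i => [|H IH] i V0.
  rewrite !nodesum0; case: existsP => [[k]|_]; last first.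
    by rewrite mulr0 V0// expn0 divn1.
  by rewrite ord1 /= expn0 divn1 nodemean0 mulr1 => /ltW.
have [lamm|mlam] := ltP lam (nodemean H.+1 i V).
  rewrite [leRHS]nodesum_nodemean.
  apply: le_trans (_ : lam * 2 ^+ H.+1 <= _); last first.
    by rewrite ler_pM2r ?exprn_gt0// ltW.
  apply: ler_wpM2l => //; rewrite -[leRHS]mul1r -(@nodesum_cst _ i).
  by apply: le_nodesum => l _; rewrite lern1 leq_b1.
have V0' j : (j./2 = i)%N -> forall l, (l %/ 2 ^ H = j)%N -> 0 <= V l.
  by move=> ji l lj; apply: V0; rewrite div2expS lj.
have E j : (j./2 = i)%N -> nodesum H j (fun l =>
     [exists k : 'I_H.+2, lam < nodemean k (l %/ 2 ^ k) V]%:R) =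
   nodesum H j (fun l =>
     [exists k : 'I_H.+1, lam < nodemean k (l %/ 2 ^ k) V]%:R).
  move=> ji; apply: eq_nodesum => l lj; congr (_%:R); congr nat_of_bool.
  apply/existsP/existsP => -[k kP].
    have kH : (k < H.+1)%N.
      rewrite ltn_neqAle -ltnS ltn_ord andbT; apply/eqP => kH.
      by move: kP; rewrite kH div2expS lj ji ltNge mlam.
    by exists (Ordinal kH).
  by exists (widen_ord (leqnSn _) k).
rewrite !nodesumS mulrDr !E ?doubleK// ?half_doubleS//.
by apply: lerD; apply: IH; apply: V0'; rewrite ?doubleK// ?half_doubleS.
Qed.

(* The largest height [k < H] at which the ancestor of the leaf [l] is marked,
   and [0] if there is none. *)
Definition stop_height (bad : nat -> nat -> bool) H l : nat :=
  \max_(k < H | bad k (l %/ 2 ^ k)%N) k.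

(** Conditional expectation of [V] with respect to the maximal marked nodes below the root and the
    leaves in none of them. *)
Definition stopped bad H V l : R :=
  let k := stop_height bad H l in nodemean k (l %/ 2 ^ k)%N V.

Lemma stop_heightP bad H l :
  let k := stop_height bad H l in
  (k = 0%N \/ (k < H)%N /\ bad k (l %/ 2 ^ k)%N) /\
  forall k', (k < k' < H)%N -> ~~ bad k' (l %/ 2 ^ k')%N.
Proof.
move=> k; split; last first.
  move=> k' /andP[kk' k'H]; apply/negP => bk'.
  have := @leq_bigmax_cond _ (fun k : 'I_H => bad k (l %/ 2 ^ k)%N)
    (fun k : 'I_H => k : nat) (Ordinal k'H) bk'.
  by rewrite leqNgt kk'.
have [c|c] := posnP #|[pred k : 'I_H | bad k (l %/ 2 ^ k)%N]|.
  by left; rewrite /k /stop_height big_pred0// => j; have /card0_eq/(_ j) := c.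
have [k0 k0P k0E] := @eq_bigmax_cond _
   [pred k : 'I_H | bad k (l %/ 2 ^ k)%N] (fun k : 'I_H => k : nat) c.
have -> : k = k0 by rewrite -k0E; apply: eq_bigl.
by right; split; [exact: ltn_ord|exact: k0P].
Qed.

(** A node that is unmarked together with its ancestors below the root is a disjoint union of
    stopping nodes and unstopped leaves; replacing [V] by its means over these preserves the sum. *)
Lemma nodesum_stopped bad H V k i : (k <= H)%N ->
  (forall k', (k <= k' < H)%N -> ~~ bad k' (i %/ 2 ^ (k' - k))%N) ->
  nodesum k i (stopped bad H V) = nodesum k i V.
Proof.
elim: k i => [|k IH] i kH nb.
  rewrite !nodesum0 /stopped.
  have [[->|[sH bs]] _] := stop_heightP bad H i.
    by rewrite expn0 divn1 nodemean0.
  move: (nb (stop_height bad H i)); rewrite sH subn0.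
  by move/(_ isT); rewrite bs.
have nbc j k' : (j./2 = i)%N -> (k < k' < H)%N -> ~~ bad k' (j %/ 2 ^ (k' - k))%N.
  move=> ji /andP[kk' k'H].
  by rewrite (@div2exp_anc 1) ?subn_gt0// expn1 divn2 ji -subnDA addn1 nb// kk'.
rewrite !nodesumS.
suff child j : (j./2 = i)%N -> nodesum k j (stopped bad H V) = nodesum k j V.
  by rewrite !child ?doubleK// ?half_doubleS.
(* The ancestors of a marked child are unmarked below the root, so the child is a stopping node and
   [stopped] is constant on it. *)
move=> ji; have [bkj|bkj] := boolP (bad k j); last first.
  apply: IH => [|k' /andP[]]; first exact: ltnW.
  rewrite leq_eqVlt => /orP[/eqP<- _|kk' k'H]; last by apply: nbc => //; rewrite kk'.
  by rewrite subnn expn0 divn1.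
rewrite [RHS]nodesum_nodemean -(@nodesum_cst _ j); apply: eq_nodesum => l lj.
suff E : stop_height bad H l = k by rewrite /stopped E lj.
have [sE sN] := stop_heightP bad H l.
apply/eqP; rewrite eqn_leq; apply/andP; split; last first.
  rewrite leqNgt; apply/negP => sk; have := sN k.
  by rewrite sk kH lj bkj => /(_ isT).
case: sE => [->//|[sH bs]]; rewrite leqNgt; apply/negP => ks.
have := nbc j (stop_height bad H l) ji; rewrite ks sH -lj => /(_ isT).
by rewrite -div2exp_anc 1?ltnW// bs.
Qed.

End dyadic_tree.

(** * Integrals without measurability and complex moduli *)

Section lower_integral.
Context d (T : measurableType d) (R : realType).
Variable mu : {measure set T -> \bar R}.
Local Open Scope ereal_scope.

(* [integral] of a nonnegative function is a supremum over simple functions,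
   hence monotone without any measurability assumption. *)
Lemma ge0_le_lintegral (D : set T) (f g : T -> \bar R) :
  (forall x, D x -> 0 <= f x) -> (forall x, D x -> f x <= g x) ->
  \int[mu]_(x in D) f x <= \int[mu]_(x in D) g x.
Proof.
move=> f0 fg; have g0 x : D x -> 0 <= g x by move=> Dx; exact: le_trans (f0 x Dx) (fg x Dx).
rewrite !ge0_integralE//; apply: ereal_sup_le => _ [h hf <-].
exists h => // x; apply: le_trans (hf x) _.
by rewrite /patch; case: ifPn => // /set_mem /fg.
Qed.

(** Measurability of [g] suffices: the integral of [f] is a supremum over simple functions, each of
    them almost everywhere below [g]. *)
Lemma ae_le_lintegral (f g : T -> \bar R) :
  (forall x, 0 <= f x) -> (forall x, 0 <= g x) -> measurable_fun setT g ->
  {ae mu, forall x, f x <= g x} ->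
  \int[mu]_x f x <= \int[mu]_x g x.
Proof.
move=> f0 g0 mg fg; rewrite [leLHS]ge0_integralTE//.
apply: ge_ereal_sup => _ [h hf <-]; rewrite -integralT_nnsfun.
apply: ae_ge0_le_integral => //.
- by move=> x _; rewrite /= lee_fin.
- by apply/measurable_EFinP.
- by apply: filterS fg => x fgx _; exact: le_trans (hf x) fgx.
Qed.

Lemma cst_le_lintegral (A : set T) (b : R) (F : T -> \bar R) :
  measurable A -> (0 <= b)%R -> (forall x, 0 <= F x) ->
  (forall x, A x -> b%:E <= F x) -> b%:E * mu A <= \int[mu]_x F x.
Proof.
move=> mA b0 F0 bF; rewrite -[X in mu X]setIT -integral_indic//.
rewrite -ge0_integralZl//; last by apply/measurable_EFinP; exact: measurable_indic.
apply: ge0_le_lintegral => x _; first by rewrite mule_ge0// lee_fin.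
rewrite indicE; case: (boolP (x \in A)) => [/set_mem/bF|_].
  by rewrite mule1.
by rewrite mule0.
Qed.

Lemma lintegral_le_cst (A : set T) (b : R) (F : T -> \bar R) :
  measurable A -> (0 <= b)%R -> (forall x, 0 <= F x) ->
  (forall x, F x <= b%:E * (\1_A x)%:E) -> \int[mu]_x F x <= b%:E * mu A.
Proof.
move=> mA b0 F0 bF; rewrite -[X in mu X]setIT -integral_indic//.
rewrite -ge0_integralZl//; last by apply/measurable_EFinP; exact: measurable_indic.
by apply: ge0_le_lintegral.
Qed.

(** For [p = +oo] the exponent [fine p^-1] is 0, so this bound and the next one include the
    essential supremum; the exponents provided by [HL] may be infinite. *)
Lemma Lnorm_le_cst (p : \bar R) (A : set T) (b : R) (F : T -> \bar R) :
  0 < p -> measurable A -> mu A < +oo -> (0 <= b)%R -> (forall x, 0 <= F x) ->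
  (forall x, F x <= b%:E * (\1_A x)%:E) ->
  Lnorm mu p F <= (b * fine (mu A) `^ fine p^-1)%:E.
Proof.
move=> p0 mA Aoo b0 F0 bF.
have AE : (fine (mu A))%:E = mu A by rewrite fineK// ge0_fin_numE.
rewrite unlock; case: p p0 => [p p0|_|//]; last first.
  rewrite invey /= powRr0 mulr1; case: ifP => // _.
  apply/ess_supP; apply: nearW => x /=; rewrite gee0_abs//.
  apply: le_trans (bF x) _; rewrite -EFinM lee_fin indicE.
  by case: (_ \in _); rewrite ?mulr1 ?mulr0.
rewrite lte_fin in p0; rewrite inver gt_eqF//=.
have -> : (b * fine (mu A) `^ p^-1)%:E = ((b `^ p)%:E * mu A) `^ p^-1.
  rewrite -AE -EFinM poweR_EFin powRM ?powR_ge0 ?fine_ge0//.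
  by rewrite -powRrM mulfV ?gt_eqF// powRr1.
apply: gt0_ler_poweR; rewrite ?invr_ge0 ?(ltW p0) ?in_itv/= ?leey ?andbT//.
- by apply: integral_ge0 => x _; exact: poweR_ge0.
- by rewrite mule_ge0// lee_fin powR_ge0.
apply: lintegral_le_cst => //; first exact: powR_ge0.
  by move=> x; exact: poweR_ge0.
move=> x; have := bF x; rewrite gee0_abs// indicE; case: (_ \in _) => /=.
  rewrite !mule1 => Fb; rewrite -poweR_EFin.
  by apply: gt0_ler_poweR; rewrite ?(ltW p0) ?in_itv/= ?leey ?andbT ?lee_fin.
rewrite !mule0 => Fx; suff -> : F x = 0 by rewrite poweR0r// gt_eqF.
by apply/eqP; rewrite eq_le Fx F0.
Qed.

Lemma cst_le_Lnorm (p : \bar R) (A : set T) (b : R) (F : T -> \bar R) :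
  0 < p -> measurable A -> 0 < mu A < +oo -> (0 <= b)%R ->
  (forall x, 0 <= F x) -> (forall x, A x -> b%:E <= F x) ->
  (b * fine (mu A) `^ fine p^-1)%:E <= Lnorm mu p F.
Proof.
move=> p0 mA /andP[A0 Aoo] b0 F0 bF.
have AE : (fine (mu A))%:E = mu A by rewrite fineK// ge0_fin_numE.
rewrite unlock; case: p p0 => [p p0|_|//]; last first.
  rewrite invey /= powRr0 mulr1; rewrite ifT; last first.
    by apply: lt_le_trans A0 _; apply: le_measure; rewrite ?inE.
  rewrite leNgt; apply/negP => lt.
  have [N [mN N0 sub]] := ess_sup_ge mu (abse \o F).
  have AN : A `<=` N.
    move=> x Ax; apply: sub => /= le; have := le_lt_trans le lt.
    by rewrite gee0_abs// ltNge bF.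
  have : mu A <= mu N by apply: le_measure; rewrite ?inE.
  by rewrite N0 leNgt A0.
rewrite lte_fin in p0; rewrite inver gt_eqF//=.
have -> : (b * fine (mu A) `^ p^-1)%:E = ((b `^ p)%:E * mu A) `^ p^-1.
  rewrite -AE -EFinM poweR_EFin powRM ?powR_ge0 ?fine_ge0//.
  by rewrite -powRrM mulfV ?gt_eqF// powRr1.
apply: gt0_ler_poweR; rewrite ?invr_ge0 ?(ltW p0) ?in_itv/= ?leey ?andbT//.
- by rewrite mule_ge0// lee_fin powR_ge0.
- by apply: integral_ge0 => x _; exact: poweR_ge0.
apply: cst_le_lintegral => //; first exact: powR_ge0.
  by move=> x; exact: poweR_ge0.
move=> x Ax; rewrite gee0_abs// -poweR_EFin.
by apply: gt0_ler_poweR; rewrite ?(ltW p0) ?in_itv/= ?leey ?andbT ?lee_fin// bF.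
Qed.

End lower_integral.

Lemma powRK (R : realType) (x r : R) : 0 <= x -> 0 < r ->
  (x `^ r) `^ r^-1 = x.
Proof. by move=> x0 r0; rewrite -powRrM mulfV ?gt_eqF// powRr1. Qed.

Lemma powRVK (R : realType) (x r : R) : 0 <= x -> 0 < r ->
  (x `^ r^-1) `^ r = x.
Proof. by move=> x0 r0; rewrite -powRrM mulVf ?gt_eqF// powRr1. Qed.

Section complex_functions.
Variable R : realType.
Implicit Types z : R[i].

Lemma cabsE z : cabs z = Num.sqrt (complex.Re z ^+ 2 + complex.Im z ^+ 2).
Proof. by case: z. Qed.

Lemma cabs_real (x : R) : cabs (x%:C)%C = `|x|.
Proof. by rewrite cabsE /= expr0n addr0 sqrtr_sqr. Qed.

Lemma cabs_ge0 z : 0 <= cabs z.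
Proof. by rewrite cabsE sqrtr_ge0. Qed.

Lemma cabsM z z' : cabs (z * z') = cabs z * cabs z'.
Proof. exact: Normc.normcM. Qed.

Lemma cabsD z z' : cabs (z + z') <= cabs z + cabs z'.
Proof. exact: le_normcD. Qed.

Lemma cabs0 : cabs (0 : R[i]) = 0.
Proof. exact: Normc.normc0. Qed.

Lemma cabs_sum I (r : seq I) P (F : I -> R[i]) :
  cabs (\sum_(i <- r | P i) F i) <= \sum_(i <- r | P i) cabs (F i).
Proof.
elim/big_ind2 : _ => [|z x z' x' zx zx'|//]; first by rewrite cabs0.
exact: le_trans (cabsD _ _) (lerD zx zx').
Qed.

Context d (T : measurableType d).
Implicit Types f g : T -> R[i].

Lemma L0_real (h : T -> R) : L0 (real_fun h) <-> measurable_fun setT h.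
Proof. by split=> [[]//|mh]; split => //=; exact: measurable_cst. Qed.

Lemma L0_cabs f : L0 f -> measurable_fun setT (fun x => cabs (f x)).
Proof.
move=> [mr mi].
under eq_fun do rewrite cabsE -powR12_sqrt ?addr_ge0 ?sqr_ge0//.
apply: (measurableT_comp (measurable_powR _)).
by apply: measurable_funD; exact: measurable_funX.
Qed.

Lemma L0_add f g : L0 f -> L0 g -> L0 (fun x => f x + g x).
Proof.
move=> [fr fi] [gr gi]; split.
  by under eq_fun do rewrite raddfD/=; exact: measurable_funD.
by under eq_fun do rewrite raddfD/=; exact: measurable_funD.
Qed.

Lemma L0_mul f g : L0 f -> L0 g -> L0 (fun x => f x * g x).
Proof.
move=> [fr fi] [gr gi].
have E x : f x * g x = ((complex.Re (f x) * complex.Re (g x) -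
    complex.Im (f x) * complex.Im (g x)) +i*
    (complex.Re (f x) * complex.Im (g x) + complex.Im (f x) * complex.Re (g x)))%C.
  by case: (f x) => a b; case: (g x).
split; under eq_fun do rewrite E/=.
  by apply: measurable_funB; exact: measurable_funM.
by apply: measurable_funD; exact: measurable_funM.
Qed.

Lemma L0_cst z : L0 (fun _ : T => z).
Proof. by split; exact: measurable_cst. Qed.

Lemma L0_sum I (r : seq I) (F : I -> T -> R[i]) :
  (forall i, L0 (F i)) -> L0 (fun x => \sum_(i <- r) F i x).
Proof.
move=> F0; elim: r => [|i r IH].
  by under eq_fun do rewrite big_nil; exact: L0_cst.
by under eq_fun do rewrite big_cons; exact: L0_add.
Qed.

Lemma L0_comp d' (T' : measurableType d') (h : T' -> T) f :
  measurable_fun setT h -> L0 f -> L0 (fun x => f (h x)).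
Proof.
move=> mh [fr fi]; split.
- exact: (@measurableT_comp _ _ _ _ _ _ (fun x => complex.Re (f x))).
- exact: (@measurableT_comp _ _ _ _ _ _ (fun x => complex.Im (f x))).
Qed.

Lemma L0_indic (A : set T) : measurable A -> L0 (fun x => (\1_A x : R)%:C%C).
Proof. by move=> mA; apply/L0_real; exact: measurable_indic. Qed.

Lemma measurable_powR_comp (h : T -> R) p : measurable_fun setT h ->
  measurable_fun setT (fun x => h x `^ p).
Proof. exact: (measurableT_comp (measurable_powR p)). Qed.

End complex_functions.

(** * Stopping times and the vector-valued maximal function *)

Lemma powR_ge1 (R : realType) (x p : R) : 1 <= x -> 0 <= p -> 1 <= x `^ p.
Proof. by move=> x1 p0; rewrite -(powRr0 x) ler_powR. Qed.

Section tree_max.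
Variables (R : realType) (n : nat) (rho : 'I_n -> R).
Implicit Types (u : 'I_n -> nat -> R) (k i l H : nat).

Definition node_prod u k i : R :=
  \prod_j nodemean k i (fun l => u j l `^ rho j) `^ (rho j)^-1.

(** Multilinear dyadic maximal function at the leaf [l], over its ancestors of heights [k] to [H].
    The truncation from below isolates the part that is constant on nodes of height [k]. *)
Definition anc_max u k H l : R :=
  \big[Num.max/0]_(k' < H.+1 | (k <= k')%N) node_prod u k' (l %/ 2 ^ k').

Lemma node_prod_ge0 u k i : 0 <= node_prod u k i.
Proof. by apply: prodr_ge0 => j _; exact: powR_ge0. Qed.

Lemma anc_max_ge0 u k H l : 0 <= anc_max u k H l.
Proof.
by rewrite /anc_max; elim/big_ind: _ => [//|x y x0 _|? _];
  rewrite ?le_max ?x0 ?node_prod_ge0.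
Qed.

Lemma node_prod_le_anc_max u k k' H l : (k <= k' <= H)%N ->
  node_prod u k' (l %/ 2 ^ k') <= anc_max u k H l.
Proof.
move=> /andP[kk' k'H]; rewrite -ltnS in k'H.
exact: (@le_bigmax_cond _ _ _ _ (Ordinal k'H)
  (fun i : 'I_H.+1 => (k <= i)%N) (fun i : 'I_H.+1 => node_prod u i (l %/ 2 ^ i))).
Qed.

Lemma anc_max_le u k H l x : 0 <= x ->
  (forall k', (k <= k' <= H)%N -> node_prod u k' (l %/ 2 ^ k') <= x) ->
  anc_max u k H l <= x.
Proof.
move=> x0 ux; apply: bigmax_le => // -[k' k'H] /= kk'.
by apply: ux; rewrite kk' -ltnS.
Qed.

Lemma le_anc_max u k k' H H' l : (k <= k')%N -> (H' <= H)%N ->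
  anc_max u k' H' l <= anc_max u k H l.
Proof.
move=> kk' H'H; apply: anc_max_le => [|i /andP[ki iH]]; first exact: anc_max_ge0.
by apply: node_prod_le_anc_max; rewrite (leq_trans kk' ki) (leq_trans iH H'H).
Qed.

Lemma anc_max_split u k H l : (k < H)%N ->
  anc_max u 0 H l <= anc_max u 0 k l + anc_max u k.+1 H l.
Proof.
move=> kH; apply: anc_max_le => [|k' /andP[_ k'H]].
  by rewrite addr_ge0// anc_max_ge0.
have [k'k|kk'] := leqP k' k.
  apply: le_trans (@node_prod_le_anc_max u 0 k' k l _) _ => //.
  by rewrite lerDl anc_max_ge0.
apply: le_trans (@node_prod_le_anc_max u k.+1 k' H l _) _; first by rewrite kk'.
by rewrite lerDr anc_max_ge0.
Qed.

Lemma eq_anc_max u u' k H l l' : (forall k', (k <= k' <= H)%N ->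
    node_prod u k' (l %/ 2 ^ k') = node_prod u' k' (l' %/ 2 ^ k')) ->
  anc_max u k H l = anc_max u' k H l'.
Proof.
move=> uu'; apply: eq_bigr => -[k' k'H] /= kk'.
by apply: uu'; rewrite kk' -ltnS.
Qed.

Lemma anc_max_le_sum u k H l :
  anc_max u k H l <= \sum_(k' < H.+1) node_prod u k' (l %/ 2 ^ k').
Proof.
apply: anc_max_le => [|k' /andP[_ k'H]].
  by apply: sumr_ge0 => ? _; exact: node_prod_ge0.
rewrite -ltnS in k'H; rewrite (bigD1 (Ordinal k'H))//= lerDl.
by apply: sumr_ge0 => ? _; exact: node_prod_ge0.
Qed.

Lemma node_prod0 u i : (forall j, 0 < rho j) -> (forall j, 0 <= u j i) ->
  node_prod u 0 i = \prod_j u j i.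
Proof.
move=> rho0 u0; apply: eq_bigr => j _.
by rewrite nodemean0 -powRrM mulfV ?gt_eqF// powRr1.
Qed.

End tree_max.

Lemma nodesum_refine (R : realType) (F G : nat -> R) k H i : (k <= H)%N ->
  (forall i', (i' %/ 2 ^ (H - k) = i)%N -> nodesum k i' F <= nodesum k i' G) ->
  nodesum H i F <= nodesum H i G.
Proof.
elim: H i => [|H IH] i.
  by rewrite leqn0 => /eqP -> /(_ i); rewrite subnn expn0 divn1; apply.
rewrite leq_eqVlt => /orP[/eqP <- /(_ i)|kH FG].
  by rewrite subnn expn0 divn1; apply.
rewrite ltnS in kH; rewrite !nodesumS.
by apply: lerD; apply: IH => // i' i'E; apply: FG;
  rewrite subSn// expnSr divnMA i'E divn2 ?doubleK ?half_doubleS.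
Qed.

Definition max_marked (bad : nat -> nat -> bool) H k l : bool :=
  bad k (l %/ 2 ^ k)%N &&
  [forall k' : 'I_H, (k < k')%N ==> ~~ bad k' (l %/ 2 ^ k')%N].

(** This allows the indicator of being a maximal marked node to be pulled out of sums over the
    leaves of a node. *)
Lemma max_marked_node bad H k i : exists b : bool,
  forall l, (l %/ 2 ^ k = i)%N -> max_marked bad H k l = b.
Proof.
exists (bad k i &&
  [forall k' : 'I_H, (k < k')%N ==> ~~ bad k' (i %/ 2 ^ (k' - k))%N]).
move=> l lk; rewrite /max_marked lk; congr (_ && _); apply: eq_forallb => k'.
case: (boolP (k < k')%N) => [/ltnW kk'|_]; last by rewrite !implyFb.
by rewrite (div2exp_anc l kk') lk.
Qed.

(** * Recursive domination over stopping nodes *)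

Section recursion.
Context (R : realType) d (Omega : measurableType d).
Variables (mu : {measure set Omega -> \bar R}) (n : nat) (rho : 'I_n -> R).
Hypothesis rho0 : forall j, 0 < rho j.
(** To be read as: [v] is a nonnegative element of the [j]-th space, of norm at most [a]. Convexity
    of that space enters through [adm_mean]. *)
Variable adm : 'I_n -> (Omega -> R) -> R -> Prop.
Hypothesis adm_meas : forall j v a, adm j v a -> measurable_fun setT v.
Hypothesis adm_ge0 : forall j v a, adm j v a -> forall w, 0 <= v w.
Hypothesis adm_bnd_ge0 : forall j v a, adm j v a -> 0 <= a.
Hypothesis adm_le : forall j v a b, adm j v a -> a <= b -> adm j v b.
Hypothesis adm_mean : forall j k i (v : nat -> Omega -> R) a,
  (forall l, (l %/ 2 ^ k = i)%N -> adm j (v l) (a l)) ->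
  adm j (fun w => nodemean k i (fun l => v l w `^ rho j) `^ (rho j)^-1)
        (nodemean k i (fun l => a l `^ rho j) `^ (rho j)^-1).

Definition vanc_max (v : 'I_n -> nat -> Omega -> R) k H l (w : Omega) : R :=
  anc_max rho (fun j l => v j l w) k H l.

Variables C e : R.
Hypotheses (C0 : 0 <= C) (e0 : 0 <= e).
(** Restricted weak-type bound for data bounded by [b] on the tree: [E] is a set of leaves on which
    the integrated maximal function is at least [beta], and its proportion among all leaves enters
    with the power [e]. *)
Hypothesis tree_bound : forall H i (v : 'I_n -> nat -> Omega -> R) b,
  (forall j l, (l %/ 2 ^ H = i)%N -> adm j (v j l) (b j)) ->
  forall (E : nat -> bool) beta, 0 <= beta ->
  (forall l, (l %/ 2 ^ H = i)%N -> E l ->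
     (beta%:E <= \int[mu]_w (vanc_max v 0 H l w)%:E)%E) ->
  0 < nodesum H i (fun l => (E l)%:R : R) ->
  beta * (nodesum H i (fun l => (E l)%:R) / 2 ^+ H) `^ e <= C * \prod_j b j.

(** On a tree with a single leaf the maximal function is the plain product, and [tree_bound] becomes
    a Hoelder inequality. *)
Let adm_prod (v : 'I_n -> Omega -> R) b : (forall j, adm j (v j) (b j)) ->
  (\int[mu]_w (\prod_j v j w)%:E <= (C * \prod_j b j)%:E)%E.
Proof.
move=> vb; have H beta : 0 <= beta ->
    (beta%:E <= \int[mu]_w (\prod_j v j w)%:E)%E -> beta <= C * \prod_j b j.
  move=> beta0 bI; have := @tree_bound 0 0 (fun j _ => v j) b _ (fun=> true)
    beta beta0.
  rewrite nodesum0 expr0 divr1 powR1 mulr1; apply=> // l _ _.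
  apply: (le_trans bI); rewrite le_eqVlt; apply/orP; left; apply/eqP.
  apply: eq_integral => w _; congr _%:E.
  apply/eqP; rewrite eq_le; apply/andP; split.
    rewrite -(@node_prod0 _ _ rho (fun j _ => v j w) l)//; last first.
      by move=> j; exact: adm_ge0 (vb j) _.
    by rewrite -{1}[l]divn1; apply: (@node_prod_le_anc_max _ _ _ _ 0 0 0 l).
  apply: anc_max_le => [|k']; first by apply: prodr_ge0 => j _; exact: adm_ge0 (vb j) _.
  rewrite leqn0 /= => /eqP ->.
  by rewrite node_prod0// => j; exact: adm_ge0 (vb j) _.
have I0 : (0 <= \int[mu]_w (\prod_j v j w)%:E)%E.
  by apply: integral_ge0 => w _; rewrite lee_fin; apply: prodr_ge0 => j _;
    exact: adm_ge0 (vb j) _.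
case: (\int[mu]_w _)%E I0 H => [x|_ H|//].
  by rewrite !lee_fin => x0 /(_ x x0); apply.
have CP0 : 0 <= C * \prod_j b j.
  by rewrite mulr_ge0// prodr_ge0// => j _; exact: adm_bnd_ge0 (vb j).
(* Were the integral infinite, every [beta] would be allowed, in particular one larger than the
   bound. *)
have /(_ _ (leey _)) := H (C * \prod_j b j + 1).
by rewrite gerDl ler10 addr_ge0// => /(_ isT).
Qed.

Section node.
Variables (H i : nat) (v : 'I_n -> nat -> Omega -> R) (a : 'I_n -> nat -> R).
Hypothesis va : forall j l, (l %/ 2 ^ H = i)%N -> adm j (v j l) (a j l).

Let sub_node k l l' : (k <= H)%N -> (l %/ 2 ^ H = i)%N ->
  (l' %/ 2 ^ k = l %/ 2 ^ k)%N -> (l' %/ 2 ^ H = i)%N.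
Proof. by move=> kH <- E; rewrite !(@div2exp_anc k H)// E. Qed.

Lemma adm_node j k l : (k <= H)%N -> (l %/ 2 ^ H = i)%N ->
  adm j (fun w => nodemean k (l %/ 2 ^ k) (fun l => v j l w `^ rho j) `^ (rho j)^-1)
        (nodemean k (l %/ 2 ^ k) (fun l => a j l `^ rho j) `^ (rho j)^-1).
Proof.
by move=> kH lH; apply: adm_mean => l' l'E; apply: va; exact: sub_node l'E.
Qed.

Lemma measurable_node_prod k l : (k <= H)%N -> (l %/ 2 ^ H = i)%N ->
  measurable_fun setT (fun w => node_prod rho (fun j l => v j l w) k (l %/ 2 ^ k)).
Proof.
move=> kH lH; apply: measurable_prod => j _.
exact: adm_meas (adm_node j kH lH).
Qed.

Lemma int_node_prod k l : (k <= H)%N -> (l %/ 2 ^ H = i)%N ->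
  (\int[mu]_w (node_prod rho (fun j l => v j l w) k (l %/ 2 ^ k))%:E <=
   (C * node_prod rho a k (l %/ 2 ^ k))%:E)%E.
Proof.
by move=> kH lH; apply: adm_prod => j; exact: adm_node.
Qed.

Lemma measurable_vanc_max k H' l : (H' <= H)%N -> (l %/ 2 ^ H = i)%N ->
  measurable_fun setT (vanc_max v k H' l).
Proof.
move=> H'H lH; rewrite /vanc_max /anc_max.
have : forall k' : 'I_H'.+1, measurable_fun setT
   (fun w => node_prod rho (fun j l => v j l w) k' (l %/ 2 ^ k')).
  by move=> k'; apply: measurable_node_prod => //; apply: leq_trans H'H; rewrite -ltnS.
elim: (index_enum _) => [|k' s IH] mk.
  by under eq_fun do rewrite big_nil; exact: measurable_cst.
under eq_fun do rewrite big_cons; case: (_ <= _)%N; last exact: IH.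
by apply: measurable_maxr; [exact: mk|exact: IH].
Qed.

(** The maximum is at most the sum over the ancestors, whose terms have finite integrals by
    [int_node_prod]. Hence [fine] in [imax] loses nothing. *)
Lemma int_vanc_max_fin k H' l : (H' <= H)%N -> (l %/ 2 ^ H = i)%N ->
  (\int[mu]_w (vanc_max v k H' l w)%:E)%E \is a fin_num.
Proof.
move=> H'H lH; rewrite ge0_fin_numE; last first.
  by apply: integral_ge0 => w _; rewrite lee_fin anc_max_ge0.
apply: le_lt_trans (_ : (\int[mu]_w
  \sum_(k' < H'.+1) (node_prod rho (fun j l => v j l w) k' (l %/ 2 ^ k'))%:E < +oo)%E).
  apply: ge0_le_integral => //.
  - by move=> w _; rewrite lee_fin anc_max_ge0.
  - by apply/measurable_EFinP; exact: measurable_vanc_max.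
  - apply: emeasurable_sum => k'; apply/measurable_EFinP.
    by apply: measurable_node_prod => //; apply: leq_trans H'H; rewrite -ltnS.
  - by move=> w _; rewrite sumEFin lee_fin anc_max_le_sum.
rewrite ge0_integral_sum//=; first last.
- by move=> k' w _; rewrite lee_fin node_prod_ge0.
- move=> k'; apply/measurable_EFinP.
  by apply: measurable_node_prod => //; apply: leq_trans H'H; rewrite -ltnS.
apply: lte_sum_pinfty => k' _; apply: le_lt_trans (ltry _).
by apply: int_node_prod => //; apply: leq_trans H'H; rewrite -ltnS.
Qed.

Definition imax k H' l : R := fine (\int[mu]_w (vanc_max v k H' l w)%:E)%E.

Lemma imaxK k H' l : (H' <= H)%N -> (l %/ 2 ^ H = i)%N ->
  (imax k H' l)%:E = (\int[mu]_w (vanc_max v k H' l w)%:E)%E.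
Proof. by move=> *; rewrite fineK// int_vanc_max_fin. Qed.

Lemma le_imax k k' H1 H2 l : (k <= k')%N -> (H2 <= H1 <= H)%N ->
  (l %/ 2 ^ H = i)%N -> imax k' H2 l <= imax k H1 l.
Proof.
move=> kk' /andP[H21 H1H] lH; have H2H := leq_trans H21 H1H.
rewrite -lee_fin !imaxK//; apply: ge0_le_integral => //.
- by move=> w _; rewrite lee_fin anc_max_ge0.
- by apply/measurable_EFinP; exact: measurable_vanc_max.
- by apply/measurable_EFinP; exact: measurable_vanc_max.
- by move=> w _; rewrite lee_fin le_anc_max.
Qed.

Lemma imax_split k l : (k < H)%N -> (l %/ 2 ^ H = i)%N ->
  imax 0 H l <= imax 0 k l + imax k.+1 H l.
Proof.
move=> kH lH; rewrite -lee_fin EFinD !imaxK//; last exact: ltnW.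
rewrite -ge0_integralD//.
- apply: ge0_le_integral => //.
  + by move=> w _; rewrite lee_fin anc_max_ge0.
  + by apply/measurable_EFinP; exact: measurable_vanc_max.
  + by apply: emeasurable_funD; apply/measurable_EFinP; apply: measurable_vanc_max => //; exact: ltnW.
  + by move=> w _; rewrite -EFinD lee_fin anc_max_split.
- by move=> w _; rewrite lee_fin anc_max_ge0.
- by apply/measurable_EFinP; apply: measurable_vanc_max => //; exact: ltnW.
- by move=> w _; rewrite lee_fin anc_max_ge0.
- by apply/measurable_EFinP; exact: measurable_vanc_max.
Qed.

Lemma imax_node k l l' : (l %/ 2 ^ k = l' %/ 2 ^ k)%N -> imax k H l = imax k H l'.
Proof.
move=> ll'; rewrite /imax; suff -> : vanc_max v k H l = vanc_max v k H l' by [].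
apply/funext => w; apply: eq_anc_max => k' /andP[kk' _].
by rewrite (anc_eq kk' ll').
Qed.

Lemma imax_top l : (l %/ 2 ^ H = i)%N -> imax H H l <= C * node_prod rho a H i.
Proof.
move=> lH.
have h0 := @int_node_prod H l (leqnn H) lH.
move: h0.
have <- : node_prod rho a H (l %/ 2 ^ H) = node_prod rho a H i by rewrite lH.
rewrite -lee_fin.
rewrite (imaxK _ (leqnn H) lH).
apply: le_trans.
apply: ge0_le_integral => //.
- by move=> w _; rewrite lee_fin anc_max_ge0.
- by apply/measurable_EFinP; apply: measurable_vanc_max.
- by apply/measurable_EFinP; apply: measurable_node_prod.
- move=> w _; rewrite lee_fin; apply: anc_max_le => [|k']; first exact: node_prod_ge0.
  by rewrite andbC -eqn_leq => /eqP ->.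
Qed.

End node.

(** By the weak-type bound each of the [n] means exceeds [c] times its top value on at most the
    proportion [1 / c] of the leaves; altogether this is at most 1/4. *)
Let c : R := 4 * n.+1%:R.
Let B : R := 4 `^ e * C * \prod_j (2 * c) `^ (rho j)^-1.

Let c_ge1 : 1 <= c.
Proof. by rewrite /c -natrM ler1n. Qed.

Let prodc_ge1 : 1 <= \prod_j (2 * c) `^ (rho j)^-1.
Proof.
elim/big_ind : _ => [//|x y x1 y1|j _]; first by rewrite mulr_ege1.
apply: powR_ge1; last by rewrite invr_ge0 ltW.
by have := c_ge1; lra.
Qed.

Let B_ge : C <= B.
Proof.
rewrite /B -[leLHS]mulr1; apply: ler_pM => //; rewrite -[leLHS]mul1r.
by apply: ler_pM => //; apply: powR_ge1 => //; lra.
Qed.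

Let B0 : 0 <= B.
Proof. exact: le_trans B_ge. Qed.

Section stopping.
Variables (H i : nat) (v : 'I_n -> nat -> Omega -> R) (a : 'I_n -> nat -> R).
Hypothesis va : forall j l, (l %/ 2 ^ H = i)%N -> adm j (v j l) (a j l).
Hypothesis H0 : (0 < H)%N.

Let V j l : R := a j l `^ rho j.
Let m j : R := nodemean H i (V j).
Let P0 : R := node_prod rho a H i.

Let bad1 k i' := [exists j, c * m j < nodemean k i' (V j)].
(** The maximal function is evaluated at the first leaf of the node; by [imax_node] every leaf of
    the node gives the same value. *)
Let bad2 k i' := B * P0 < imax v k H (i' * 2 ^ k).
Let bad k i' := bad1 k i' || bad2 k i'.
Let hs1 l := [exists k : 'I_H, bad1 k (l %/ 2 ^ k)%N].
Let hs l := [exists k : 'I_H, bad k (l %/ 2 ^ k)%N].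

Let m_ge0 j : 0 <= m j.
Proof. by apply: nodemean_ge0 => l _; exact: powR_ge0. Qed.

Let P0_ge0 : 0 <= P0. Proof. exact: node_prod_ge0. Qed.

(** Means of order [rho j] over the maximal nodes marked by [bad1]. They are bounded by a multiple
    of the top means, as [tree_bound] requires, and agree with the original means along unmarked
    branches. *)
Definition vstopped j l w : R :=
  stopped bad1 H (fun l => v j l w `^ rho j) l `^ (rho j)^-1.

Let stop_lt bad' l : (stop_height bad' H l < H)%N.
Proof. by have [[->|[]]] := stop_heightP bad' H l. Qed.

(** The parent of the stopping node is the root or violates [bad1], so its mean is at most
    [c * m j]; passing to one of two children at most doubles a mean. *)
Let adm_vstopped j l : (l %/ 2 ^ H = i)%N ->
  adm j (vstopped j l) ((2 * c) `^ (rho j)^-1 * m j `^ (rho j)^-1).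
Proof.
move=> lH; have [_ sN] := stop_heightP bad1 H l.
apply: (adm_le (adm_node va j (ltnW (stop_lt bad1 l)) lH)).
have sH := stop_lt bad1 l; set s := stop_height _ _ _ in sN sH *.
have c0 : 0 <= c by exact: le_trans c_ge1.
have c20 : 0 <= 2 * c by rewrite mulr_ge0.
rewrite -(powRM _ c20 (m_ge0 j)).
apply: ge0_ler_powR.
- by rewrite invr_ge0 ltW.
- by rewrite nnegrE; apply: nodemean_ge0 => ? _; exact: powR_ge0.
- by rewrite nnegrE mulr_ge0// m_ge0.
apply: (le_trans (nodemean_parent _)) => [l' _|]; first exact: powR_ge0.
rewrite -div2expS -mulrA ler_pM2l//.
have := sH; rewrite -[(s < H)%N]/(s.+1 <= H)%N leq_eqVlt => /orP[/eqP sHE|sH'].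
  rewrite sHE lH -[X in X <= _]mul1r.
  exact: ler_wpM2r (m_ge0 j) _ _ c_ge1.
have := sN s.+1; rewrite ltnSn sH' negb_exists => /(_ isT)/forallP/(_ j).
by rewrite -leNgt.
Qed.

Let hs1P l : ~~ hs1 l -> forall k', (k' < H)%N -> ~~ bad1 k' (l %/ 2 ^ k').
Proof. by rewrite negb_exists => /forallP nb k' k'H; exact: (nb (Ordinal k'H)). Qed.

Let vanc_max_vstopped l : (l %/ 2 ^ H = i)%N -> ~~ hs1 l ->
  vanc_max vstopped 0 H l = vanc_max v 0 H l.
Proof.
move=> lH nb; apply/funext => w; apply: eq_anc_max => k /andP[_ kH].
apply: eq_bigr => j _; congr (_ `^ _); rewrite /nodemean; congr (_ / _).
rewrite -(@nodesum_stopped _ bad1 H (fun l => v j l w `^ rho j))//; last first.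
  move=> k' /andP[kk' k'H]; have := hs1P nb k'H.
  by rewrite (div2exp_anc l kk').
apply: eq_nodesum => l' _; rewrite /vstopped -powRrM mulVf ?gt_eqF// powRr1//.
by apply: nodemean_ge0 => ? _; exact: powR_ge0.
Qed.

(** The weak-type bound for each function, followed by a union bound over the [n] functions. *)
Let count1 : nodesum H i (fun l => (hs1 l)%:R) <= 2 ^+ H / 4 :> R.
Proof.
pose F j l : R := [exists k : 'I_H.+1, c * m j < nodemean k (l %/ 2 ^ k) (V j)]%:R.
have cgt0 : 0 < c by exact: lt_le_trans c_ge1.
have FV j : nodesum H i (F j) <= 2 ^+ H / c.
  have V0 l : (l %/ 2 ^ H = i)%N -> 0 <= V j l by move=> _; exact: powR_ge0.
  have := weak_type V0 (mulr_ge0 (ltW cgt0) (m_ge0 j)).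
  rewrite [leRHS]nodesum_nodemean -/(m j) -/(F j).
  (* With a vanishing top mean the weak-type inequality says nothing; but then all leaf values
     vanish and no mean exceeds 0. *)
  have [mj0|mj0] := eqVneq (m j) 0; last first.
    have mj : 0 < m j by rewrite lt_neqAle eq_sym mj0 m_ge0.
    by rewrite ler_pdivlMr// (mulrC c) -mulrA ler_pM2l// mulrC.
  have V00 l : (l %/ 2 ^ H = i)%N -> V j l = 0.
    have : nodesum H i (V j) == 0 by rewrite nodesum_nodemean -/(m j) mj0 mul0r.
    rewrite psumr_eq0 => [/allP Vz lH|l' _]; last exact: powR_ge0.
    have lr : (l %% 2 ^ H < 2 ^ H)%N by rewrite ltn_pmod// expn_gt0.
    have := Vz (Ordinal lr) (mem_index_enum _) => /eqP /=.
    by rewrite -lH -divn_eq.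
  move=> _; apply: le_trans (_ : nodesum H i (fun=> 0) <= _).
    apply: le_nodesum => l lH; rewrite /F; case: existsP => //= -[k].
    rewrite mj0 mulr0 /nodemean (_ : nodesum _ _ _ = 0) ?mul0r ?ltxx//.
    rewrite /nodesum big1// => l' _; apply: V00.
    rewrite -lH; apply: (@anc_eq k); first by rewrite -ltnS.
    by rewrite divnMDl ?expn_gt0// (@divn_small l') ?addn0.
  by rewrite nodesum_cst mul0r divr_ge0 ?exprn_ge0// ltW.
apply: le_trans (_ : \sum_j nodesum H i (F j) <= _).
  have -> : \sum_j nodesum H i (F j) = nodesum H i (fun l => \sum_j F j l).
    by rewrite /nodesum exchange_big.
  apply: le_nodesum => l _.
  have [/existsP[k /existsP[j bj]]|_] := boolP (hs1 l); last exact: sumr_ge0.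
  rewrite (bigD1 j)//=; suff -> : F j l = 1 by rewrite lerDl sumr_ge0.
  suff : [exists k : 'I_H.+1, c * m j < nodemean k (l %/ 2 ^ k) (V j)].
    by rewrite /F => ->.
  by apply/existsP; exists (widen_ord (leqnSn H) k).
apply: le_trans (_ : \sum_(j < n) 2 ^+ H / c <= _).
  by apply: ler_sum => j _; exact: FV.
rewrite sumr_const card_ord -[leLHS]mulr_natr -mulrA.
apply: ler_wpM2l; first exact: exprn_ge0.
rewrite /c invfM -mulrA ger_pMr ?invr_gt0// mulrC ler_pdivrMr// mul1r ler_nat.
exact: leqnSn.
Qed.

Let E l := ~~ hs1 l && [exists k : 'I_H, bad2 k (l %/ 2 ^ k)%N].

Let imax2 k l : (l %/ 2 ^ H = i)%N -> (k <= H)%N ->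
  imax v k H (l %/ 2 ^ k * 2 ^ k) = imax v k H l.
Proof. by move=> lH kH; apply: imax_node; rewrite mulnK// expn_gt0. Qed.

(** On [E] no mean is large, so stopping does not change the maximal function there. If [E] were
    larger than a quarter, [tree_bound] for the stopped functions would contradict the values above
    [B * P0] that [bad2] guarantees on [E]. *)
Let count2 : nodesum H i (fun l => (E l)%:R) <= 2 ^+ H / 4 :> R.
Proof.
rewrite leNgt; apply/negP => cE.
pose g (l : 'I_(2 ^ H)) := (i * 2 ^ H + l)%N.
have gH l : (g l %/ 2 ^ H = i)%N.
  by rewrite /g divnMDl ?expn_gt0// (@divn_small l) ?addn0.
have [l0 El0] : exists l0, E (g l0).
  apply/existsP; apply: contraTT cE; rewrite negb_exists => /forallP nE.
  rewrite -leNgt /nodesum big1 ?divr_ge0 ?exprn_ge0// => l _.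
  by have := nE l; rewrite /g => /negbTE ->.
(* [beta] is the least value of the integrated maximal function on the finite nonempty set [E];
   being attained, it is still strictly above [B * P0]. *)
have [l1 El1 l1P] := @arg_minP _ _ _ l0 (fun l => E (g l))
  (fun l => imax v 0 H (g l)) El0.
pose beta := imax v 0 H (g l1).
have beta0 : 0 <= beta.
  by rewrite fine_ge0// integral_ge0// => w _; rewrite lee_fin anc_max_ge0.
have betaE l : (l %/ 2 ^ H = i)%N -> E l ->
    (beta%:E <= \int[mu]_w (vanc_max vstopped 0 H l w)%:E)%E.
  move=> lH El; have /andP[nb _] := El; rewrite vanc_max_vstopped//.
  rewrite -(imaxK va _ (leqnn H) lH) lee_fin.
  have lr : (l %% 2 ^ H < 2 ^ H)%N by rewrite ltn_pmod// expn_gt0.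
  have lE : l = g (Ordinal lr) by rewrite /g /= -lH -divn_eq.
  by rewrite lE; apply: l1P; rewrite -lE.
have E0 : 0 < nodesum H i (fun l => (E l)%:R) :> R.
  by apply: le_lt_trans cE; rewrite divr_ge0 ?exprn_ge0.
have := tree_bound adm_vstopped beta0 betaE E0.
rewrite big_split /= -/(node_prod rho a H i) -/P0 => bP.
have : beta * (4^-1) `^ e <= C * ((\prod_j (2 * c) `^ (rho j)^-1) * P0).
  apply: le_trans bP; apply: ler_wpM2l => //; apply: ge0_ler_powR => //.
  - by rewrite nnegrE.
  - by rewrite nnegrE divr_ge0 ?exprn_ge0// ltW.
  - by rewrite ler_pdivlMr ?exprn_gt0// mulrC ltW.
have -> : (4^-1) `^ e = (4 `^ e)^-1 :> R.
  by rewrite -[4^-1]powR_inv1// -powRrM mulN1r powRN.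
rewrite ler_pdivrMr ?powR_gt0// => bP'.
have : B * P0 < beta.
  have /andP[_ /existsP[k kb]] := El1.
  move: kb; rewrite /bad2 (imax2 (gH l1) (ltnW (ltn_ord k))) => /lt_le_trans; apply.
  by apply: (le_imax va) => //; rewrite leqnn.
rewrite ltNge => /negP; apply; apply: le_trans bP' _.
by rewrite /B !mulrA [leRHS]mulrAC [in leRHS]mulrAC ![_ * 4 `^ e]mulrC !mulrA.
Qed.

Let count : nodesum H i (fun l => (hs l)%:R) <= 2 ^+ H / 2 :> R.
Proof.
apply: le_trans (_ : nodesum H i (fun l => (hs1 l)%:R + (E l)%:R) <= _).
  apply: le_nodesum => l _; rewrite -natrD ler_nat /E.
  have [//|h1] := boolP (hs1 l); first by case: hs.
  case: (boolP (hs l)) => // /existsP[k /orP[b1|b2]].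
    by move/negP: h1; case; apply/existsP; exists k.
  suff -> : [exists k : 'I_H, bad2 k (l %/ 2 ^ k)%N] by [].
  by apply/existsP; exists k.
rewrite nodesumD; have := lerD count1 count2; lra.
Qed.

Let st k l := max_marked bad H k l.

(** Split the maximal function at the stopping height. The heights above it contribute at most
    [B * P0], since the parent of the stopping node violates [bad2]; the heights up to it form the
    maximal function inside that node. *)
Let imax_stop l : (l %/ 2 ^ H = i)%N ->
  imax v 0 H l <= B * P0 + \sum_(k < H) (st k l)%:R * imax v 0 k l.
Proof.
move=> lH; have [s1 sN] := stop_heightP bad H l; have sH := stop_lt bad l.
have J0 k : 0 <= imax v 0 k l.
  by rewrite fine_ge0// integral_ge0// => w _; rewrite lee_fin anc_max_ge0.
have S0 (P : pred 'I_H) : 0 <= \sum_(k < H | P k) (st k l)%:R * imax v 0 k l.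
  by apply: sumr_ge0 => k _; rewrite mulr_ge0.
set s := stop_height bad H l in s1 sN sH.
(* Height 0 is also the default of [stop_height] when nothing on the branch is marked; then the
   unmarked leaf itself bounds the whole maximal function. *)
have [bs|nbs] := boolP (bad s (l %/ 2 ^ s)); last first.
  have s0 : s = 0%N by case: s1 => // -[_]; rewrite (negbTE nbs).
  have : ~~ bad2 0 (l %/ 2 ^ 0) by move: nbs; rewrite s0 negb_or => /andP[].
  by rewrite /bad2 (imax2 lH (leq0n H)) -leNgt => /le_trans; apply; rewrite lerDl.
apply: le_trans (imax_split va sH lH) _; rewrite addrC; apply: lerD; last first.
  rewrite (bigD1 (Ordinal sH))//= (_ : st s l) ?mul1r ?lerDl//.
  rewrite /st /max_marked bs; apply/forallP => k'; apply/implyP => sk'.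
  by apply: sN; rewrite sk' ltn_ord.
(* If the parent is the root, which is never tested for stopping, its single term is bounded by
   [imax_top]. *)
have := sH; rewrite -[(s < H)%N]/(s.+1 <= H)%N leq_eqVlt => /orP[/eqP sHE|sH'].
  rewrite sHE; apply: le_trans (imax_top va lH) _; exact: ler_wpM2r.
have := sN s.+1; rewrite ltnSn sH' negb_or => /(_ isT)/andP[_].
by rewrite /bad2 (imax2 lH sH) -leNgt.
Qed.

(** A branch contains at most one maximal marked node, so at most one summand is nonzero. *)
Let anc_max_stop l : \sum_(k < H) (st k l)%:R * anc_max rho a 0 k l <=
  (hs l)%:R * anc_max rho a 0 H l.
Proof.
have [/existsP[k stk]|] := boolP [exists k : 'I_H, st k l]; last first.
  rewrite negb_exists => /forallP nst; rewrite big1 ?mulr_ge0 ?anc_max_ge0//.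
  by move=> k _; rewrite (negbTE (nst k)) mul0r.
have -> : hs l by apply/existsP; exists k; case/andP : stk.
rewrite (bigD1 k)//= stk !mul1r big1 => [|k' k'k].
  by rewrite addr0; apply: le_anc_max => //; exact: ltnW.
case: (boolP (st k' l)); last by rewrite mul0r.
case/andP : stk => bk /forallP Nk /andP[bk' /forallP Nk'].
have := k'k; rewrite -val_eqE neq_ltn => /orP[lt|lt].
  by have := Nk' k; rewrite lt bk.
by have := Nk k'; rewrite lt bk'.
Qed.

Hypothesis IH : forall k i', (k < H)%N -> (i' %/ 2 ^ (H - k) = i)%N ->
  nodesum k i' (imax v 0 k) <= 2 * B * nodesum k i' (anc_max rho a 0 k).

(** The constant [2 * B] reproduces itself: the term [B * P0] is paid for by the leaves without
    marked ancestor below the root, where the scalar maximal function is at least [P0], and the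
    inner terms, by induction, by the other leaves. *)
Lemma stopping_step :
  nodesum H i (imax v 0 H) <= 2 * B * nodesum H i (anc_max rho a 0 H).
Proof.
apply: le_trans (le_nodesum imax_stop) _; rewrite nodesumD nodesum_cst.
have nsum (F : nat -> nat -> R) : nodesum H i (fun l => \sum_(k < H) F k l) =
    \sum_(k < H) nodesum H i (F k) by rewrite /nodesum exchange_big.
rewrite (nsum (fun k l => (st k l)%:R * imax v 0 k l)).
have step2 (k : 'I_H) : nodesum H i (fun l => (st k l)%:R * imax v 0 k l) <=
    2 * B * nodesum H i (fun l => (st k l)%:R * anc_max rho a 0 k l).
  rewrite -nodesumZ; apply: (@nodesum_refine _ _ _ k); first exact: ltnW.
  move=> i' i'E.
  have [b stE] := max_marked_node bad H k i'.
  rewrite (@eq_nodesum _ _ _ _ (fun l => b%:R * imax v 0 k l)); last first.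
    by move=> l lk; rewrite /st (stE l lk).
  rewrite (@eq_nodesum _ _ _ (fun l => 2 * B * _)
    (fun l => b%:R * (2 * B * anc_max rho a 0 k l))); last first.
    by move=> l lk; rewrite /st (stE l lk) mulrCA.
  rewrite !nodesumZ; apply: ler_wpM2l => //; exact: IH.
have {}step2 := ler_sum (index_enum 'I_H) (fun k (_ : true) => step2 k).
(* By [count] at least half of the leaves have no marked node above them; this is the origin of the
   factor 2. *)
have half : P0 * 2 ^+ H <= 2 * nodesum H i (fun l => (1 - (hs l)%:R) * P0).
  rewrite (@eq_nodesum _ _ _ _ (fun l => P0 + (- P0) * (hs l)%:R)); last first.
    by move=> l _; ring.
  rewrite nodesumD nodesum_cst nodesumZ.
  have := ler_wpM2l P0_ge0 count; lra.
apply: le_trans (lerD (_ : _ <= B * (2 * nodesum H i (fun l => (1 - (hs l)%:R) * P0))) step2) _.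
  by rewrite -mulrA; exact: ler_wpM2l.
rewrite -mulr_sumr -(nsum (fun k l => (st k l)%:R * anc_max rho a 0 k l)).
rewrite [B * _]mulrA [B * 2]mulrC -mulrDr -nodesumD.
apply: ler_wpM2l; first by rewrite mulr_ge0.
apply: le_nodesum => l lH.
apply: le_trans (lerD (_ : _ <= (1 - (hs l)%:R) * anc_max rho a 0 H l) (anc_max_stop l)) _.
  apply: ler_wpM2l; first by rewrite subr_ge0 lern1 leq_b1.
  by rewrite /P0 -{1}lH; apply: node_prod_le_anc_max; rewrite leqnn.
by rewrite -mulrDl subrK mul1r.
Qed.

End stopping.

Theorem tree_domination H i v a :
  (forall j l, (l %/ 2 ^ H = i)%N -> adm j (v j l) (a j l)) ->
  nodesum H i (imax v 0 H) <= 2 * B * nodesum H i (anc_max rho a 0 H).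
Proof.
elim/ltn_ind: H i v a => H IH i v a va.
have [H0|H0] := posnP H; last first.
  apply: stopping_step => // k i' kH i'E; apply: IH => // j l lk; apply: va.
  by rewrite (div2exp_anc l (ltnW kH)) lk.
rewrite H0 in va *; rewrite !nodesum0.
apply: le_trans (imax_top va _) _; first by rewrite expn0 divn1.
apply: ler_pM; rewrite ?node_prod_ge0//.
  by apply: le_trans B_ge _; have := B0; lra.
by rewrite -{1}(divn1 i); apply: (@node_prod_le_anc_max _ _ _ _ 0 0 0 i).
Qed.
End recursion.

(** * Trees of cells *)

Lemma odd_half_cases i : i = i./2.*2 \/ i = i./2.*2.+1.
Proof.
by have := odd_double_half i; case: odd => /= <-; [right|left];
  rewrite ?add0n ?add1n ?half_doubleS ?doubleK.
Qed.

Section cells.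
Context d (S : measurableType d) (R : realType).
Variable lam : {measure set S -> \bar R}.
Variables (H i0 : nat) (box : nat -> nat -> set S) (delta : R).

(* [(k, i)] is a node below the root [(H, i0)]. *)
Definition below_root k i : bool := (k <= H)%N && (i %/ 2 ^ (H - k) == i0)%N.

Hypothesis delta0 : 0 < delta.
Hypothesis mbox : forall k i, below_root k i -> measurable (box k i).
Hypothesis boxS : forall k i, below_root k.+1 i ->
  box k.+1 i = box k i.*2 `|` box k i.*2.+1.
Hypothesis box_disj : forall k i, below_root k.+1 i ->
  box k i.*2 `&` box k i.*2.+1 = set0.
Hypothesis box0 : forall l, below_root 0 l -> lam (box 0 l) = delta%:E.

Lemma below_root_child k i j : j./2 = i -> below_root k.+1 i -> below_root k j.
Proof.
move=> ji /andP[kH /eqP iE]; apply/andP; split; first exact: ltnW.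
by apply/eqP; rewrite -iE -ji (@div2exp_anc 1 (H - k)) ?subn_gt0// expn1 divn2 -subnDA addn1.
Qed.

Lemma below_root_parent k i : (k < H)%N -> below_root k i -> below_root k.+1 i./2.
Proof.
move=> kH /andP[_ /eqP iE]; apply/andP; split => //; apply/eqP.
by rewrite -iE [RHS](@div2exp_anc 1 (H - k)) ?subn_gt0// expn1 divn2 -subnDA addn1.
Qed.

Lemma below_rootP k i : (k <= H)%N -> below_root 0 (i * 2 ^ k) = below_root k i.
Proof.
move=> kH; rewrite /below_root kH /= subn0; congr (_ == _).
by rewrite (@div2exp_anc k)// mulnK// expn_gt0.
Qed.

Lemma below_root_anc k l : (k <= H)%N -> below_root 0 l ->
  below_root k (l %/ 2 ^ k).
Proof.
by move=> kH /andP[_ /eqP]; rewrite subn0 /below_root kH /= => <-; rewrite -div2exp_anc.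
Qed.

Lemma integral_box (F : S -> \bar R) (g : nat -> R) :
  measurable_fun setT F -> (forall x, 0 <= F x)%E ->
  (forall l, below_root 0 l -> (\int[lam]_(x in box 0 l) F x)%E = (delta * g l)%:E) ->
  forall k i, below_root k i ->
  (\int[lam]_(x in box k i) F x)%E = (delta * nodesum k i g)%:E.
Proof.
move=> mF F0 Fg; elim=> [|k IH] i bi; first by rewrite nodesum0 Fg.
have b1 : below_root k i.*2 by apply: below_root_child bi; rewrite doubleK.
have b2 : below_root k i.*2.+1 by apply: below_root_child bi; rewrite half_doubleS.
rewrite boxS// ge0_integral_setU//; first last.
- by apply/disj_setPS; rewrite box_disj.
- exact: measurable_funTS.
- exact: mbox.
- exact: mbox.
by rewrite !IH// nodesumS mulrDr.
Qed.

Lemma measure_box k i : below_root k i -> lam (box k i) = (delta * 2 ^+ k)%:E.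
Proof.
move=> bi; have := @integral_box (cst 1%E) (fun=> 1) (measurable_cst _) _ _ k i bi.
rewrite integral_cst ?mul1e; last exact: mbox.
rewrite nodesum_cst mul1r; apply=> // l bl.
by rewrite integral_cst ?mul1e ?box0 ?mulr1//; exact: mbox.
Qed.

(** All cells have measure [delta], so the mean over a box is the plain mean over its cells. Thus
    only the averages over cells matter, whatever space the boxes live in. *)
Lemma avg_box (rho : R) (h : S -> \bar R) (c : nat -> R) :
  0 < rho -> measurable_fun setT h -> (forall l, below_root 0 l -> 0 <= c l) ->
  (forall l, below_root 0 l -> avg lam rho (box 0 l) h = (c l)%:E) ->
  forall k i, below_root k i -> avg lam rho (box k i) h =
  (nodemean k i (fun l => c l `^ rho) `^ rho^-1)%:E.
Proof.
move=> rho0 mh c0 hc k i bi; rewrite /avg (measure_box bi).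
rewrite (@integral_box _ (fun l => c l `^ rho))//.
- rewrite inver gt_eqF ?mulr_gt0 ?exprn_gt0// -EFinM poweR_EFin; congr (_ `^ _)%:E.
  rewrite /nodemean; field.
  by rewrite !gt_eqF ?exprn_gt0.
- apply: (measurableT_comp (measurable_poweR _)).
  by apply: measurableT_comp.
- by move=> x; exact: poweR_ge0.
move=> l bl; have := hc l bl; rewrite /avg box0// inver gt_eqF//.
set J := (\int[lam]_(x in _) _)%E => E.
have J0 : (0 <= J)%E by apply: integral_ge0 => x _; exact: poweR_ge0.
have {}E : (delta^-1%:E * J = (c l `^ rho)%:E)%E.
  rewrite -poweR_EFin -E -poweRrM mulVf ?gt_eqF// poweRe1//.
  by rewrite mule_ge0// lee_fin invr_ge0 ltW.
by rewrite EFinM -E muleA -EFinM mulfV ?gt_eqF// mul1e.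
Qed.

Lemma box_parent k i x : (k < H)%N -> below_root k i -> box k i x ->
  box k.+1 i./2 x.
Proof.
move=> kH bi xi; rewrite boxS; last exact: below_root_parent.
by case: (odd_half_cases i) => E; [left|right]; rewrite -E.
Qed.

Lemma box_anc k l x : (k <= H)%N -> below_root 0 l -> box 0 l x ->
  box k (l %/ 2 ^ k) x.
Proof.
move=> kH bl lx; elim: k kH => [|k IH] kH; first by rewrite expn0 divn1.
have := IH (ltnW kH); have := below_root_anc (ltnW kH) bl.
rewrite div2expS; move: (l %/ 2 ^ k)%N => i bk xi; exact: box_parent.
Qed.

Lemma box_inj k i i' x : below_root k i -> below_root k i' ->
  box k i x -> box k i' x -> i = i'.
Proof.
have [n] := ubnP (H - k); elim: n k i i' => // n IH k i i' Hk bi bi' xi xi'.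
have : (k <= H)%N by case/andP: bi.
rewrite leq_eqVlt => /orP[/eqP kH|kH].
  have root j : below_root k j -> j = i0.
    by rewrite kH => /andP[_ /eqP]; rewrite subnn expn0 divn1.
  by rewrite (root _ bi) (root _ bi').
have E : i./2 = i'./2.
  apply: (IH k.+1); rewrite ?below_root_parent//; try exact: box_parent.
  by rewrite -ltnS subnSK.
have := box_disj (below_root_parent kH bi).
move=> /seteqP[/(_ x) D _].
case: (odd_half_cases i) => iE; case: (odd_half_cases i'); rewrite -E => i'E.
- by rewrite iE i'E.
- by exfalso; apply: D; split; [rewrite -iE|rewrite -i'E].
- by exfalso; apply: D; split; [rewrite -i'E|rewrite -iE].
- by rewrite iE i'E.
Qed.

Lemma box_leaf k i x : below_root k i -> box k i x ->
  exists2 l, below_root 0 l & box 0 l x.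
Proof.
elim: k i => [|k IH] i bi; first by exists i.
rewrite boxS// => -[]; apply: IH; apply: below_root_child bi;
  by rewrite ?doubleK ?half_doubleS.
Qed.

Lemma below_root_leaf (l : 'I_(2 ^ H)) : below_root 0 (i0 * 2 ^ H + l).
Proof.
by rewrite /below_root subn0 divnMDl ?expn_gt0// (@divn_small l)// addn0 eqxx.
Qed.

Lemma below_root_leafP l : below_root 0 l ->
  exists l' : 'I_(2 ^ H), l = (i0 * 2 ^ H + l')%N.
Proof.
move=> /andP[_ /eqP]; rewrite subn0 => lH.
have lr : (l %% 2 ^ H < 2 ^ H)%N by rewrite ltn_pmod// expn_gt0.
by exists (Ordinal lr); rewrite /= -lH -divn_eq.
Qed.

Definition cell_step (g : nat -> R) (x : S) : R :=
  \sum_(l < 2 ^ H) \1_(box 0 (i0 * 2 ^ H + l)) x * g (i0 * 2 ^ H + l)%N.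

Lemma cell_stepE g l x : below_root 0 l -> box 0 l x -> cell_step g x = g l.
Proof.
move=> bl lx; have [l' lE] := below_root_leafP bl.
rewrite /cell_step (bigD1 l')//= big1 => [|l1 l1l'].
  by rewrite -lE indicE mem_set// mul1r addr0.
rewrite indicE memNset ?mul0r// => l1x; move/eqP: l1l'; apply; apply/val_inj.
have := box_inj (below_root_leaf l1) bl l1x lx.
by rewrite lE => /addnI.
Qed.

Lemma cell_step0 g x : ~ box H i0 x -> cell_step g x = 0.
Proof.
move=> nx; apply: big1 => l _; rewrite indicE memNset ?mul0r// => lx; apply: nx.
have := box_anc (leqnn H) (below_root_leaf l) lx.
by rewrite divnMDl ?expn_gt0// (@divn_small l)// addn0.
Qed.

Lemma measurable_cell_step g : measurable_fun setT (cell_step g).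
Proof.
apply: measurable_sum => l; apply: measurable_funM; last exact: measurable_cst.
by apply: measurable_indic; apply: mbox; exact: below_root_leaf.
Qed.

Lemma cell_step_ge0 g x : (forall l, 0 <= g l) -> 0 <= cell_step g x.
Proof. by move=> g0; apply: sumr_ge0 => l _; rewrite mulr_ge0. Qed.

Lemma integral_cell_step g : (forall l, 0 <= g l) ->
  (\int[lam]_x (cell_step g x)%:E)%E = (delta * nodesum H i0 g)%:E.
Proof.
move=> g0; have bH : below_root H i0.
  by rewrite /below_root leqnn subnn expn0 divn1 eqxx.
rewrite -(@integral_box (EFin \o cell_step g) g _ _ _ H i0 bH).
- rewrite [RHS]integral_mkcond; apply: eq_integral => x _.
  rewrite /patch; case: ifPn => // /negP xH; rewrite cell_step0// => xH'.
  by apply: xH; rewrite inE.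
- by apply/measurable_EFinP; exact: measurable_cell_step.
- by move=> x; rewrite lee_fin cell_step_ge0.
move=> l bl; rewrite (eq_integral (cst (g l)%:E)).
  by rewrite integral_cst ?box0// ?EFinM ?(muleC (g l)%:E)//; exact: mbox.
by move=> x /set_mem lx /=; rewrite (cell_stepE g bl lx).
Qed.

(** The passage between the two models: over a tree of boxes the maximal function is a step function
    given by the discrete [anc_max]. It is applied to intervals of R, where the Hardy-Littlewood
    property lives, and to boxes of R^n. *)
Lemma multi_maximal_boxE n (rho : 'I_n -> R) (h : 'I_n -> S -> \bar R)
    (c : 'I_n -> nat -> R) (D : set (set S)) :
  (forall j, 0 < rho j) -> (forall j, measurable_fun setT (h j)) ->
  (forall j l, below_root 0 l -> 0 <= c j l) ->
  (forall j l, below_root 0 l -> avg lam (rho j) (box 0 l) (h j) = (c j l)%:E) ->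
  D = [set box p.1 p.2 | p in [set p | below_root p.1 p.2]] ->
  forall x, multi_maximal lam D rho h x =
    (cell_step (anc_max rho c 0 H) x)%:E.
Proof.
move=> rho0 mh c0 hc -> x.
have avgE k i : below_root k i -> (\prod_(j < n) avg lam (rho j) (box k i) (h j))%E =
    (node_prod rho c k i)%:E.
  move=> bi; rewrite /node_prod -prodEFin; apply: eq_bigr => j _.
  exact: (avg_box (rho0 j) (mh j) (c0 j) (hc j) bi).
apply/eqP; rewrite eq_le; apply/andP; split.
  apply: ge_ereal_sup => _ [->|[_ [[k i] /= bi <-] <-]].
    by rewrite lee_fin cell_step_ge0// => l; exact: anc_max_ge0.
  rewrite avgE// -EFinM lee_fin indicE.
  have [xi|xi] := boolP (x \in box k i); last first.
    by rewrite mulr0 cell_step_ge0// => l; exact: anc_max_ge0.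
  move/set_mem in xi; have [l bl lx] := box_leaf bi xi.
  have kH : (k <= H)%N by case/andP : bi.
  rewrite mulr1 (cell_stepE _ bl lx).
  rewrite (box_inj bi (below_root_anc kH bl) xi (box_anc kH bl lx)).
  exact: node_prod_le_anc_max.
have [xH|xH] := pselect (box H i0 x); last first.
  by rewrite cell_step0//; apply: ereal_sup_ubound; left.
have bH : below_root H i0 by rewrite /below_root leqnn subnn expn0 divn1 eqxx.
have [l bl lx] := box_leaf bH xH; rewrite (cell_stepE _ bl lx).
set M := multi_maximal _ _ _ _ _.
have M0 : (0 <= M)%E by apply: ereal_sup_ubound; left.
have MP k : (k <= H)%N -> ((node_prod rho c k (l %/ 2 ^ k))%:E <= M)%E.
  move=> kH; apply: ereal_sup_ubound; right.
  exists (box k (l %/ 2 ^ k)).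
    by exists (k, (l %/ 2 ^ k)%N) => //=; exact: below_root_anc.
  rewrite avgE; last exact: below_root_anc.
  by rewrite indicE mem_set ?mule1//; exact: box_anc.
case: M M0 MP => [M M0 MP|_ _|//]; last by rewrite leey.
by rewrite lee_fin; apply: anc_max_le => // k /andP[_ kH]; exact: MP.
Qed.

End cells.

(** * The Hardy-Littlewood property on a tree of intervals *)

Section nonneg_elements.
Context (R : realType) d (Omega : measurableType d).
Variable mu : {measure set Omega -> \bar R}.
Implicit Types (Y : fspace Omega R) (v : Omega -> R) (a : R).

Definition nnelt Y v a : Prop :=
  [/\ measurable_fun setT v, forall w, 0 <= v w, Y (real_fun v) &
      fnorm Y (real_fun v) <= a].

Lemma mem_zero Y : quasi_banach_fs mu Y -> Y (fun=> 0).
Proof.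
move=> qY; have [u Yu _] := qb_unit qY.
have := qb_scale qY 0 Yu; congr (fmem Y _).
by apply/funext => w; rewrite mul0r.
Qed.

Lemma fnorm_zero Y : quasi_banach_fs mu Y -> fnorm Y (fun=> 0) = 0.
Proof. by move=> qY; apply/(qb_norm_eq0 qY (mem_zero qY)); apply: nearW. Qed.

Lemma solid_real Y (u v : Omega -> R) : quasi_banach_fs mu Y -> measurable_fun setT u ->
  Y (real_fun v) -> {ae mu, forall w, `|u w| <= `|v w|} ->
  Y (real_fun u) /\ fnorm Y (real_fun u) <= fnorm Y (real_fun v).
Proof.
move=> qY mu_ Yv uv; apply: (qb_solid qY (proj2 (L0_real u) mu_) Yv).
by apply: filterS uv => w; rewrite !cabs_real.
Qed.

Lemma mem_sum Y (I : Type) (s : seq I) (xi : I -> Omega -> R[i]) :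
  quasi_banach_fs mu Y -> (forall k, Y (xi k)) ->
  Y (fun w => \sum_(k <- s) xi k w).
Proof.
move=> qY Yxi; elim: s => [|k s IH].
  by have := mem_zero qY; congr (fmem Y _); apply/funext => w; rewrite big_nil.
have := qb_add qY (Yxi k) IH; congr (fmem Y _).
by apply/funext => w; rewrite big_cons.
Qed.

Lemma real_funD v v' : real_fun (fun w => v w + v' w) =
  (fun w => real_fun v w + real_fun v' w).
Proof. by apply/funext => w; rewrite /real_fun rmorphD. Qed.

Lemma real_funZ a v : real_fun (fun w => a * v w) = (fun w => (a%:C)%C * real_fun v w).
Proof. by apply/funext => w; rewrite /real_fun rmorphM. Qed.

Lemma real_fun_sum (I : Type) (s : seq I) (v : I -> Omega -> R) :
  real_fun (fun w => \sum_(k <- s) v k w) = (fun w => \sum_(k <- s) real_fun (v k) w).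
Proof. by apply/funext => w; rewrite /real_fun rmorph_sum. Qed.

Lemma nnelt_ge0 Y v a : quasi_banach_fs mu Y -> nnelt Y v a -> 0 <= a.
Proof. by move=> qY [_ _ Yv]; apply: le_trans; exact: qb_norm_ge0 qY _ Yv. Qed.

Lemma nnelt_le Y v a b : nnelt Y v a -> a <= b -> nnelt Y v b.
Proof. by move=> [mv v0 Yv va] ab; split => //; exact: le_trans ab. Qed.

Lemma nnelt_weighted Y (rho : R) N (c a : 'I_N -> R) (v : 'I_N -> Omega -> R) :
  quasi_banach_fs mu Y -> 0 < rho -> pconvex rho Y -> (forall k, 0 <= c k) ->
  (forall k, nnelt Y (v k) (a k)) ->
  nnelt Y (fun w => (\sum_k c k * v k w `^ rho) `^ rho^-1)
          ((\sum_k c k * a k `^ rho) `^ rho^-1).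
Proof.
move=> qY rho0 cY c0 va.
have v0 k w : 0 <= v k w by have [] := va k.
have Yv k : Y (real_fun (v k)) by have [] := va k.
have rV0 : 0 <= rho^-1 by rewrite invr_ge0 ltW.
have mg : measurable_fun setT (fun w => (\sum_k c k * v k w `^ rho) `^ rho^-1).
  apply: measurable_powR_comp; apply: measurable_sum => k.
  apply: measurable_funM; first exact: measurable_cst.
  by apply: measurable_powR_comp; have [] := va k.
have S0 w : 0 <= \sum_k v k w by exact: sumr_ge0.
(* [pconvex] bounds the norm of the combination; its membership in [Y] follows from domination by a
   multiple of the sum of the [v k]. *)
have dom w : (\sum_k c k * v k w `^ rho) `^ rho^-1 <=
    (\sum_k c k) `^ rho^-1 * (\sum_k v k w).
  rewrite -[X in _ <= _ * X](powRK (S0 w) rho0).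
  rewrite -powRM ?sumr_ge0 ?powR_ge0//.
  apply: ge0_ler_powR => //; rewrite ?nnegrE.
  - by apply: sumr_ge0 => k _; rewrite mulr_ge0// powR_ge0.
  - by rewrite mulr_ge0 ?sumr_ge0 ?powR_ge0.
  rewrite mulr_suml; apply: ler_sum => k _; apply: ler_wpM2l => //.
  apply: ge0_ler_powR; rewrite ?nnegrE ?(ltW rho0)//.
  by rewrite (bigD1 k)//= lerDl sumr_ge0.
split => //.
- by move=> w; exact: powR_ge0.
- have YS : Y (real_fun (fun w => (\sum_k c k) `^ rho^-1 * (\sum_k v k w))).
    by rewrite real_funZ; apply: (qb_scale qY); rewrite real_fun_sum; exact: mem_sum.
  apply: (solid_real qY mg YS _).1; apply: nearW => w.
  by rewrite !ger0_norm ?powR_ge0// mulr_ge0// powR_ge0.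
pose xi k w := ((c k `^ rho^-1)%:C)%C * real_fun (v k) w.
have Yxi k : Y (xi k) by exact: (qb_scale qY).
have cxi k w : cabs (xi k w) `^ rho = c k * v k w `^ rho.
  rewrite /xi cabsM !cabs_real !ger0_norm ?powR_ge0// powRM ?powR_ge0//.
  by rewrite -powRrM mulVf ?gt_eqF// powRr1.
have := cY N xi Yxi.
under [X in real_fun X]eq_fun do under eq_bigr do rewrite cxi.
move/le_trans; apply; apply: ge0_ler_powR => //; rewrite ?nnegrE.
- by apply: sumr_ge0 => k _; exact: powR_ge0.
- by apply: sumr_ge0 => k _; rewrite mulr_ge0// powR_ge0.
apply: ler_sum => k _; rewrite /xi (qb_normZ qY)// cabs_real ger0_norm ?powR_ge0//.
have n0 := qb_norm_ge0 qY (Yv k).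
rewrite powRM ?powR_ge0// -powRrM mulVf ?gt_eqF// powRr1//.
apply: ler_wpM2l => //; have [_ _ _ ka] := va k.
apply: ge0_ler_powR; rewrite ?nnegrE ?(ltW rho0)//.
exact: le_trans ka.
Qed.

Lemma nnelt_nodemean Y (rho : R) k i (v : nat -> Omega -> R) (a : nat -> R) :
  quasi_banach_fs mu Y -> 0 < rho -> pconvex rho Y ->
  (forall l, (l %/ 2 ^ k = i)%N -> nnelt Y (v l) (a l)) ->
  nnelt Y (fun w => nodemean k i (fun l => v l w `^ rho) `^ rho^-1)
          (nodemean k i (fun l => a l `^ rho) `^ rho^-1).
Proof.
move=> qY rho0 cY va.
have := @nnelt_weighted Y rho (2 ^ k) (fun=> (2 ^+ k)^-1)
  (fun l => a (i * 2 ^ k + l)%N) (fun l => v (i * 2 ^ k + l)%N) qY rho0 cY.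
under [X in nnelt _ X]eq_fun do rewrite -mulr_sumr mulrC.
rewrite -[X in nnelt _ _ (X `^ _)]mulr_sumr [in X in nnelt _ _ X]mulrC; apply=> [l|l].
  by rewrite invr_ge0 exprn_ge0.
by apply: va; rewrite divnMDl ?expn_gt0// (@divn_small l)// addn0.
Qed.

End nonneg_elements.

Section interval_tree.
Variable R : realType.

Definition itv_box k i : set (measurableTypeR R) :=
  `[(i * 2 ^ k)%:R, (i.+1 * 2 ^ k)%:R[%classic.

Lemma measurable_itv_box k i : measurable (itv_box k i).
Proof. exact: measurable_itv. Qed.

Lemma itv_boxS k i : itv_box k.+1 i = itv_box k i.*2 `|` itv_box k i.*2.+1.
Proof.
rewrite /itv_box; have -> : (i * 2 ^ k.+1 = i.*2 * 2 ^ k)%N by rewrite expnS -muln2; lia.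
have -> : (i.+1 * 2 ^ k.+1 = i.*2.+2 * 2 ^ k)%N by rewrite expnS -muln2; lia.
have h1 : ((i.*2 * 2 ^ k)%:R <= (i.*2.+1 * 2 ^ k)%:R :> R).
  by rewrite ler_nat leq_mul2r leqnSn orbT.
have h2 : ((i.*2.+1 * 2 ^ k)%:R <= (i.*2.+2 * 2 ^ k)%:R :> R).
  by rewrite ler_nat leq_mul2r leqnSn orbT.
apply/seteqP; split => x /=; rewrite !in_itv /=.
  move=> /andP[-> xlt]; rewrite xlt andbT /=.
  by have [h|h] := ltP x (i.*2.+1 * 2 ^ k)%:R; [left|right].
move=> [] /andP[xa xb]; apply/andP; split => //.
  exact: lt_le_trans h2.
exact: le_trans xa.
Qed.

Lemma itv_box_disj k i : itv_box k i.*2 `&` itv_box k i.*2.+1 = set0.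
Proof.
apply/seteqP; split => x //= []; rewrite /itv_box /= !in_itv /= => /andP[_ h] /andP[h' _].
by have := lt_le_trans h h'; rewrite ltxx.
Qed.

Lemma itv_box0 l : @lebesgue_measure R (itv_box 0 l) = 1%:E.
Proof.
rewrite /itv_box expn0 !muln1 (lebesgue_measure_itv `[(l%:R : R), l.+1%:R[)/=.
by rewrite lte_fin ltr_nat ltnSn -EFinB -natrB// subSnn.
Qed.

Lemma intervals_itv_box k i : @intervals R (itv_box k i).
Proof.
exists (i * 2 ^ k)%:R, (2 ^ k)%:R; split; first by rewrite ltr0n expn_gt0.
by rewrite /itv_box -natrD mulSn addnC.
Qed.

Lemma finite_below_root H i0 (box : nat -> nat -> set (measurableTypeR R)) :
  finite_set [set box p.1 p.2 | p in [set p | below_root H i0 p.1 p.2]].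
Proof.
apply: finite_image.
apply: (@sub_finite_set _ _ [set (p.1, (p.2 %/ 2 ^ p.1)%N) |
    p in `I_H.+1 `*` `I_((i0 * 2 ^ H + 2 ^ H))]); last first.
  by apply: finite_image; apply: finite_setX; exact: finite_II.
move=> [k i] /= /andP[kH /eqP iE].
exists (k, (i * 2 ^ k)%N) => /=; last by rewrite mulnK// expn_gt0.
split; first exact: kH.
have := ltn_ceil i (_ : 0 < 2 ^ (H - k))%N; rewrite expn_gt0 /= iE => /(_ isT) h.
have -> : (2 ^ H = 2 ^ (H - k) * 2 ^ k)%N by rewrite -expnD subnK.
have := h; rewrite -(ltn_pmul2r (_ : 0 < 2 ^ k)%N) ?expn_gt0//.
by rewrite mulSn mulnDl addnC mulnA.
Qed.

End interval_tree.

Lemma powR_sum (R : realType) (I : Type) (s : seq I) (x : R) (F : I -> R) :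
  0 < x -> x `^ (\sum_(i <- s) F i) = \prod_(i <- s) x `^ F i.
Proof.
move=> x0; elim: s => [|i s IH]; first by rewrite !big_nil powRr0.
by rewrite !big_cons powRD ?IH//; apply/implyP => _; rewrite gt_eqF.
Qed.

Lemma lee_prod (R : realType) (I : Type) (s : seq I) (F G : I -> \bar R) :
  (forall i, 0 <= F i <= G i)%E ->
  (\prod_(i <- s) F i <= \prod_(i <- s) G i)%E.
Proof.
move=> FG.
suff : (0 <= \prod_(i <- s) F i <= \prod_(i <- s) G i)%E by case/andP.
elim/big_ind2 : _ => [|x1 x2 y1 y2 /andP[x0 xy] /andP[y0 yy]|i _]; last exact: FG.
  by rewrite lee01 lexx.
by rewrite mule_ge0//= lee_pmul.
Qed.

Section tree_bound.
Context (R : realType) d (Omega : measurableType d).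
Variable mu : {measure set Omega -> \bar R}.
Variables (n : nat) (rho : 'I_n -> R) (Y : 'I_n -> fspace Omega R).
Hypothesis hHL : HL mu rho Y.
(** The product space embeds into L^1 with constant 1. This holds when the last factor is the dual
    of the product of the others, see [int_le_enorm_dual]. *)
Hypothesis int_le_enorm : forall (u : Omega -> R) (F : Omega -> \bar R),
  measurable_fun setT u -> (forall w, 0 <= u w) -> (forall w, ((u w)%:E <= F w)%E) ->
  (\int[mu]_w (u w)%:E <= enorm mu (fs_product mu Y) F)%E.

Lemma vnorm_ge0 (X : fspace Omega R) xi : quasi_banach_fs mu X ->
  (0 <= vnorm X xi)%E.
Proof.
by move=> qX; rewrite /vnorm; case: asboolP => // Xxi; rewrite lee_fin (qb_norm_ge0 qX).
Qed.

(** The Hardy-Littlewood property is tested on step functions with value [v j l] on the unit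
    interval of the leaf [l]. Their L^p norms are at most [b j] times a power of the length
    [2 ^+ H], and dividing by these powers turns the measure of the set [ES] into a proportion. *)
Lemma HL_tree_bound : exists C e : R, [/\ 0 <= C, 0 <= e &
  forall H i (v : 'I_n -> nat -> Omega -> R) (b : 'I_n -> R),
  (forall j l, (l %/ 2 ^ H = i)%N -> nnelt (Y j) (v j l) (b j)) ->
  forall (E : nat -> bool) (beta : R), 0 <= beta ->
  (forall l, (l %/ 2 ^ H = i)%N -> E l ->
     (beta%:E <= \int[mu]_w (vanc_max rho v 0 H l w)%:E)%E) ->
  0 < nodesum H i (fun l => (E l)%:R : R) ->
  beta * (nodesum H i (fun l => (E l)%:R) / 2 ^+ H) `^ e <= C * \prod_j b j].
Proof.
have [[qY qP] rho0 cY [p [rp [C HC]]]] := hHL.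
have p0 j : (0 < p j)%E by apply: lt_trans (rp j); rewrite lte_fin.
pose e := \sum_j fine (p j)^-1.
have pV j : ((p j)^-1)%E = (fine (p j)^-1)%:E.
  rewrite fineK//; case: (p j) (p0 j) => [x|_|//] //.
  by rewrite lte_fin inver => x0; rewrite gt_eqF.
have pV0 j : 0 <= fine (p j)^-1 by rewrite fine_ge0// inve_ge0 ltW.
have e0 : 0 <= e by exact: sumr_ge0.
have hsV : ((hsum p)^-1)%E = e%:E.
  by rewrite /hsum inveK /e -sumEFin; apply: eq_bigr => j _; rewrite -pV.
have hs0 : (0 < hsum p)%E.
  rewrite -[hsum p]inveK hsV inver; case: eqP => [//|/eqP en0].
  by rewrite lte_fin invr_gt0 lt_neqAle eq_sym en0.
(* The constant in [HL] is an arbitrary real, possibly negative. *)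
exists (Num.max C 0), e; split => //; first by rewrite le_max lexx orbT.
move=> H i v b va E beta beta0 bE Epos.
have leafE (k : 'I_(2 ^ H)) : ((i * 2 ^ H + k) %/ 2 ^ H = i)%N.
  by rewrite divnMDl ?expn_gt0// (@divn_small k)// addn0.
have brE l : below_root H i 0 l -> (l %/ 2 ^ H = i)%N.
  by move=> /andP[_ /eqP]; rewrite subn0.
have b0 j : 0 <= b j.
  have h : (i * 2 ^ H %/ 2 ^ H = i)%N by rewrite mulnK// expn_gt0.
  exact: nnelt_ge0 (qY j) (va j _ h).
have mv j l : below_root H i 0 l -> measurable_fun setT (v j l).
  by move=> /brE lH; have [] := va j l lH.
have v0 j l w : below_root H i 0 l -> 0 <= v j l w.
  by move=> /brE lH; have [_] := va j l lH.
have Yv j l : below_root H i 0 l -> Y j (real_fun (v j l)).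
  by move=> /brE lH; have [_] := va j l lH.
have br (k : 'I_(2 ^ H)) := below_root_leaf i k.
pose box := @itv_box R.
have mbox k i' : below_root H i k i' -> measurable (box k i').
  by move=> _; exact: measurable_itv_box.
have boxS k i' : below_root H i k.+1 i' ->
  box k.+1 i' = box k i'.*2 `|` box k i'.*2.+1 by move=> _; exact: itv_boxS.
have boxD k i' : below_root H i k.+1 i' ->
  box k i'.*2 `&` box k i'.*2.+1 = set0 by move=> _; exact: itv_box_disj.
have box0 l : below_root H i 0 l -> lebesgue_measure (box 0 l) = 1%:E.
  by move=> _; exact: itv_box0.
have bH : below_root H i H i by rewrite /below_root leqnn subnn expn0 divn1 eqxx.
pose f j (x : measurableTypeR R) (w : Omega) : R[i] :=
  \sum_(k < 2 ^ H) (\1_(box 0 (i * 2 ^ H + k)%N) x)%:C%C *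
    real_fun (v j (i * 2 ^ H + k)%N) w.
have f_in j l x : below_root H i 0 l -> box 0 l x -> f j x = real_fun (v j l).
  move=> bl lx; have [l' lE] := below_root_leafP bl.
  apply/funext => w; rewrite /f (bigD1 l')//= big1 => [|l1 l1l'].
    by rewrite -lE indicE mem_set// mul1r addr0.
  rewrite indicE memNset ?mul0r// => l1x; move/eqP: l1l'; apply; apply/val_inj.
  have := box_inj boxS boxD (br l1) bl l1x lx.
  by rewrite lE => /addnI.
have f_out j x : ~ box H i x -> f j x = (fun=> 0).
  move=> nx; apply/funext => w; apply: big1 => k _.
  rewrite indicE memNset ?mul0r// => kx; apply: nx.
  by have := box_anc boxS (leqnn H) (br k) kx; rewrite leafE.
have Yf j x : Y j (f j x).
  by apply: (mem_sum _ (qY j)) => k; apply: (qb_scale (qY j)); exact: Yv.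
have f_simple j : simple_on setT (Y j) (f j).
  exists (2 ^ H)%N, (fun k : 'I_(2 ^ H) => box 0 (i * 2 ^ H + k)%N),
    (fun k : 'I_(2 ^ H) => real_fun (v j (i * 2 ^ H + k)%N)); split => // k.
    by split => //; exact: measurable_itv_box.
  exact: Yv.
have f_bound j x : (vnorm (Y j) (f j x) <= (b j)%:E * (\1_(box H i) x)%:E)%E.
  rewrite /vnorm asboolT// -EFinM lee_fin indicE.
  have [xH|xH] := boolP (x \in box H i); last first.
    rewrite mulr0 f_out ?(fnorm_zero (qY j))//.
    by move=> xH'; rewrite mem_set in xH.
  move/set_mem in xH; have [l bl lx] := box_leaf boxS bH xH.
  by rewrite mulr1 (f_in _ _ _ bl lx); have [_ _ _] := va j l (brE _ bl).
have f_norm j : (vLnorm lebesgue_measure (p j) (Y j) (f j) <=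
    (b j * (2 ^+ H) `^ fine (p j)^-1)%:E)%E.
  have mH := measure_box mbox boxS boxD box0 bH.
  have -> : 2 ^+ H = fine (@lebesgue_measure R (box H i)) by rewrite mH mul1r.
  apply: Lnorm_le_cst => //; first exact: mbox.
    by apply: le_lt_trans (ltry (1 * 2 ^+ H)); rewrite -mH.
  by move=> x; exact: vnorm_ge0 (qY j).
pose D : set (set (measurableTypeR R)) :=
  [set box q.1 q.2 | q in [set q | below_root H i q.1 q.2]].
have fLp j : vLp lebesgue_measure (p j) (Y j) (f j).
  split; last exact: le_lt_trans (f_norm j) (ltry _).
  split.
    apply: L0_sum => k; apply: L0_mul.
      have Ik := @L0_indic R _ (measurableTypeR R) _
        (measurable_itv_box 0 (i * 2 ^ H + k)).
      by have := L0_comp (@measurable_fst _ _ (measurableTypeR R) Omega) Ik.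
    have vk := proj2 (L0_real _) (mv j _ (br k)).
    by have := L0_comp (@measurable_snd _ _ (measurableTypeR R) Omega) vk.
  exists (fun=> f j); split => //; apply: nearW => x; split => //.
  have -> : (fun w => f j x w - f j x w) = (fun=> 0).
    by apply/funext => w; rewrite subrr.
  by rewrite (fnorm_zero (qY j)); exact: cvg_cst.
have Dint : D `<=` @intervals R.
  by move=> _ [[k i'] _ <-]; exact: intervals_itv_box.
have := HC D (finite_below_root H i box) Dint f fLp.
pose g l : R := (E l)%:R.
(* The union of the unit intervals whose leaf lies in [E], as a level set so that its measurability
   is immediate. *)
pose ES := [set x | cell_step H i box g x = 1].
have mES : measurable ES.
  rewrite /ES -[X in measurable X]setTI.
  have mst : measurable_fun setT (cell_step H i box g) by exact: measurable_cell_step.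
  by have := mst measurableT _ (measurable_set1 1).
have stepE x : cell_step H i box g x = \1_ES x.
  rewrite indicE; case: (boolP (x \in ES)) => [/set_mem//|/negP xES].
  have [xH|xH] := pselect (box H i x); last by rewrite cell_step0.
  have [l bl lx] := box_leaf boxS bH xH.
  have sE : cell_step H i box g x = g l by exact: cell_stepE bl lx.
  rewrite sE /g; case: (boolP (E l)) => // El; exfalso; apply: xES.
  by rewrite inE /ES /= sE /g El.
have ESm : lebesgue_measure ES = (nodesum H i g)%:E.
  rewrite -[ES]setIT -integral_indic//.
  under eq_integral do rewrite -stepE.
  by rewrite (integral_cell_step mbox boxS boxD box0) ?mul1r// => l; rewrite ler0n.
have lower x : ES x -> (beta%:E <= enorm mu (fs_product mu Y)
    (lattice_multi_maximal lebesgue_measure D rho f x))%E.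
  move=> xES; have [xH|xH] := pselect (box H i x); last first.
    by move: xES; rewrite /ES /= cell_step0// => /esym/eqP; rewrite oner_eq0.
  have [l bl lx] := box_leaf boxS bH xH.
  have El : E l.
    move: xES; rewrite /ES /= (cell_stepE boxS boxD _ bl lx) /g.
    by case: (E l) => // /esym/eqP; rewrite oner_eq0.
  apply: le_trans (bE l (brE _ bl) El) _; apply: int_le_enorm.
  - apply: (@measurable_vanc_max _ _ _ _ _ (fun j => nnelt (Y j)) _ _ _ _ _ _ va) => //.
      by move=> j u a [].
      by move=> j k i' u a; exact: (nnelt_nodemean (qY j)).
    exact: brE.
  - by move=> w; exact: anc_max_ge0.
  move=> w.
  rewrite /lattice_multi_maximal (@multi_maximal_boxE _ _ _ lebesgue_measure H i box 1
    ltr01 mbox boxS boxD box0 n rho _ (fun j l => v j l w))//.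
  - by rewrite lee_fin (cell_stepE boxS boxD _ bl lx).
  - move=> j; apply/measurable_EFinP; apply: L0_cabs; apply: L0_sum => k.
    apply: L0_mul; last exact: L0_cst.
    by apply: L0_indic; exact: measurable_itv_box.
  - by move=> j l' bl'; exact: v0.
  move=> j l' bl'; rewrite /avg [X in (X^-1 * _)%E](box0 _ bl') inve1 mul1e.
  rewrite (eq_integral (cst ((v j l' w) `^ rho j)%:E)).
    rewrite integral_cst; last exact: measurable_itv_box.
    by rewrite [X in (_ * X)%E](box0 _ bl') mule1 poweR_EFin powRK//; exact: v0.
  move=> y /set_mem ly; rewrite (f_in j l' y bl' ly) cabs_real /=.
  by rewrite !ger0_norm ?normr_ge0//; exact: v0.
have upper : (C%:E * \prod_(j < n) vLnorm lebesgue_measure (p j) (Y j) (f j) <=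
    (Num.max C 0 * ((\prod_j b j) * (2 ^+ H) `^ e))%:E)%E.
  apply: (@le_trans _ _ ((Num.max C 0)%:E *
      \prod_(j < n) vLnorm lebesgue_measure (p j) (Y j) (f j))%E).
    apply: lee_wpmul2r; last by rewrite lee_fin le_max lexx.
    by apply: prode_ge0 => j _; exact: Lnorm_ge0.
  rewrite EFinM; apply: lee_wpmul2l; first by rewrite lee_fin le_max lexx orbT.
  rewrite /e powR_sum ?exprn_gt0// -big_split/= -prodEFin.
  by apply: lee_prod => j; rewrite f_norm Lnorm_ge0.
move=> HCf; have {HCf} := le_trans HCf upper.
have ES0 : (0 < lebesgue_measure ES < +oo)%E by rewrite ESm lte_fin Epos ltry.
have [_ enorm_ge0] : True /\ forall x, (0 <= enorm mu (fs_product mu Y)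
    (lattice_multi_maximal lebesgue_measure D rho f x))%E.
  split=> // x; rewrite /enorm; case: asboolP => // _; exact: vnorm_ge0 qP.
move/(le_trans (cst_le_Lnorm hs0 mES ES0 beta0 enorm_ge0 lower)).
rewrite lee_fin hsV [X in fine X `^ _]ESm /= mulrA.
rewrite -[X in X `^ e](@divfK _ (2 ^+ H)) ?gt_eqF ?exprn_gt0//.
have N0 : 0 <= nodesum H i g / 2 ^+ H by rewrite divr_ge0 ?exprn_ge0 ?(ltW Epos).
rewrite [X in beta * X]powRM ?exprn_ge0// mulrA.
by rewrite ler_pM2r ?powR_gt0 ?exprn_gt0.
Qed.

Lemma HL_tree_domination : exists2 B : R, 0 <= B &
  forall H i (v : 'I_n -> nat -> Omega -> R) (a : 'I_n -> nat -> R),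
  (forall j l, (l %/ 2 ^ H = i)%N -> nnelt (Y j) (v j l) (a j l)) ->
  (\int[mu]_w (nodesum H i (fun l => vanc_max rho v 0 H l w))%:E <=
   (B * nodesum H i (anc_max rho a 0 H))%:E)%E.
Proof.
have [[qY qP] rho0 cY _] := hHL.
have [C [e [C0 e0 Hb]]] := HL_tree_bound.
have h1 (j : 'I_n) (v : Omega -> R) (a : R) :
  nnelt (Y j) v a -> measurable_fun [set: Omega] v by case.
have h2 (j : 'I_n) (v : Omega -> R) (a : R) :
  nnelt (Y j) v a -> forall w, 0 <= v w by case.
have h3 (j : 'I_n) (v : Omega -> R) (a : R) : nnelt (Y j) v a -> 0 <= a.
  exact: nnelt_ge0.
have h4 (j : 'I_n) (v : Omega -> R) (a b : R) : nnelt (Y j) v a -> a <= b ->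
  nnelt (Y j) v b by exact: nnelt_le.
have h5 (j : 'I_n) (k i : nat) (v : nat -> Omega -> R) (a : nat -> R) :
    (forall l, (l %/ 2 ^ k = i)%N -> nnelt (Y j) (v l) (a l)) ->
  nnelt (Y j) (fun w => nodemean k i (fun l => v l w `^ rho j) `^ (rho j)^-1)
        (nodemean k i (fun l => a l `^ rho j) `^ (rho j)^-1).
  exact: (nnelt_nodemean (qY j)).
exists (2 * (4 `^ e * C * \prod_j (2 * (4 * n.+1%:R)) `^ (rho j)^-1)).
  by rewrite !mulr_ge0 ?powR_ge0// prodr_ge0// => j _; exact: powR_ge0.
move=> H i v a va.
have leafE (k : 'I_(2 ^ H)) : ((i * 2 ^ H + k) %/ 2 ^ H = i)%N.
  by rewrite divnMDl ?expn_gt0// (@divn_small k)// addn0.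
have := tree_domination (mu := mu) rho0 h1 h2 h3 h4 h5 C0 e0 Hb va.
rewrite -lee_fin; apply: le_trans.
under eq_integral do rewrite /nodesum -sumEFin.
rewrite ge0_integral_sum//.
- rewrite /nodesum -sumEFin le_eqVlt; apply/orP; left; apply/eqP.
  apply: eq_bigr => k _.
  by rewrite (imaxK (mu := mu) rho0 h1 h2 h3 h5 C0 Hb va 0 (leqnn H) (leafE k)).
- move=> k; apply/measurable_EFinP.
  exact: (measurable_vanc_max (fun j => h1 j) h5 va 0 (leqnn H) (leafE k)).
- by move=> k w _; rewrite lee_fin anc_max_ge0.
Qed.

End tree_bound.

(** * Norming elements of the dual *)

Section hahn_banach.
Variables (R : realType) (W : lmodType R) (V : W -> Prop).
Hypothesis VD : forall x y, V x -> V y -> V (x + y).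
Hypothesis VZ : forall (t : R) x, V x -> V (t *: x).

Definition sublinear (q : W -> R) : Prop :=
  (forall x y, V x -> V y -> q (x + y) <= q x + q y) /\
  (forall t x, 0 < t -> V x -> q (t *: x) <= t * q x).

Let VN x : V x -> V (- x). Proof. by move=> Vx; rewrite -scaleN1r; exact: VZ. Qed.

Lemma sublinear0 q x : sublinear q -> V x -> q 0 = 0.
Proof.
move=> [_ qZ] Vx; have V0 : V 0 by rewrite -(scale0r x); exact: VZ.
have := qZ 2 0 (ltr0n R 2) V0; have := qZ 2^-1 0 (_ : 0 < 2^-1) V0.
rewrite !scaler0 invr_gt0 ltr0n => /(_ isT) h1 h2; lra.
Qed.

Lemma sublinear_ge q x : sublinear q -> V x -> - q (- x) <= q x.
Proof.
move=> sq Vx; have := sq.1 x (- x) Vx (VN Vx).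
by rewrite subrr (sublinear0 sq Vx); lra.
Qed.

Lemma sublinearZ q t x : sublinear q -> 0 < t -> V x -> q (t *: x) = t * q x.
Proof.
move=> sq t0 Vx; apply/eqP; rewrite eq_le sq.2//=.
have := sq.2 t^-1 (t *: x); rewrite invr_gt0 => /(_ t0 (VZ t Vx)).
by rewrite scalerA mulVf ?gt_eqF// scale1r mulrC ler_pdivlMr// mulrC.
Qed.

(** [lb] keeps the infimum finite. The two conditions make the family directed enough; they hold for
    chains of sublinear functionals and for the shifts in [shift_inf]. *)
Lemma sublinear_inf (I : Type) (i0 : I) (F : I -> W -> R) (lb : W -> R) :
  (forall i x, V x -> lb x <= F i x) ->
  (forall i j x y, V x -> V y -> exists k, F k (x + y) <= F i x + F j y) ->
  (forall i t x, 0 < t -> V x -> exists k, F k (t *: x) <= t * F i x) ->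
  let q := fun x => inf [set F i x | i in [set: I]] in
  sublinear q /\ forall i x, V x -> q x <= F i x.
Proof.
move=> Flb FD FZ q.
have qF i x : V x -> q x <= F i x.
  move=> Vx; apply: ge_inf; last by exists i.
  by exists (lb x) => _ [j _ <-]; exact: Flb.
have Fq x z : (forall i, z <= F i x) -> z <= q x.
  move=> zF; apply: lb_le_inf; first by exists (F i0 x); exists i0.
  by move=> _ [i _ <-].
split => //; split => [x y Vx Vy|t x t0 Vx].
- rewrite -lerBlDr; apply: (Fq) => i; rewrite lerBlDr -lerBlDl; apply: (Fq) => j.
  rewrite lerBlDl; have [k] := FD i j x y Vx Vy.
  exact/le_trans/qF/VD.
- rewrite mulrC -ler_pdivrMr//; apply: (Fq) => i; rewrite ler_pdivrMr// mulrC.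
  by have [k] := FZ i t x t0 Vx; exact/le_trans/qF/VZ.
Qed.

(** For sublinear [q] this lies below [q] (take t = 0) and is at most [- q y] at [- y] (take t = 1).
    Hence a sublinear functional below it takes the value [q y] at [y]. *)
Definition shift_inf (q : W -> R) (y x : W) : R :=
  inf [set (q (x + sval t *: y) - sval t * q y) | t in [set: {t : R | 0 <= t}]].

Lemma shift_infP q y : sublinear q -> V y ->
  sublinear (shift_inf q y) /\
  forall t x, 0 <= t -> V x -> shift_inf q y x <= q (x + t *: y) - t * q y.
Proof.
move=> sq Vy.
pose F (t : {t : R | 0 <= t}) x := q (x + sval t *: y) - sval t * q y.
have zero : {t : R | 0 <= t} by exists 0.
have [|||sF leF] := @sublinear_inf _ zero F (fun x => - q (- x)).
- move=> [t t0] x Vx; rewrite /F/=.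
  have -> : t * q y = q (t *: y).
    move: t0; rewrite le_eqVlt => /orP[/eqP <-|t0]; last by rewrite sublinearZ.
    by rewrite mul0r scale0r (sublinear0 sq Vy).
  have := sq.1 (x + t *: y) (- x) (VD Vx (VZ t Vy)) (VN Vx).
  by rewrite addrC addKr; lra.
- move=> [t t0] [t' t'0] x x' Vx Vx'.
  have tt' : 0 <= t + t' by rewrite addr_ge0.
  exists (exist _ (t + t') tt'); rewrite /F/= scalerDl addrACA.
  have := sq.1 (x + t *: y) (x' + t' *: y) (VD Vx (VZ t Vy)) (VD Vx' (VZ t' Vy)).
  lra.
- move=> [t t0] a x a0 Vx; have at0 : 0 <= a * t by rewrite mulr_ge0// ltW.
  exists (exist _ (a * t) at0); rewrite /F/= -scalerA -scalerDr.
  have := sq.2 a (x + t *: y) a0 (VD Vx (VZ t Vy)).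
  rewrite mulrBr mulrA; lra.
split => // t x t0 Vx; exact: (leF (exist _ t t0)).
Qed.

(** Minimal sublinear functionals are linear. Zorn's lemma is applied below [shift_inf p x0] instead
    of [p], which forces the value [p x0] at [x0]. *)
Theorem hahn_banach (p : W -> R) (x0 : W) : sublinear p -> V x0 ->
  exists phi : W -> R, [/\ forall x y, V x -> V y -> phi (x + y) = phi x + phi y,
    forall t x, V x -> phi (t *: x) = t * phi x,
    forall x, V x -> phi x <= p x & phi x0 = p x0].
Proof.
move=> sp Vx0; have [sp0 p0le] := shift_infP sp Vx0.
pose T := {q : W -> R | sublinear q /\ forall x, V x -> q x <= shift_inf p x0 x}.
have t0 : T by exists (shift_inf p x0).
pose Rel (q1 q2 : T) := `[< forall x, V x -> sval q2 x <= sval q1 x >].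
have [|||[q [sq qle]] qmax] := @ZL_preorder T t0 Rel.
- by move=> q; apply/asboolP.
- move=> q1 q2 q3 /asboolP h1 /asboolP h2; apply/asboolP => x Vx.
  exact: le_trans (h2 x Vx) (h1 x Vx).
- move=> A totA; have [[a Aa]|A0] := pselect (exists a, A a); last first.
    by exists t0 => s As; exfalso; apply: A0; exists s.
  pose F (s : {s : T | A s}) := sval (sval s).
  have [|||sF leF] := @sublinear_inf _ (exist _ a Aa) F (fun x => - shift_inf p x0 (- x)).
  + move=> [[s [ss sle]] As] x Vx; rewrite /F/=.
    apply: le_trans (sublinear_ge ss Vx); rewrite lerN2; exact/sle/VN.
  + move=> [s As] [s' As'] x y Vx Vy; rewrite /F/=.
    have [/asboolP h|/asboolP h] := totA s s' As As'.
      exists (exist _ s' As') => /=; apply: le_trans ((svalP s').1.1 x y Vx Vy) _.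
      by rewrite lerD2r h.
    exists (exist _ s As) => /=; apply: le_trans ((svalP s).1.1 x y Vx Vy) _.
    by rewrite lerD2l h.
  + move=> [s As] t x t_gt0 Vx; exists (exist _ s As) => /=.
    exact: (svalP s).1.2.
  pose q x := inf [set F i x | i in [set: {s : T | A s}]].
  have qT : sublinear q /\ forall x, V x -> q x <= shift_inf p x0 x.
    split => // x Vx; apply: le_trans (leF (exist _ a Aa) x Vx) _.
    exact: (svalP a).2.
  exists (exist _ q qT : T) => s As; apply/asboolP => x Vx /=.
  exact: (leF (exist _ s As)).
have qmin q' : sublinear q' -> (forall x, V x -> q' x <= q x) ->
    forall x, V x -> q x <= q' x.
  move=> sq' q'q.
  have q'T : sublinear q' /\ forall x, V x -> q' x <= shift_inf p x0 x.
    by split => // x Vx; apply: le_trans (q'q x Vx) (qle x Vx).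
  have := qmax (exist _ q' q'T : T); rewrite /Rel /= => h x Vx.
  have /asboolP := h (introT (asboolP _) q'q); exact.
(* By minimality [q] is not above [shift_inf q y], and t = 1 gives superadditivity. *)
have qD x y : V x -> V y -> q (x + y) = q x + q y.
  move=> Vx Vy; apply/eqP; rewrite eq_le sq.1//=.
  have [ss sle] := shift_infP sq Vy.
  have h x' : V x' -> shift_inf q y x' <= q x'.
    by move=> Vx'; have := sle 0 x' (lexx _) Vx'; rewrite scale0r addr0 mul0r subr0.
  have := qmin _ ss h x Vx; have := sle 1 x ler01 Vx; rewrite scale1r mul1r.
  lra.
have q0 : q 0 = 0 := sublinear0 sq Vx0.
have qN x : V x -> q (- x) = - q x.
  move=> Vx; have := qD x (- x) Vx (VN Vx); rewrite subrr q0; lra.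
exists q; split => //.
- move=> t x Vx; have [t_lt0|t_gt0|->] := ltgtP t 0.
  + rewrite -[t]opprK scaleNr qN; last exact: VZ.
    by rewrite sublinearZ ?oppr_gt0// !mulNr.
  + exact: sublinearZ.
  + by rewrite scale0r mul0r.
- move=> x Vx; apply: le_trans (qle x Vx) _.
  by have := p0le 0 x (lexx _) Vx; rewrite scale0r addr0 mul0r subr0.
- apply/eqP; rewrite eq_le; apply/andP; split.
    apply: le_trans (qle x0 Vx0) _.
    by have := p0le 0 x0 (lexx _) Vx0; rewrite scale0r addr0 mul0r subr0.
  have := qle (- x0) (VN Vx0); have := p0le 1 (- x0) ler01 (VN Vx0).
  rewrite scale1r addNr mul1r (sublinear0 sp Vx0) qN//; lra.
Qed.

End hahn_banach.

Lemma cabs_cintegral_le (R : realType) d (Omega : measurableType d)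
    (mu : {measure set Omega -> \bar R}) (f : Omega -> R[i]) :
  L0 f -> mu.-integrable setT (fun w => (cabs (f w))%:E) ->
  cabs (cintegral mu f) <= Rintegral mu setT (fun w => cabs (f w)).
Proof.
move=> [mr mi] fint.
have re_le (z : R[i]) : `|complex.Re z| <= cabs z.
  by rewrite cabsE -sqrtr_sqr ler_wsqrtr// lerDl sqr_ge0.
have im_le (z : R[i]) : `|complex.Im z| <= cabs z.
  by rewrite cabsE -sqrtr_sqr ler_wsqrtr// lerDr sqr_ge0.
have ri : mu.-integrable setT (EFin \o (fun w => complex.Re (f w))).
  apply: le_integrable fint => //; first exact/measurable_EFinP.
  by move=> w _; rewrite /= lee_fin [leRHS]ger0_norm ?cabs_ge0.
have ii : mu.-integrable setT (EFin \o (fun w => complex.Im (f w))).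
  apply: le_integrable fint => //; first exact/measurable_EFinP.
  by move=> w _; rewrite /= lee_fin [leRHS]ger0_norm ?cabs_ge0.
set z := cintegral mu f; have z0 := cabs_ge0 z.
have [zz|] := eqVneq (cabs z) 0.
  by rewrite zz Rintegral_ge0// => w _; exact: cabs_ge0.
move=> zn0; have zgt0 : 0 < cabs z by rewrite lt_neqAle eq_sym zn0.
have zsq : cabs z ^+ 2 = complex.Re z ^+ 2 + complex.Im z ^+ 2.
  by rewrite cabsE sqr_sqrtr// addr_ge0 ?sqr_ge0.
(* The square of |z| is Re z times the integral of Re f plus Im z times that of Im f; the combined
   integrand is at most |z| |f| by the Cauchy-Schwarz inequality in the plane. *)
rewrite -(ler_pM2l zgt0) -expr2 zsq.
have CS (a b : R[i]) : complex.Re a * complex.Re b + complex.Im a * complex.Im b <=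
    cabs a * cabs b.
  have := re_le ((a^*)%C * b); rewrite cabsM.
  have -> : cabs (a^*)%C = cabs a by rewrite !cabsE; case: a => x y /=; rewrite sqrrN.
  move/(le_trans (ler_norm _)); case: a b => [x y] [x' y'] /=.
  by rewrite mulNr opprK.
rewrite [X in X ^+ 2 + _ <= _]/= [X in _ + X ^+ 2 <= _]/= !expr2.
rewrite -[X in X + _ <= _]RintegralZl// -[X in _ + X <= _]RintegralZl//.
rewrite -RintegralD//; last 2 first.
- by have := integrableZl measurableT (complex.Re z) ri.
- by have := integrableZl measurableT (complex.Im z) ii.
rewrite -RintegralZl//; apply: le_Rintegral => //.
- exact: (integrableD measurableT (integrableZl measurableT (complex.Re z) ri)
    (integrableZl measurableT (complex.Im z) ii)).
- by have := integrableZl measurableT (cabs z) fint.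
by move=> w _; exact: (CS z (f w)).
Qed.

(** * Positive norming functionals and their densities *)

Section order_continuous_functional.
Context (R : realType) d (Omega : measurableType d).
Variable mu : {sigma_finite_measure set Omega -> \bar R}.
Variable Y : fspace Omega R.
Hypotheses (bY : banach_fs mu Y) (ocY : order_continuous mu Y).
Let qY : quasi_banach_fs mu Y := bY.1.
Let W : Type := Omega -> R^o.
Implicit Types x y : Omega -> R.

Let V (x : Omega -> R) : Prop := Y (real_fun x).

Let V_meas x : V x -> measurable_fun setT x.
Proof. by move=> /(qb_L0 qY)/L0_real. Qed.

Let V_D x y : V x -> V y -> V (fun w => x w + y w).
Proof. by move=> Vx Vy; rewrite /V real_funD; exact: (qb_add qY). Qed.

Let V_Z (t : R) x : V x -> V (fun w => t * x w).
Proof. by move=> Vx; rewrite /V real_funZ; exact: (qb_scale qY). Qed.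

Let V_solid x y : measurable_fun setT x -> V y ->
  (forall w, `|x w| <= `|y w|) -> V x.
Proof. by move=> mx Vy xy; apply: (solid_real qY mx Vy _).1; exact: nearW. Qed.

Let norm_solid x y : measurable_fun setT x -> V y ->
  {ae mu, forall w, `|x w| <= `|y w|} ->
  fnorm Y (real_fun x) <= fnorm Y (real_fun y).
Proof. by move=> mx Vy xy; exact: (solid_real qY mx Vy _).2. Qed.

Let pos x : Omega -> R := fun w => Num.max (x w) 0.

Let norm_pos_le x w : `|pos x w| <= `|x w|.
Proof. by rewrite /pos; case: (leP (x w) 0) => _; rewrite ?normr0. Qed.

Let V_pos x : V x -> V (pos x).
Proof.
move=> Vx; apply: (V_solid _ Vx).
  by apply: measurable_maxr; [exact: (V_meas Vx)|exact: measurable_cst].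
by move=> w; exact: norm_pos_le.
Qed.

(** The norm of the positive part is used as the majorant because a linear functional below it is
    automatically positive: on [- x] with [x] nonnegative it is at most 0. *)
Let sublinear_pos : @sublinear R (Omega -> R^o) V (fun x => fnorm Y (real_fun (pos x))).
Proof.
split=> [x y Vx Vy|t x t0 Vx].
  apply: le_trans (bY.2 _ _ (V_pos Vx) (V_pos Vy)); rewrite -real_funD.
  apply: norm_solid; last 1 first.
  - apply: nearW => w; rewrite /pos -[(x + y) w]/(x w + y w).
    rewrite !ger0_norm ?addr_ge0 ?le_max ?lexx ?orbT//.
    by rewrite ge_max addr_ge0 ?le_max ?lexx ?orbT// lerD// le_max lexx.
  - by apply: V_meas; apply: V_pos; exact: V_D.
  - by apply: V_D; exact: V_pos.
have -> : pos (t *: x) = (fun w => t * pos x w).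
  by apply/funext => w; rewrite /pos maxr_pMr ?mulr0// ltW.
by rewrite real_funZ (qb_normZ qY) ?cabs_real ?gtr0_norm//; exact: V_pos.
Qed.

Variable xi0 : Omega -> R.
Hypotheses (Vxi0 : Y (real_fun xi0)) (xi0_ge0 : forall w, 0 <= xi0 w).

Let norming_functional : exists phi : (Omega -> R) -> R,
  [/\ forall x y, V x -> V y -> phi (fun w => x w + y w) = phi x + phi y,
      forall (t : R) x, V x -> phi (fun w => t * x w) = t * phi x,
      forall x, V x -> (forall w, 0 <= x w) -> 0 <= phi x,
      forall x, V x -> `|phi x| <= fnorm Y (real_fun x) &
      phi xi0 = fnorm Y (real_fun xi0)].
Proof.
have [phi [phiD phiZ phip phixi]] :=
  @hahn_banach R (Omega -> R^o) V V_D V_Z _ xi0 sublinear_pos Vxi0.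
have ple x : V x -> fnorm Y (real_fun (pos x)) <= fnorm Y (real_fun x).
  move=> Vx; apply: norm_solid => //; first exact/V_meas/V_pos.
  by apply: nearW => w; exact: norm_pos_le.
have phiN x : V x -> phi (fun w => - x w) = - phi x.
  move=> Vx; have := phiZ (-1) x Vx; rewrite mulN1r => <-; congr phi.
  by apply/funext => w; rewrite /= scaleN1r.
have VN x : V x -> V (fun w => - x w).
  move=> Vx; have := V_Z (-1) Vx; congr V.
  by apply/funext => w; rewrite mulN1r.
exists phi; split => //.
- move=> x Vx x0; rewrite -oppr_le0 -phiN//; apply: le_trans (phip _ (VN _ Vx)) _.
  have -> : pos (fun w => - x w) = (fun=> 0).
    by apply/funext => w; rewrite /pos max_r// oppr_le0.
  have -> : real_fun (fun _ : Omega => 0 : R) = (fun=> 0) by [].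
  by rewrite (fnorm_zero qY).
- move=> x Vx; rewrite ler_norml; apply/andP; split.
    rewrite lerNl -phiN//; apply: le_trans (phip _ (VN _ Vx)) _.
    apply: le_trans (ple _ (VN _ Vx)) _; apply: norm_solid => //.
      by apply: V_meas; exact: VN.
    by apply: nearW => w; rewrite normrN.
  exact: le_trans (phip x Vx) (ple x Vx).
rewrite phixi; congr (fnorm Y (real_fun _)).
by apply/funext => w; rewrite /pos max_l.
Qed.

Section representation.
Variable phi : (Omega -> R) -> R.
Hypothesis phiD : forall x y, V x -> V y ->
  phi (fun w => x w + y w) = phi x + phi y.
Hypothesis phiZ : forall (t : R) x, V x -> phi (fun w => t * x w) = t * phi x.
Hypothesis phi_ge0 : forall x, V x -> (forall w, 0 <= x w) -> 0 <= phi x.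
Hypothesis phi_norm : forall x, V x -> `|phi x| <= fnorm Y (real_fun x).

Let V0 : V (fun=> 0). Proof. exact: (mem_zero qY). Qed.

Let phi0 : phi (fun=> 0) = 0.
Proof.
rewrite -[RHS](mul0r (phi (fun=> 0))) -phiZ//; congr phi.
by apply/funext => w; rewrite mul0r.
Qed.

Let phi_sum I (s : seq I) (x : I -> Omega -> R) : (forall i, V (x i)) ->
  V (fun w => \sum_(i <- s) x i w) /\
  phi (fun w => \sum_(i <- s) x i w) = \sum_(i <- s) phi (x i).
Proof.
move=> Vx; elim: s => [|i s [IH1 IH2]].
  rewrite big_nil (_ : (fun _ => _) = (fun=> 0)) ?phi0//.
  by apply/funext => w; rewrite big_nil.
rewrite (_ : (fun w => \sum_(j <- i :: s) x j w) =
  (fun w => x i w + \sum_(j <- s) x j w)).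
  by rewrite big_cons phiD// IH2; split => //; exact: V_D.
by apply/funext => w; rewrite big_cons.
Qed.

(** Order continuity of the norm enters here; it is what makes [nu] below countably additive. *)
Let phi_oc (xin : nat -> Omega -> R) x :
  (forall n, measurable_fun setT (xin n)) -> V x ->
  (forall n w, 0 <= xin n w) ->
  (forall w, {homo (fun n => xin n w) : k l / (k <= l)%N >-> k <= l}) ->
  (forall w, (fun n => xin n w) @ \oo --> x w) ->
  (fun n => phi (xin n)) @ \oo --> phi x.
Proof.
move=> mxin Vx xin0 ndxin cvxin.
have xinx n w : xin n w <= x w.
  rewrite -(cvg_lim (@Rhausdorff R) (cvxin w)).
  apply: nondecreasing_cvgn_le; last by apply: cvgP; exact: cvxin.
  exact: ndxin.
have Vxin n : V (xin n).
  apply: (V_solid (mxin n) Vx) => w; rewrite !ger0_norm//.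
  exact: le_trans (xinx n w).
have dE n : phi (fun w => xin n w - x w) = phi (xin n) - phi x.
  have -> : (fun w => xin n w - x w) = (fun w => xin n w + (-1) * x w).
    by apply/funext => w; rewrite mulN1r.
  by rewrite phiD ?phiZ ?mulN1r//; exact: V_Z.
have Vd n : V (fun w => xin n w - x w).
  have -> : (fun w => xin n w - x w) = (fun w => xin n w + (-1) * x w).
    by apply/funext => w; rewrite mulN1r.
  by apply: V_D => //; exact: V_Z.
have cv0 : fnorm Y (real_fun (fun w => xin n w - x w)) @[n --> \oo] --> (0 : R).
  by apply: ocY => //; apply: nearW => w; split => // n; exact: xin0.
apply/subr_cvg0/cvgrPdist_le => eps eps0.
near=> n; rewrite sub0r normrN -dE; apply: le_trans (phi_norm (Vd n)) _.
near: n; have /cvgrPdist_le/(_ _ eps0) := cv0.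
by apply: filterS => n; rewrite sub0r normrN; exact/le_trans/ler_norm.
Unshelve. all: by end_near.
Qed.

Variable u : Omega -> R.
Hypotheses (Vu : V u) (u_gt0 : forall w, 0 < u w).

Let V_indic A : measurable A -> V (fun w => u w * \1_A w).
Proof.
move=> mA; apply: (V_solid _ Vu).
  by apply: measurable_funM; [exact: V_meas|exact: measurable_indic].
move=> w; rewrite normrM -[leRHS]mulr1 ler_wpM2l// ger0_norm//.
Qed.

(** The weight [u] brings every indicator into the space and makes the measure finite. The value 0
    on nonmeasurable sets keeps [nu] nonnegative on all sets. *)
Let nu (A : set Omega) : \bar R :=
  if `[< measurable A >] then (phi (fun w => u w * \1_A w))%:E else 0%E.

Let nuE A : measurable A -> nu A = (phi (fun w => u w * \1_A w))%:E.
Proof. by move=> mA; rewrite /nu asboolT. Qed.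

Let nu0 : nu set0 = 0%E.
Proof.
rewrite nuE// (_ : (fun w => _) = (fun=> 0)) ?phi0//.
by apply/funext => w; rewrite indic0 mulr0.
Qed.

Let nu_ge0 A : (0 <= nu A)%E.
Proof.
rewrite /nu; case: asboolP => // mA; rewrite lee_fin.
by apply: phi_ge0 => [|w]; [exact: V_indic|rewrite mulr_ge0// ltW].
Qed.

Let nu_sigma_additive : semi_sigma_additive nu.
Proof.
move=> F mF tF mUF.
pose xin n w := \sum_(i < n) u w * \1_(F i) w.
have E n : (\sum_(0 <= i < n) nu (F i))%E = (phi (xin n))%:E.
  rewrite big_mkord; under eq_bigr do rewrite nuE//.
  by rewrite sumEFin -(phi_sum _ (fun i : 'I_n => V_indic (mF i))).2.
have t0 i w : 0 <= u w * \1_(F i) w by rewrite mulr_ge0// ltW.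
rewrite nuE// (_ : (fun n => _) = (fun n => (phi (xin n))%:E)); last exact/funext.
apply: cvg_EFin; first exact: nearW; apply: phi_oc.
- move=> n; apply: measurable_sum => i.
  by apply: measurable_funM; [exact: V_meas|exact: measurable_indic].
- exact: V_indic.
- by move=> n w; exact: sumr_ge0.
- move=> w k l kl; rewrite /xin -!(big_mkord predT (fun i => u w * \1_(F i) w)).
  by rewrite (big_cat_nat (leq0n k) kl)/= lerDl; apply: sumr_ge0.
move=> w; apply: cvg_near_cst.
have [[k _ kw]|nw] := pselect ((\bigcup_n F n) w); last first.
  apply: nearW => n; rewrite [in RHS]indicE memNset// mulr0 /xin big1// => i _.
  by rewrite indicE memNset ?mulr0// => iw; apply: nw; exists i.
exists k.+1 => // n /= kn; rewrite [in RHS]indicE mem_set; last by exists k.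
rewrite mulr1 /xin (bigD1 (Ordinal kn))//= indicE mem_set// mulr1 big1 ?addr0//.
move=> i ik; rewrite indicE memNset ?mulr0// => iw; move/eqP: ik; apply.
apply/val_inj => /=; move/trivIsetP: tF => /(_ i k I I) tik.
by apply/eqP/negPn/negP => /tik /seteqP[/(_ w) + _]; apply.
Qed.

HB.instance Definition _ := isMeasure.Build _ _ _ nu nu0 nu_ge0 nu_sigma_additive.

Let nu_fin : fin_num_fun nu.
Proof. by move=> A mA; rewrite nuE. Qed.

HB.instance Definition _ := Measure_isFinite.Build _ _ _ nu nu_fin.

Let nu_dom : nu `<< mu.
Proof.
apply/null_content_dominatesP => A mA muA0; rewrite nuE//; congr _%:E.
apply/eqP; rewrite -normr_le0; apply: le_trans (phi_norm (V_indic mA)) _.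
suff -> : fnorm Y (real_fun (fun w => u w * \1_A w)) = 0 by [].
apply/(qb_norm_eq0 qY (V_indic mA)); exists A; split => // w /= h.
apply: contrapT => nA; apply: h.
by rewrite /real_fun indicE memNset ?mulr0.
Qed.

Let nu_int_nnsfun (g : {nnsfun Omega >-> R}) :
  (\int[nu]_w (g w)%:E)%E = (phi (fun w => u w * g w))%:E.
Proof.
rewrite integralT_nnsfun sintegralE fsbig_finite//=.
pose s := finmap.enum_fset (fset_set (range g)).
have Vr (r : R) : V (fun w => u w * \1_(g @^-1` [set r]) w).
  by apply: V_indic; exact: measurable_sfunP.
rewrite (eq_bigr (fun r : R => (r * phi (fun w => u w * \1_(g @^-1` [set r]) w))%:E)).
  rewrite sumEFin; congr _%:E.
  under eq_bigr do rewrite -phiZ//.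
  rewrite -(phi_sum _ (fun r => V_Z r (Vr r))).2; congr phi; apply/funext => w.
  rewrite [in RHS](fimfunE g w) fsbig_finite//= mulr_sumr.
  by apply: eq_bigr => r _; rewrite mulrCA.
by move=> r _; rewrite nuE ?EFinM//; exact: measurable_sfunP.
Qed.

Let measurable_invu : measurable_fun setT (fun w => (u w)^-1).
Proof.
under eq_fun do rewrite -powR_inv1 ?ltW//.
by apply: measurable_powR_comp; exact: V_meas.
Qed.

(** The density is that of [nu] divided by [u]. Writing x = u g turns the left side into the
    integral of g against [nu], which is evaluated on simple functions and extended by monotone
    convergence on one side and [phi_oc] on the other. *)
Lemma functional_repr : exists2 h : Omega -> R,
  measurable_fun setT h /\ (forall w, 0 <= h w) &
  forall x, V x -> (forall w, 0 <= x w) ->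
    (\int[mu]_w (x w * h w)%:E)%E = (phi x)%:E.
Proof.
pose f := Radon_Nikodym_SigmaFinite.f nu mu.
have f0 w : (0 <= f w)%E by exact: Radon_Nikodym_SigmaFinite.f_ge0.
have ffin w : f w \is a fin_num by exact: Radon_Nikodym_SigmaFinite.f_fin_num.
have mf : measurable_fun setT f.
  by apply: measurable_int; exact: Radon_Nikodym_SigmaFinite.f_integrable.
exists (fun w => fine (f w) / u w).
  split; last by move=> w; rewrite divr_ge0 ?fine_ge0 ?f0 ?(ltW (u_gt0 w)).
  apply: measurable_funM; last exact: measurable_invu.
  exact: (measurableT_comp (fine_measurable measurableT)).
move=> x Vx x0; pose g w := x w / u w.
have mg : measurable_fun setT g.
  by apply: measurable_funM; [exact: V_meas|exact: measurable_invu].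
have g0 w : 0 <= g w by rewrite divr_ge0 ?x0 ?(ltW (u_gt0 w)).
transitivity (\int[mu]_w ((g w)%:E * f w))%E.
  apply: eq_integral => w _; rewrite -(fineK (ffin w)) -EFinM; congr _%:E.
  by rewrite /g mulrA mulrAC.
rewrite Radon_Nikodym_SigmaFinite.change_of_variables//; last exact/measurable_EFinP.
have mEg : measurable_fun setT (EFin \o g) by exact/measurable_EFinP.
pose s := nnsfun_approx measurableT mEg.
have s_cvg w : (fun n => s n w) @ \oo --> g w.
  have := @cvg_nnsfun_approx _ _ _ _ measurableT _ mEg
    (fun w _ => g0 w : (0 <= (EFin \o g) w)%E) w I.
  by move=> /fine_cvgP[].
have s_nd : nondecreasing_seq (s : (Omega -> R)^nat).
  exact: nd_nnsfun_approx.
have s_ndw w : {homo (fun n => s n w) : k l / (k <= l)%N >-> k <= l}.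
  by move=> k l kl; have /lefP := s_nd _ _ kl; exact.
have cvphi : (fun n => phi (fun w => u w * s n w)) @ \oo --> phi x.
  apply: phi_oc => //.
  - by move=> n; apply: measurable_funM => //; exact: V_meas.
  - by move=> n w; rewrite mulr_ge0// ltW.
  - by move=> w k l kl; rewrite ler_wpM2l ?s_ndw// ltW.
  move=> w; have -> : x w = u w * g w by rewrite /g mulrC divfK// gt_eqF.
  by apply: cvgMl_tmp; exact: s_cvg.
have cvint : (fun n => \int[nu]_w (s n w)%:E)%E @ \oo --> (\int[nu]_w (g w)%:E)%E.
  have -> : (\int[nu]_w (g w)%:E = \int[nu]_w limn (fun n => (s n w)%:E))%E.
    apply: eq_integral => w _; apply/esym/cvg_lim => //.
    by apply: cvg_EFin; [exact: nearW|exact: s_cvg].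
  apply: (@cvg_monotone_convergence _ _ _ nu _ measurableT (fun n w => (s n w)%:E)).
  - by move=> n; apply/measurable_EFinP.
  - by move=> n w _; rewrite lee_fin.
  - by move=> w _ k l kl; rewrite lee_fin s_ndw.
apply: cvg_unique cvint _ => //.
have cvphiE : (fun n => (phi (fun w => u w * s n w))%:E) @ \oo --> (phi x)%:E.
  by apply: cvg_EFin; [exact: nearW|exact: cvphi].
apply: cvg_trans cvphiE; apply: near_eq_cvg; apply: nearW => n.
by symmetry; exact: (nu_int_nnsfun (s n)).
Qed.

End representation.

Let pos_unit : exists2 u : Omega -> R, V u & forall w, 0 < u w.
Proof.
have [u Vu u0] := qb_unit qY; have mu_ := V_meas Vu.
(* The unit of the space is positive almost everywhere only; changing it to 1 on the exceptional set
   makes division by it safe. *)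
exists (fun w => if 0 < u w then u w else 1); last by move=> w; case: ifP.
apply: (solid_real qY _ Vu _).1; last first.
  by apply: filterS u0 => w u0w; rewrite u0w.
apply: measurable_fun_ifT => //; apply: measurable_fun_ltr => //.
Qed.

(** The functional lives on real-valued elements. Complex elements of the unit ball are estimated
    through their moduli, which have no larger norm. *)
Theorem norming_dual_element : exists2 h : Omega -> R,
  nnelt (fs_dual mu Y) h 1 &
  (\int[mu]_w (xi0 w * h w)%:E)%E = (fnorm Y (real_fun xi0))%:E.
Proof.
have [phi [phiD phiZ phi_ge0 phi_norm phixi]] := norming_functional.
have [u Vu u0] := pos_unit.
have [h [mh h0] hphi] := functional_repr phiD phiZ phi_ge0 phi_norm Vu u0.
exists h; last by rewrite hphi// phixi.
have absV xi : Y xi -> V (fun w => cabs (xi w)) /\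
    fnorm Y (real_fun (fun w => cabs (xi w))) <= fnorm Y xi.
  move=> Yxi; apply: (qb_solid qY _ Yxi).
    by apply/L0_real; exact: L0_cabs (qb_L0 qY Yxi).
  by apply: nearW => w; rewrite cabs_real ger0_norm ?cabs_ge0.
have cabsh xi w : cabs (xi w * real_fun h w) = cabs (xi w) * h w.
  by rewrite cabsM cabs_real ger0_norm.
have absint xi : Y xi ->
    (\int[mu]_w (cabs (xi w * real_fun h w))%:E)%E = (phi (fun w => cabs (xi w)))%:E.
  move=> Yxi; under eq_integral do rewrite cabsh.
  by apply: hphi => [|w]; [exact: (absV _ Yxi).1|exact: cabs_ge0].
have L0xih xi : Y xi -> L0 (fun w => xi w * real_fun h w).
  by move=> Yxi; apply: L0_mul; [exact: qb_L0 qY _ Yxi|exact/L0_real].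
have integ xi : Y xi -> mu.-integrable setT (fun w => (cabs (xi w * real_fun h w))%:E).
  move=> Yxi; apply/integrableP; split.
    by apply/measurable_EFinP; exact: L0_cabs (L0xih _ Yxi).
  under eq_integral do rewrite gee0_abs ?lee_fin ?cabs_ge0//.
  by rewrite absint// ltry.
have dual_le : ubound (fs_dual_values mu Y (real_fun h)) 1.
  move=> _ [xi [Yxi xi1] <-]; rewrite /pairing.
  apply: le_trans (cabs_cintegral_le (L0xih _ Yxi) (integ _ Yxi)) _.
  rewrite /Rintegral absint//=.
  apply: le_trans (ler_norm _) _; apply: le_trans (phi_norm _ (absV _ Yxi).1) _.
  exact: le_trans (absV _ Yxi).2 xi1.
split => //.
  split; [exact/L0_real|exact: integ|by exists 1].
apply: ge_sup => //; exists (cabs (pairing mu (fun=> 0) (real_fun h))).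
exists (fun=> 0) => //; split; first exact: (mem_zero qY).
by rewrite (fnorm_zero qY).
Qed.

End order_continuous_functional.

(** * Cubes and shifted grids *)

Section boxes.
Variables (R : realType) (n : nat).
Hypothesis n0 : (0 < n)%N.
Local Notation lam := (lebesgue_Rd R n).

Definition obox (a l : 'I_n -> R) : set (Rd R n) :=
  [set t | forall j, a j <= tnth t j < a j + l j].

Lemma measurable_obox a l : measurable (obox a l).
Proof.
rewrite (_ : obox a l = \bigcap_(j : 'I_n)
    ((@tnth n (measurableTypeR R))^~ j @^-1` `[a j, a j + l j[%classic)).
  apply: fin_bigcap_measurable => // j _.
  by rewrite -[X in measurable X]setTI; apply: measurable_tnth.
apply/seteqP; split=> t /= tB j.
  by move=> _; rewrite /= in_itv /=; exact: tB.
by have := tB j I; rewrite /= in_itv.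
Qed.

Lemma measure_obox a l : (forall j, 0 <= l j) -> lam (obox a l) = (\prod_j l j)%:E.
Proof.
move=> l0; rewrite lebesgue_Rd_box; last by move=> j; rewrite lerDl.
by congr _%:E; apply: eq_bigr => j _; rewrite addrC addKr.
Qed.

(* The top box is a cube of side length [S] with corner [c]. Step [t] halves
   coordinate [t %% n]; [halvings t j] counts the halvings of coordinate [j]
   before step [t]. *)
Variables (c : 'I_n -> R) (S : R) (K : nat).
Hypothesis S0 : 0 < S.

Definition halvings t (j : 'I_n) : nat := \sum_(t' < t) (t' %% n == j :> nat)%N.

Definition side t j : R := S / 2 ^+ halvings t j.

(** The binary digits of [i], the leading one first, are the successive choices between lower and
    upper half. *)
Fixpoint corner t i (j : 'I_n) : R :=
  if t is t'.+1 then
    corner t' i./2 j + (odd i && (t' %% n == j :> nat)%N)%:R * side t j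
  else c j.

Definition tree_box k i : set (Rd R n) :=
  obox (corner (K * n - k) i) (side (K * n - k)).

Lemma halvingsS t j : halvings t.+1 j = (halvings t j + (t %% n == j :> nat))%N.
Proof. by rewrite /halvings big_ord_recr. Qed.

Lemma halvings_mul t j : halvings (t * n) j = t.
Proof.
elim: t => [|t IH]; first by rewrite mul0n /halvings big_ord0.
rewrite mulSn addnC /halvings big_split_ord /= -/(halvings _ _) IH.
rewrite (bigD1 j)//= modnMDl modn_small// eqxx big1 ?addn0 ?addn1// => s sj.
by rewrite modnMDl modn_small//; apply/eqP; rewrite eqb0.
Qed.

Lemma side_gt0 t j : 0 < side t j.
Proof. by rewrite divr_gt0// exprn_gt0. Qed.

Lemma sideS t j : side t j = (1 + (t %% n == j :> nat)%N%:R) * side t.+1 j.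
Proof.
rewrite /side halvingsS; case: (_ == _) => /=.
  by rewrite addn1 exprS -natr1; field; rewrite gt_eqF ?exprn_gt0.
by rewrite addn0 addr0 mul1r.
Qed.

Lemma corner_grid t i j : exists z : nat, corner t i j = c j + z%:R * side t j.
Proof.
elim: t i => [|t IH] i; first by exists 0%N; rewrite /= mul0r addr0.
have [z zE] := IH i./2.
exists (z * (1 + (t %% n == j :> nat)) + (odd i && (t %% n == j :> nat)))%N.
by rewrite /= zE sideS natrD natrM natrD; ring.
Qed.

Lemma measurable_tree_box k i : measurable (tree_box k i).
Proof. exact: measurable_obox. Qed.

Lemma tree_boxS k i : (k < K * n)%N ->
  tree_box k.+1 i = tree_box k i.*2 `|` tree_box k i.*2.+1.
Proof.
move=> kH; rewrite /tree_box -(subnSK kH); set t := (K * n - k.+1)%N.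
have t_lt : (t %% n < n)%N by rewrite ltn_pmod.
apply/seteqP; split => x.
  move=> xb; have [h|h] := ltP (tnth x (Ordinal t_lt))
      (corner t i (Ordinal t_lt) + side t.+1 (Ordinal t_lt)).
    left => j; have := xb j; rewrite /= odd_double doubleK /= mul0r addr0 (sideS t).
    case: (eqVneq (t %% n)%N j) => [tj|_] /=; last by rewrite addr0 mul1r.
    have <- : Ordinal t_lt = j by exact/val_inj.
    by move=> /andP[-> _].
  right => j; have := xb j; rewrite /= odd_double uphalf_double /= (sideS t).
  case: (eqVneq (t %% n)%N j) => [tj|_] /=; last by rewrite addr0 mul0r mul1r addr0.
  have <- : Ordinal t_lt = j by exact/val_inj.
  by move=> /andP[_ h2]; apply/andP; split; [move: h|move: h2]; lra.
have ge0 := fun j => ltW (side_gt0 t.+1 j).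
case=> xb j; have := xb j; rewrite /= odd_double ?doubleK ?uphalf_double (sideS t) /=;
  have g0 := ge0 j; case: (_ == _) => /= /andP[h1 h2]; apply/andP; split; lra.
Qed.

Lemma tree_box_disj k i : (k < K * n)%N ->
  tree_box k i.*2 `&` tree_box k i.*2.+1 = set0.
Proof.
move=> kH; rewrite /tree_box -(subnSK kH); set t := (K * n - k.+1)%N.
have t_lt : (t %% n < n)%N by rewrite ltn_pmod.
apply/seteqP; split => // x [] /(_ (Ordinal t_lt)) + /(_ (Ordinal t_lt)).
rewrite /= odd_double doubleK uphalf_double /= eqxx /=.
by move=> /andP[h1 h2] /andP[h3 h4]; exfalso; lra.
Qed.

Definition cell_volume : R := \prod_j side (K * n) j.

Lemma cell_volume_gt0 : 0 < cell_volume.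
Proof. by apply: prodr_gt0 => j _; exact: side_gt0. Qed.

Lemma measure_tree_box0 l : lam (tree_box 0 l) = cell_volume%:E.
Proof. by rewrite /tree_box subn0 measure_obox// => j; exact/ltW/side_gt0. Qed.

Lemma side_mul t j : side (t * n) j = S / 2 ^+ t.
Proof. by rewrite /side halvings_mul. Qed.

Lemma cubes_tree_box t i : (t <= K)%N -> cubes (tree_box ((K - t) * n) i).
Proof.
move=> tK; rewrite /tree_box -mulnBl subKn//.
exists (corner (t * n) i), (S / 2 ^+ t); split; first by rewrite divr_gt0// exprn_gt0.
by apply/seteqP; split => x xb j; have := xb j; rewrite side_mul.
Qed.

Lemma measure_cube_box t i : (t <= K)%N ->
  lam (tree_box ((K - t) * n) i) = ((S / 2 ^+ t) ^+ n)%:E.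
Proof.
move=> tK; rewrite /tree_box -mulnBl subKn// measure_obox => [|j].
  under eq_bigr do rewrite side_mul.
  by rewrite prodr_const card_ord.
exact/ltW/side_gt0.
Qed.

Lemma below_top k i : below_root (K * n) 0 k.+1 i -> (k < K * n)%N.
Proof. by case/andP. Qed.

Lemma tree_box_top i : tree_box (K * n) i = obox c (fun=> S).
Proof.
rewrite /tree_box subnn; congr obox; apply/funext => j.
by rewrite /side /halvings big_ord0 expr0 divr1.
Qed.

(* The ancestor of a node at the next height divisible by [n] is a cube. *)
Lemma tree_box_sub_cube k i : below_root (K * n) 0 k i ->
  exists Q, [/\ cubes Q, tree_box k i `<=` Q &
    (lam Q <= (2 ^+ n)%:E * lam (tree_box k i))%E].
Proof.
move=> bki; have kH : (k <= K * n)%N by case/andP : bki.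
pose t := ((K * n - k) %/ n)%N.
have tK : (t <= K)%N by rewrite /t -[leqRHS](@mulnK _ n)// leq_div2r// leq_subr.
pose k' := ((K - t) * n)%N.
have k'H : (k' <= K * n)%N by rewrite /k' leq_mul2r leq_subr orbT.
have tn : (t * n <= K * n - k)%N by exact: leq_divM.
have kk' : (k <= k')%N.
  by rewrite /k' mulnBl leq_subRL ?leq_mul2r ?tK ?orbT// addnC -leq_subRL.
have k'k : (k' <= k + n)%N.
  rewrite /k' mulnBl leq_subLR addnCA -leq_subLR.
  by rewrite addnC -mulSn ltnW// ltn_ceil.
have mbox k1 i1 : below_root (K * n) 0 k1 i1 -> measurable (tree_box k1 i1).
  by move=> _; exact: measurable_tree_box.
have boxS k1 i1 : below_root (K * n) 0 k1.+1 i1 ->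
  tree_box k1.+1 i1 = tree_box k1 i1.*2 `|` tree_box k1 i1.*2.+1.
  by move=> /below_top; exact: tree_boxS.
have boxD k1 i1 : below_root (K * n) 0 k1.+1 i1 ->
  tree_box k1 i1.*2 `&` tree_box k1 i1.*2.+1 = set0.
  by move=> /below_top; exact: tree_box_disj.
have box0 l : below_root (K * n) 0 0 l -> lam (tree_box 0 l) = cell_volume%:E.
  by move=> _; exact: measure_tree_box0.
pose i' := (i %/ 2 ^ (k' - k))%N.
have bk' : below_root (K * n) 0 k' i'.
  have h : below_root (K * n) 0 0 (i * 2 ^ k) by rewrite below_rootP.
  have := below_root_anc k'H h; rewrite (div2exp_anc _ kk') mulnK ?expn_gt0//.
exists (tree_box k' i'); split.
- exact: cubes_tree_box.
- move=> x xi; have [l bl lx] := box_leaf boxS bki xi.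
  have iE : i = (l %/ 2 ^ k)%N.
    by apply: (box_inj boxS boxD bki _ xi); [exact: below_root_anc|exact: (box_anc boxS)].
  by rewrite /i' iE -div2exp_anc//; exact: (box_anc boxS).
rewrite (measure_box mbox boxS boxD box0 bk') (measure_box mbox boxS boxD box0 bki).
rewrite -EFinM lee_fin mulrCA ler_pM2l ?cell_volume_gt0// -exprD.
by rewrite ler_weXn2l ?ler1n// addnC.
Qed.

End boxes.

(** * Covering cubes by shifted grids *)

Section shifted_grids.
Variables (R : realType) (n : nat).
Hypothesis n0 : (0 < n)%N.

(** In each coordinate the top box starts at -S/2 or at -S/6; it contains [-S/6, S/6] in both cases,
    whence the bound [S / 6] in [cube_cover]. *)
Definition shifted_corner (S : R) (alpha : {ffun 'I_n -> bool}) (j : 'I_n) : R :=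
  - (S / 2) + (alpha j)%:R * (S / 3).

(** A point of the grid of mesh [L] and one of the grid shifted by a third of the top side differ by
    (2^j + 3 z) L / 3 with z an integer. As 3 does not divide 2^j, this is at least L / 3 in
    modulus, too much for an interval of length [l]. *)
Lemma third_shift (u l L : R) (z0 z1 : int) (j : nat) :
  0 < l -> 3 * l <= L ->
  u < - (2 ^+ j * L / 2) + z0%:~R * L < u + l ->
  u < - (2 ^+ j * L / 2) + 2 ^+ j * L / 3 + z1%:~R * L < u + l -> False.
Proof.
move=> l0 lL /andP[a1 a2] /andP[b1 b2].
have L0 : 0 < L by lra.
have : `|((2 ^ j)%N%:Z + 3 * (z1 - z0))%:~R| < (1 : R).
  rewrite intrD intrM intrB -[(2 ^ j)%N%:Z%:~R]/((2 ^ j)%N%:R) natrX.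
  rewrite -(ltr_pM2r L0) mul1r -[X in _ * X < _](gtr0_norm L0) -normrM ltr_norml.
  rewrite (_ : (2%:R ^+ j + 3%:~R * (z1%:~R - z0%:~R)) * L =
    3 * ((2 ^+ j * L / 3 + z1%:~R * L) - z0%:~R * L)); last by field.
  apply/andP; split; lra.
rewrite -intr_norm -[1]/(1%:~R) ltr_int => h.
have {h} : ((2 ^ j)%N%:Z + 3 * (z1 - z0) = 0)%R by lia.
move=> h; have : (3 %| 2 ^ j)%N.
  by lia.
by rewrite Euclid_dvdX.
Qed.

Lemma int_eq_of_lt (z z' : int) (x L : R) : 0 < L ->
  z%:~R * L <= x < z%:~R * L + L -> z'%:~R * L <= x < z'%:~R * L + L -> z = z'.
Proof.
move=> L0 /andP[a1 a2] /andP[b1 b2].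
have h1 : z%:~R * L < (z' + 1)%:~R * L by rewrite intrD mulrDl mul1r; lra.
have h2 : z'%:~R * L < (z + 1)%:~R * L by rewrite intrD mulrDl mul1r; lra.
move: h1 h2; rewrite !(ltr_pM2r L0) !ltr_int; lia.
Qed.

Lemma cube_cover (u : 'I_n -> R) (l S : R) (K : nat) :
  0 < l -> 3 * l <= S -> S <= l * 2 ^+ K -> (forall j, `|u j| <= S / 6) ->
  exists alpha k i, [/\ below_root (K * n) 0 k i,
    obox u (fun=> l) `<=` tree_box (shifted_corner S alpha) S K k i &
    (lebesgue_Rd R n (tree_box (shifted_corner S alpha) S K k i) <=
     (6 ^+ n)%:E * lebesgue_Rd R n (obox u (fun=> l)))%E].
Proof.
move=> l0 lS SK uS; have S0 : 0 < S by lra.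
(* The finest mesh that is still at least [3 * l]. It is not the last one since S / 2^K is at most
   [l], and by maximality it is at most [6 * l], the origin of [6 ^+ n]. *)
pose P t := (t <= K)%N && (3 * l <= S / 2 ^+ t).
have P0 : exists t, P t by exists 0%N; rewrite /P leq0n expr0 divr1.
have PK t : P t -> (t <= K)%N by case/andP.
case: (ex_maxnP P0 PK) => t /andP[tK lt] tmax.
set L := S / 2 ^+ t in lt.
have L0 : 0 < L by rewrite divr_gt0// exprn_gt0.
have SL : S = 2 ^+ t * L by rewrite /L mulrC divfK// gt_eqF// exprn_gt0.
have tK' : (t < K)%N.
  rewrite ltn_neqAle tK andbT; apply/eqP => tE.
  have : L <= l by rewrite /L tE ler_pdivrMr// exprn_gt0.
  by lra.
have L6 : L <= 6 * l.
  have : ~~ P t.+1 by apply/negP => /tmax; rewrite ltnn.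
  rewrite /P tK' /= -ltNge exprS invfM mulrCA -/L => h; lra.
pose fits (c x : R) := exists z : int, c + z%:~R * L <= x /\ x + l <= c + z%:~R * L + L.
(* Coordinates are independent: shift exactly those in which the unshifted grid cuts the
   interval. *)
pose alpha := [ffun j => ~~ `[< fits (- (S / 2)) (u j) >]].
have nfits c x : ~ fits c x -> exists z : int, x < c + z%:~R * L < x + l.
  move=> nf; have /andP[f1 f2] := @floor_itv R ((x - c) / L).
  move: f1 f2; move: (Num.floor ((x - c) / L)) => z.
  rewrite ler_pdivlMr// ltr_pdivrMr// intrD mulrDl mul1r => f1 f2.
  exists (z + 1); rewrite intrD mulrDl mul1r; apply/andP; split; first lra.
  by rewrite ltNge; apply/negP => h; apply: nf; exists z; split; lra.
have fitsP j : fits (shifted_corner S alpha j) (u j).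
  rewrite /shifted_corner /alpha ffunE; case: asboolP => [|nf0] /=.
    by rewrite mul0r addr0.
  apply: contrapT => nf1; have [z0 h0] := nfits _ _ nf0.
  have [z1] := nfits _ _ nf1; rewrite mul1r => h1.
  by apply: (@third_shift (u j) _ _ z0 z1 t l0 lt); rewrite -SL.
set c := shifted_corner S alpha in fitsP.
have boxS k1 i1 : below_root (K * n) 0 k1.+1 i1 ->
  tree_box c S K k1.+1 i1 = tree_box c S K k1 i1.*2 `|` tree_box c S K k1 i1.*2.+1.
  by move=> /below_top; exact: tree_boxS.
have boxD k1 i1 : below_root (K * n) 0 k1.+1 i1 ->
  tree_box c S K k1 i1.*2 `&` tree_box c S K k1 i1.*2.+1 = set0.
  by move=> /below_top; exact: tree_box_disj.
pose x : Rd R n := [tuple u j | j < n].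
have b0 : below_root (K * n) 0 (K * n) 0 by rewrite /below_root leqnn div0n.
have xtop : tree_box c S K (K * n) 0 x.
  rewrite tree_box_top => j; rewrite tnth_mktuple /c /shifted_corner.
  have := uS j; rewrite ler_norml => /andP[h1 h2].
  by case: (alpha j) => /=; apply/andP; split; lra.
have [l1 bl1 l1x] := box_leaf boxS b0 xtop.
pose k := ((K - t) * n)%N; have kH : (k <= K * n)%N by rewrite leq_mul2r leq_subr orbT.
pose i := (l1 %/ 2 ^ k)%N.
have bi : below_root (K * n) 0 k i by exact: below_root_anc.
have xi : tree_box c S K k i x by exact: (box_anc boxS).
have kt : (K * n - k = t * n)%N by rewrite /k -mulnBl subKn.
exists alpha, k, i; split => //.
  move=> y yu j; rewrite kt side_mul// -/L.
  have [z' cE] := corner_grid c S (t * n) i j.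
  have {}cE : corner c S (t * n) i j = c j + (z' : int)%:~R * L.
    by rewrite cE side_mul.
  have := xi j; rewrite kt cE side_mul// -/L tnth_mktuple => /andP[x1 x2].
  have [z [z1 z2]] := fitsP j.
  (* The cell that contains the whole interval and the cell of the tree both contain its left
     endpoint. *)
  have zz' : z = z'.
    by apply: (@int_eq_of_lt _ _ (u j - c j) L L0); apply/andP; split; lra.
  by have /andP[y1 y2] := yu j; move: z1 z2; rewrite zz' => z1 z2;
    apply/andP; split; lra.
rewrite /k measure_cube_box// measure_obox => [|j]; last exact: ltW.
rewrite prodr_const card_ord -EFinM lee_fin -exprMn.
by rewrite lerXn2r ?nnegrE ?(ltW L0)// mulr_ge0// ltW.
Qed.

End shifted_grids.

(** * Comparison of cubes with tree boxes *)

Section maximal_comparison.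
Context d (T : measurableType d) (R : realType).
Variable lam : {measure set T -> \bar R}.
Local Open Scope ereal_scope.

Lemma avg_ge0 (p : R) (Q : set T) h : 0 <= avg lam p Q h.
Proof. exact: poweR_ge0. Qed.

Lemma avg_le_of_subset (p kappa : R) (Q Q' : set T) (h : T -> \bar R) :
  (0 < p)%R -> (0 < kappa)%R -> Q `<=` Q' -> 0 < lam Q -> lam Q' < +oo ->
  0 < lam Q' -> lam Q < +oo -> lam Q' <= kappa%:E * lam Q ->
  avg lam p Q h <= (kappa `^ p^-1)%:E * avg lam p Q' h.
Proof.
move=> p0 k0 QQ' Q0 Q'oo Q'0 Qoo Q'Q; rewrite /avg -poweR_EFin.
have J0 (A : set T) : 0 <= \int[lam]_(y in A) `|h y| `^ p.
  by apply: integral_ge0 => y _; exact: poweR_ge0.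
have V0 (A : set T) : 0 <= (lam A)^-1 by rewrite inve_ge0.
rewrite -poweRM ?lee_fin ?(ltW k0)//; last by rewrite mule_ge0.
apply: gt0_ler_poweR; rewrite ?invr_ge0 ?(ltW p0)//.
- by rewrite in_itv/= leey andbT mule_ge0.
- by rewrite in_itv/= leey andbT mule_ge0 ?mule_ge0// lee_fin ltW.
rewrite muleA; apply: lee_pmul => //.
  have : lam Q \is a fin_num by rewrite ge0_fin_numE// ltW.
  have : lam Q' \is a fin_num by rewrite ge0_fin_numE// ltW.
  move: Q0 Q'0 Q'Q; case: (lam Q) => [q| |]//; case: (lam Q') => [q'| |]//.
  rewrite !lte_fin -EFinM lee_fin => q0 q'0 qq' _ _.
  rewrite !inver !gt_eqF// -EFinM lee_fin.
  by rewrite -[leLHS]mul1r ler_pdivrMr// mulrAC ler_pdivlMr// mul1r.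
rewrite [leLHS]integral_mkcond [leRHS]integral_mkcond.
apply: ge0_le_lintegral => y _; rewrite /patch.
  by case: ifP => // _; exact: poweR_ge0.
case: ifPn => [/set_mem/QQ'/mem_set ->//|_].
by case: ifP => // _; exact: poweR_ge0.
Qed.

Lemma multi_maximal_ge0 (D : set (set T)) n (r : 'I_n -> R) h x :
  0 <= multi_maximal lam D r h x.
Proof. by apply: ereal_sup_ubound; left. Qed.

Lemma multi_maximal_ubound (D : set (set T)) n (r : 'I_n -> R) h x Q : D Q ->
  (\prod_(j < n) avg lam (r j) Q (h j)) * (\1_Q x)%:E <= multi_maximal lam D r h x.
Proof. by move=> DQ; apply: ereal_sup_ubound; right; exists Q. Qed.

Lemma multi_maximal_le (D : set (set T)) n (r : 'I_n -> R) h x (M : \bar R) :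
  0 <= M -> (forall Q, D Q -> Q x ->
    \prod_(j < n) avg lam (r j) Q (h j) <= M) ->
  multi_maximal lam D r h x <= M.
Proof.
move=> M0 DM; apply: ge_ereal_sup => _ [->//|[Q DQ <-]].
rewrite indicE; have [xQ|xQ] := boolP (x \in Q).
  by rewrite mule1; apply: DM => //; exact: set_mem.
by rewrite mule0.
Qed.

Lemma prod_avg_le n (r : 'I_n -> R) (kappa : R) (Q Q' : set T)
    (h : 'I_n -> T -> \bar R) :
  (forall j, 0 < r j)%R -> (0 < kappa)%R -> Q `<=` Q' -> 0 < lam Q ->
  lam Q' < +oo -> 0 < lam Q' -> lam Q < +oo -> lam Q' <= kappa%:E * lam Q ->
  \prod_(j < n) avg lam (r j) Q (h j) <=
  (\prod_j (kappa `^ (r j)^-1))%:E * \prod_(j < n) avg lam (r j) Q' (h j).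
Proof.
move=> r0 k0 QQ' Q0 Q'oo Q'0 Qoo Q'Q; rewrite -prodEFin -big_split/=.
by apply: lee_prod => j; rewrite avg_ge0/=; exact: avg_le_of_subset.
Qed.

End maximal_comparison.

Section cubes_vs_trees.
Variables (R : realType) (n : nat).
Hypothesis n0 : (0 < n)%N.
Local Notation lam := (lebesgue_Rd R n).
Variables (N : nat) (rho : 'I_N -> R).
Hypothesis rho0 : forall j, 0 < rho j.

Definition tree_family (c : 'I_n -> R) (S : R) (K : nat) : set (set (Rd R n)) :=
  [set tree_box c S K p.1 p.2 | p in [set p | below_root (K * n) 0 p.1 p.2]].

Lemma cubesE (Q : set (Rd R n)) : cubes Q ->
  exists u l, 0 < l /\ Q = obox u (fun=> l).
Proof. by move=> [u [l [l0 ->]]]; exists u, l. Qed.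

Lemma measure_cube u (l : R) : 0 < l -> lam (obox u (fun=> l)) = (l ^+ n)%:E.
Proof.
move=> l0; rewrite measure_obox => [|j]; last exact: ltW.
by rewrite prodr_const card_ord.
Qed.

Lemma measure_tree_box (c : 'I_n -> R) (S : R) K k i : 0 < S ->
  below_root (K * n) 0 k i ->
  lam (tree_box c S K k i) = (cell_volume n S K * 2 ^+ k)%:E.
Proof.
move=> S0 bi; apply: (measure_box (H := (K * n)%N) (i0 := 0%N) (box := tree_box c S K)) => //.
- by move=> k1 i1 _; exact: measurable_tree_box.
- by move=> k1 i1 /below_top; exact: tree_boxS.
- by move=> k1 i1 /below_top; exact: tree_box_disj.
- by move=> l _; exact: measure_tree_box0.
Qed.

Lemma measure_tree_box_gt0 (c : 'I_n -> R) (S : R) K k i : 0 < S ->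
  below_root (K * n) 0 k i -> (0 < lam (tree_box c S K k i) < +oo)%E.
Proof.
move=> S0 bi; rewrite measure_tree_box// lte_fin ltry andbT.
by rewrite mulr_gt0 ?exprn_gt0 ?cell_volume_gt0.
Qed.

Lemma tree_le_cubes c S K h x : 0 < S ->
  (multi_maximal lam (tree_family c S K) rho h x <=
   (\prod_j ((2 ^+ n) `^ (rho j)^-1))%:E * multi_maximal lam (@cubes R n) rho h x)%E.
Proof.
move=> S0; have P0 : 0 <= \prod_j ((2 ^+ n : R) `^ (rho j)^-1).
  by apply: prodr_ge0 => j _; exact: powR_ge0.
apply: multi_maximal_le => [|_ [[k i] /= bi <-] xi].
  by rewrite mule_ge0 ?multi_maximal_ge0.
have [Q [cQ sQ mQ]] := tree_box_sub_cube n0 c S0 bi.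
have /andP[b0 boo] := measure_tree_box_gt0 c S0 bi.
have /cubesE[u [l [l0 QE]]] := cQ.
have Q0 : (0 < lam Q)%E by rewrite QE measure_cube// lte_fin exprn_gt0.
have Qoo : (lam Q < +oo)%E by rewrite QE measure_cube// ltry.
apply: le_trans (prod_avg_le h rho0 _ sQ b0 Qoo Q0 boo mQ) _.
  by rewrite exprn_gt0.
apply: lee_wpmul2l; first by rewrite lee_fin.
have := multi_maximal_ubound lam rho h x cQ.
by rewrite indicE mem_set ?mule1//; exact: sQ.
Qed.

Lemma large_exp2 (X : R) : exists N0, forall m, (N0 <= m)%N -> X <= 2 ^+ m.
Proof.
exists (Num.truncn X).+1 => m Nm; apply: le_trans (ltW (truncnS_gt X)) _.
apply: le_trans (_ : m%:R <= _); first by rewrite ler_nat.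
by rewrite -natrX ler_nat ltnW// ltn_expl.
Qed.

(** With top side 2^m and 2 m rounds of halving the cells have side 2^-m, so region and resolution
    both grow with [m]. A sum over the shifts is as good as a maximum and easier to integrate. *)
Definition grid_maximal h (m : nat) (x : Rd R n) : \bar R :=
  (\sum_(alpha : {ffun 'I_n -> bool}) multi_maximal lam
     (tree_family (shifted_corner (2 ^+ m) alpha) (2 ^+ m) (2 * m)) rho h x)%E.

(** Each cube is covered for all large [m], with a threshold depending on the cube; hence the lower
    limit. *)
Lemma cubes_le_grids h x :
  (multi_maximal lam (@cubes R n) rho h x <=
   limn_einf (fun m => (\prod_j ((6 ^+ n) `^ (rho j)^-1))%:E * grid_maximal h m x))%E.
Proof.
have P0 : 0 <= \prod_j ((6 ^+ n : R) `^ (rho j)^-1).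
  by apply: prodr_ge0 => j _; exact: powR_ge0.
set F := fun m => _.
have F0 m : (0 <= F m)%E.
  rewrite mule_ge0// sume_ge0// => alpha _; exact: multi_maximal_ge0.
have ev a : (exists N0, forall m, (N0 <= m)%N -> (a <= F m)%E) ->
    (a <= limn_einf F)%E.
  move=> [N0 aF]; rewrite limn_einf_lim; apply: lime_ge.
    exact: is_cvg_einfs.
  exists N0 => // m /= Nm; apply: le_ereal_inf_tmp => _ [m' /= mm' <-].
  by apply: aF; exact: leq_trans mm'.
apply: multi_maximal_le; first by apply: ev; exists 0%N.
move=> Q cQ Qx; apply: ev.
have /cubesE[u [l [l0 QE]]] := cQ.
have [N1 h1] := large_exp2 (3 * l).
have [N2 h2] := large_exp2 l^-1.
have [N3 h3] := large_exp2 (6 * \sum_j `|u j|).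
exists (maxn N1 (maxn N2 N3)) => m; rewrite !geq_max => /and3P[m1 m2 m3].
have lS := h1 m m1; have lK := h2 m m2; have uS := h3 m m3.
have SK : 2 ^+ m <= l * 2 ^+ (2 * m).
  rewrite mul2n -addnn exprD mulrA ler_peMl ?exprn_ge0//.
  by rewrite mulrC -ler_pdivrMr// div1r.
have uj j : `|u j| <= 2 ^+ m / 6.
  rewrite ler_pdivlMr// mulrC; apply: le_trans uS; rewrite ler_pM2l//.
  by rewrite (bigD1 j)//= lerDl sumr_ge0.
have [alpha [k [i [bi sub meas]]]] := cube_cover n0 l0 lS SK uj.
have S0 : (0 : R) < 2 ^+ m by rewrite exprn_gt0.
have /andP[b0 boo] := measure_tree_box_gt0 (shifted_corner (2 ^+ m) alpha) S0 bi.
have Q0 : (0 < lam Q)%E by rewrite QE measure_cube// lte_fin exprn_gt0.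
have Qoo : (lam Q < +oo)%E by rewrite QE measure_cube// ltry.
rewrite -QE in sub meas.
apply: le_trans (prod_avg_le h rho0 _ sub Q0 boo b0 Qoo meas) _.
  by rewrite exprn_gt0.
apply: lee_wpmul2l; first by rewrite lee_fin.
rewrite /grid_maximal (bigD1 alpha)//=; apply: le_trans; last first.
  by apply: leeDl; apply: sume_ge0 => ? _; exact: multi_maximal_ge0.
have Db : tree_family (shifted_corner (2 ^+ m) alpha) (2 ^+ m) (2 * m)
  (tree_box (shifted_corner (2 ^+ m) alpha) (2 ^+ m) (2 * m) k i) by exists (k, i).
have := multi_maximal_ubound lam rho h x Db.
by rewrite indicE mem_set ?mule1//; exact: sub.
Qed.

End cubes_vs_trees.

(** * Products and concavifications *)

Section products.
Context (R : realType) d (Omega : measurableType d).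
Variable mu : {measure set Omega -> \bar R}.

Lemma prod_powR n (x : 'I_n -> R) (p : R) : (forall j, 0 <= x j) ->
  (\prod_j x j) `^ p = \prod_j x j `^ p.
Proof.
move=> x0; suff : 0 <= \prod_j x j /\ (\prod_j x j) `^ p = \prod_j x j `^ p by case.
elim/big_ind2 : _ => [|a b c e [a0 <-] [c0 <-]|j _]; last by [].
  by rewrite ler01 powR1.
by rewrite mulr_ge0// powRM.
Qed.

Section product_norm.
Variables (n : nat) (X : 'I_n -> fspace Omega R).
Hypothesis qX : forall j, quasi_banach_fs mu (X j).

Lemma factors_norm_ge0 xi xs : factors mu X xi xs ->
  0 <= \prod_j fnorm (X j) (real_fun (xs j)).
Proof. by move=> [Xxs _]; apply: prodr_ge0 => j _; exact: qb_norm_ge0 (qX j) _ _. Qed.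

Lemma fs_product_norm_le xi xs : factors mu X xi xs ->
  fnorm (fs_product mu X) xi <= \prod_j fnorm (X j) (real_fun (xs j)).
Proof.
move=> fxs; apply: ge_inf; last by exists xs.
by exists 0 => _ [ys fys <-]; exact: factors_norm_ge0 fys.
Qed.

Lemma le_fs_product_norm xi (z : R) : (exists xs, factors mu X xi xs) ->
  (forall xs, factors mu X xi xs -> z <= \prod_j fnorm (X j) (real_fun (xs j))) ->
  z <= fnorm (fs_product mu X) xi.
Proof.
move=> [xs fxs] zxs; apply: lb_le_inf; first by exists (\prod_j fnorm (X j) (real_fun (xs j))), xs.
by move=> _ [ys fys <-]; exact: zxs.
Qed.

End product_norm.

Definition cpow (q : R) (zeta : Omega -> R[i]) : Omega -> R :=
  fun w => cabs (zeta w) `^ q.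

Section concavification_of_product.
Variables (n : nat) (X : 'I_n -> fspace Omega R) (q : R).
Hypotheses (q0 : 0 < q) (qX : forall j, quasi_banach_fs mu (X j)).
Let Y j := concavification q (X j).
Hypothesis qY : forall j, quasi_banach_fs mu (Y j).

Let factors_pow zeta xs : L0 zeta -> factors mu X zeta xs ->
  let ys := fun j w => `|xs j w| `^ q in
  factors mu Y (real_fun (cpow q zeta)) ys /\
  forall j, fnorm (Y j) (real_fun (ys j)) <= fnorm (X j) (real_fun (xs j)) `^ q.
Proof.
move=> L0z [Xxs zxs] ys.
have mxs j : measurable_fun setT (fun w => `|xs j w|).
  by apply: measurableT_comp => //; exact/L0_real/(qb_L0 (qX j)).
have Xabs j : X j (real_fun (fun w => `|xs j w|)) /\
    fnorm (X j) (real_fun (fun w => `|xs j w|)) <= fnorm (X j) (real_fun (xs j)).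
  by apply: (solid_real (qX j)) => //; apply: nearW => w; rewrite normr_id.
have E j : (fun w => cabs (real_fun (ys j) w) `^ q^-1) = (fun w => `|xs j w|).
  by apply/funext => w; rewrite cabs_real ger0_norm ?powR_ge0// powRK.
have Yys j : Y j (real_fun (ys j)).
  split; first by apply/L0_real; exact: measurable_powR_comp.
  by rewrite E; exact: (Xabs j).1.
split; first split => //.
  apply: filterS zxs => w [xs0 zw]; split => [j|]; first exact: powR_ge0.
  rewrite cabs_real ger0_norm ?powR_ge0// /ys -prod_powR//.
  under eq_bigr do rewrite ger0_norm//.
  apply: ge0_ler_powR => //; rewrite ?nnegrE ?(ltW q0) ?cabs_ge0//.
  by apply: prodr_ge0 => j _.
move=> j; rewrite /Y /= E; apply: ge0_ler_powR; rewrite ?nnegrE ?(ltW q0)//.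
- exact: qb_norm_ge0 (qX j) _ (Xabs j).1.
- exact: qb_norm_ge0 (qX j) _ (Xxs j).
- exact: (Xabs j).2.
Qed.

Let factors_root zeta ys : L0 zeta -> factors mu Y (real_fun (cpow q zeta)) ys ->
  let xs := fun j w => cabs (real_fun (ys j) w) `^ q^-1 in
  factors mu X zeta xs /\
  forall j, fnorm (X j) (real_fun (xs j)) `^ q = fnorm (Y j) (real_fun (ys j)).
Proof.
move=> L0z [Yys zys] xs; split => //; split => [j|].
  by have [_] := Yys j.
apply: filterS zys => w [ys0]; rewrite cabs_real ger0_norm ?powR_ge0// => zw.
split => [j|]; first exact: powR_ge0.
rewrite /xs -prod_powR => [|j]; last exact: cabs_ge0.
under eq_bigr do rewrite cabs_real ger0_norm//.
rewrite -[leLHS](@powRK _ _ q)// ?cabs_ge0//.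
apply: ge0_ler_powR => //; rewrite ?nnegrE ?invr_ge0 ?(ltW q0) ?powR_ge0//.
by apply: prodr_ge0 => j _.
Qed.

Lemma concavification_product_mem zeta : fs_product mu X zeta ->
  fs_product mu Y (real_fun (cpow q zeta)).
Proof.
move=> [L0z [xs fxs]]; split.
  by apply/L0_real/measurable_powR_comp; exact: L0_cabs.
by have [fys _] := factors_pow L0z fxs; eexists; exact: fys.
Qed.

(** Powers and roots carry factorizations of [zeta] in the [X j] to factorizations of its power in
    the [Y j] and back, without increasing the product of the norms. *)
Lemma concavification_product_norm zeta : fs_product mu X zeta ->
  fnorm (fs_product mu Y) (real_fun (cpow q zeta)) =
  fnorm (fs_product mu X) zeta `^ q.
Proof.
move=> Xz; have [L0z [xs0 fxs0]] := Xz; have [_ [ys0 fys0]] := concavification_product_mem Xz.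
have NX0 : 0 <= fnorm (fs_product mu X) zeta.
  by apply: le_fs_product_norm; [exists xs0|exact: factors_norm_ge0].
have NY0 : 0 <= fnorm (fs_product mu Y) (real_fun (cpow q zeta)).
  by apply: le_fs_product_norm; [exists ys0|exact: factors_norm_ge0].
apply/eqP; rewrite eq_le; apply/andP; split.
  rewrite -[leLHS](@powRVK _ _ q)//.
  apply: ge0_ler_powR; rewrite ?nnegrE ?powR_ge0 ?(ltW q0)//.
  apply: le_fs_product_norm; first by exists xs0.
  move=> xs fxs; have [fys ysn] := factors_pow L0z fxs.
  have P0 := factors_norm_ge0 qX fxs.
  rewrite -[leRHS](@powRK _ _ q)//.
  apply: ge0_ler_powR; rewrite ?nnegrE ?powR_ge0 ?invr_ge0 ?(ltW q0)//.
  apply: le_trans (fs_product_norm_le qY fys) _.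
  rewrite prod_powR => [|j]; last by apply: (qb_norm_ge0 (qX j)); case: fxs.
  apply: ler_prod => j _; rewrite ysn andbT; apply: (qb_norm_ge0 (qY j)).
  by case: fys.
apply: le_fs_product_norm; first by exists ys0.
move=> ys fys; have [fxs xsn] := factors_root L0z fys.
under eq_bigr do rewrite -xsn.
rewrite -prod_powR => [|j]; last by apply: (qb_norm_ge0 (qX j)); case: fxs.
apply: ge0_ler_powR; rewrite ?nnegrE ?(ltW q0)//; first exact: (factors_norm_ge0 qX fxs).
exact: fs_product_norm_le.
Qed.

End concavification_of_product.

Lemma snoc_lift A n (f : 'I_n -> A) a j : snoc f a (lift ord_max j) = f j.
Proof. by rewrite /snoc liftK. Qed.

Lemma snoc_last A n (f : 'I_n -> A) a : snoc f a ord_max = a.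
Proof. by rewrite /snoc unlift_none. Qed.

Lemma widen_lift n (j : 'I_n) : widen_ord (leqnSn n) j = lift ord_max j.
Proof. by apply/val_inj; rewrite /= /bump leqNgt ltn_ord. Qed.

(** After normalising [xi] this is the definition of the dual norm; an element of norm 0 vanishes
    almost everywhere and is treated apart. Nonnegativity of [eta] makes the pairing with |xi| equal
    to the integral on the left. *)
Lemma dual_pairing_le (Z : fspace Omega R) (xi eta : Omega -> R) :
  quasi_banach_fs mu Z -> Z (real_fun xi) -> fs_dual mu Z (real_fun eta) ->
  {ae mu, forall w, 0 <= eta w} ->
  (\int[mu]_w (`|xi w| * `|eta w|)%:E <=
   (fnorm Z (real_fun xi) * fnorm (fs_dual mu Z) (real_fun eta))%:E)%E.
Proof.
move=> qZ Zxi [L0eta etaint etasup] eta0.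
have mxi : measurable_fun setT xi by exact/L0_real/(qb_L0 qZ).
have meta : measurable_fun setT eta by exact/L0_real.
pose axi w := `|xi w|.
have maxi : measurable_fun setT axi by exact: measurableT_comp.
have [Zaxi axile] : Z (real_fun axi) /\ fnorm Z (real_fun axi) <= fnorm Z (real_fun xi).
  by apply: (solid_real qZ) => //; apply: nearW => w; rewrite normr_id.
have N0 := qb_norm_ge0 qZ Zaxi.
have D0 : 0 <= fnorm (fs_dual mu Z) (real_fun eta).
  apply: le_trans (ub_le_sup etasup (_ : fs_dual_values mu Z _ (cabs (pairing mu (fun=> 0) (real_fun eta))))).
    exact: cabs_ge0.
  exists (fun=> 0) => //; split; first exact: (mem_zero qZ).
  by rewrite (fnorm_zero qZ).
have mprod : measurable_fun setT (fun w => (`|xi w| * `|eta w|)%:E).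
  by apply/measurable_EFinP; apply: measurable_funM => //; exact: measurableT_comp.
have [Nz|Nn] := eqVneq (fnorm Z (real_fun axi)) 0.
  have zero : {ae mu, forall w, real_fun axi w = 0} by exact/(qb_norm_eq0 qZ Zaxi).
  rewrite (_ : (\int[mu]_w _)%E = 0%E).
    by rewrite lee_fin mulr_ge0// (qb_norm_ge0 qZ Zxi).
  transitivity (\int[mu]_(w in setT) (cst 0%E w))%E; last by rewrite integral0.
  apply: ae_eq_integral => //.
  apply: filterS zero => w; rewrite /real_fun => -[axi0] _ /=.
  by rewrite -[`|xi w|]/(axi w) axi0 mul0r.
have Ngt : 0 < fnorm Z (real_fun axi) by rewrite lt_neqAle eq_sym Nn N0.
pose t := (fnorm Z (real_fun axi))^-1.
have t0 : 0 < t by rewrite invr_gt0.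
pose xi1 w := t * axi w.
have Zxi1 : Z (real_fun xi1) by rewrite real_funZ; exact: (qb_scale qZ).
have xi1n : fnorm Z (real_fun xi1) <= 1.
  by rewrite real_funZ (qb_normZ qZ)// cabs_real gtr0_norm// mulVf.
have val : fs_dual_values mu Z (real_fun eta) (cabs (pairing mu (real_fun xi1) (real_fun eta))).
  by exists (real_fun xi1).
have := ub_le_sup etasup val => {}val.
have pE : pairing mu (real_fun xi1) (real_fun eta) =
    ((Rintegral mu setT (fun w => xi1 w * eta w))%:C)%C.
  rewrite /pairing /cintegral; congr (_ +i* _)%C.
    by apply: eq_Rintegral => w _; rewrite /real_fun -rmorphM.
  rewrite /Rintegral (eq_integral (cst 0%E)) ?integral0// => w _.
  by rewrite /real_fun -rmorphM.
have intE : (\int[mu]_w (xi1 w * eta w)%:E)%E =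
    (t%:E * \int[mu]_w (`|xi w| * `|eta w|)%:E)%E.
  rewrite -ge0_integralZl//; last by rewrite lee_fin ltW.
  apply: ae_eq_integral => //.
  - by apply/measurable_EFinP; apply: measurable_funM => //; apply: measurable_funM.
  - exact: measurable_funeM.
  by apply: filterS eta0 => w e0 _; rewrite -EFinM /xi1 /axi mulrA (ger0_norm e0).
have fin : (\int[mu]_w (`|xi w| * `|eta w|)%:E)%E \is a fin_num.
  have := etaint _ Zxi => /integrableP[_].
  under eq_integral do rewrite cabsM !cabs_real.
  rewrite ge0_fin_numE; last by apply: integral_ge0 => w _; rewrite lee_fin mulr_ge0.
  apply: le_lt_trans; rewrite le_eqVlt; apply/orP; left; apply/eqP.
  by apply: eq_integral => w _; rewrite gee0_abs// lee_fin mulr_ge0.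
rewrite pE cabs_real in val.
have := le_trans (ler_norm _) val; rewrite /Rintegral intE -(fineK fin) -EFinM /= => h.
rewrite lee_fin; apply: le_trans (_ : fnorm Z (real_fun axi) * sup (fs_dual_values mu Z (real_fun eta)) <= _); last first.
  by apply: ler_wpM2r.
by rewrite -ler_pdivrMl.
Qed.

End products.

(** * The product of a space with its dual *)

Section product_with_dual.
Context (R : realType) d (Omega : measurableType d).
Variable mu : {measure set Omega -> \bar R}.
Variables (m : nat) (Y : 'I_m -> fspace Omega R).
Let PY := fs_product mu Y.
Let Z := snoc Y (fs_dual mu PY).
Hypotheses (qY : forall j, quasi_banach_fs mu (Y j)) (qPY : quasi_banach_fs mu PY).
Hypothesis qZ : forall j, quasi_banach_fs mu (Z j).

(** Split off the last factor as a dual element, pair it with the product of the remaining ones, and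
    bound the norm of that product by this very factorization. *)
Let int_le_factors (u : Omega -> R) xi xs :
  measurable_fun setT u -> (forall w, 0 <= u w) ->
  {ae mu, forall w, u w <= cabs (xi w)} -> factors mu Z xi xs ->
  (\int[mu]_w (u w)%:E <= (\prod_j fnorm (Z j) (real_fun (xs j)))%:E)%E.
Proof.
move=> mu_ u0 uxi [Zxs xsxi].
pose ys j := xs (lift ord_max j); pose eta := xs ord_max.
have Yys j : Y j (real_fun (ys j)) by have := Zxs (lift ord_max j); rewrite /Z snoc_lift.
have Deta : fs_dual mu PY (real_fun eta) by have := Zxs ord_max; rewrite /Z snoc_last.
have mys j : measurable_fun setT (ys j) by exact/L0_real/(qb_L0 (qY j)).
have meta : measurable_fun setT eta by case: Deta => /L0_real.
pose zeta w := \prod_j ys j w.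
have mzeta : measurable_fun setT zeta by apply: measurable_prod => j _.
have fys : factors mu Y (real_fun zeta) ys.
  split => //; apply: filterS xsxi => w [xs0 _]; split => [j|]; first exact: xs0.
  by rewrite cabs_real ger0_norm// prodr_ge0// => j _; exact: xs0.
have PYz : PY (real_fun zeta) by split; [exact/L0_real|exists ys].
have eta0 : {ae mu, forall w, 0 <= eta w}.
  by apply: filterS xsxi => w [xs0 _]; exact: xs0.
apply: (@le_trans _ _ (\int[mu]_w (`|zeta w| * `|eta w|)%:E)%E).
  apply: ae_ge0_le_integral => //.
  - by move=> w _; rewrite lee_fin.
  - exact/measurable_EFinP.
  - by apply/measurable_EFinP; apply: measurable_funM; exact: measurableT_comp.
  apply: filterS2 uxi xsxi => w uw [xs0 xw] _; rewrite lee_fin.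
  apply: le_trans uw _; apply: le_trans xw _; rewrite big_ord_recr /=.
  apply: ler_pM; rewrite ?xs0 ?ler_norm//; first by rewrite prodr_ge0.
  apply: le_trans (ler_norm _); rewrite le_eqVlt; apply/orP; left; apply/eqP.
  by apply: eq_bigr => j _; rewrite widen_lift.
apply: le_trans (dual_pairing_le qPY PYz Deta eta0) _; rewrite lee_fin.
rewrite big_ord_recr /= {2}/Z snoc_last.
apply: ler_pM => //.
- exact: qb_norm_ge0 qPY _ PYz.
- by have := qb_norm_ge0 (qZ ord_max); rewrite /Z snoc_last; apply.
apply: le_trans (fs_product_norm_le qY fys) _.
rewrite le_eqVlt; apply/orP; left; apply/eqP.
by apply: eq_bigr => j _; rewrite widen_lift /Z snoc_lift.
Qed.

Lemma int_le_enorm_dual (u : Omega -> R) (F : Omega -> \bar R) :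
  measurable_fun setT u -> (forall w, 0 <= u w) -> (forall w, ((u w)%:E <= F w)%E) ->
  (\int[mu]_w (u w)%:E <= enorm mu (fs_product mu Z) F)%E.
Proof.
move=> mu_ u0 uF; rewrite /enorm; case: asboolP => [Ffin|_]; last by rewrite leey.
rewrite /vnorm; case: asboolP => [[_ [xs0 fxs0]]|_]; last by rewrite leey.
have uxi : {ae mu, forall w, u w <= cabs (real_fun (fun w => fine (F w)) w)}.
  apply: filterS Ffin => w Fw; rewrite cabs_real; apply: le_trans (ler_norm _).
  by rewrite -lee_fin fineK.
have J0 : (0 <= \int[mu]_w (u w)%:E)%E by apply: integral_ge0 => w _; rewrite lee_fin.
have Jfin : (\int[mu]_w (u w)%:E)%E \is a fin_num.
  rewrite ge0_fin_numE//; apply: le_lt_trans (ltry _).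
  exact: int_le_factors mu_ u0 uxi fxs0.
rewrite -(fineK Jfin) lee_fin; apply: le_fs_product_norm; first by exists xs0.
by move=> xs fxs; rewrite -lee_fin fineK//; exact: int_le_factors mu_ u0 uxi fxs.
Qed.

End product_with_dual.

Section lower_integral_scaling.
Context d (T : measurableType d) (R : realType).
Variable mu : {measure set T -> \bar R}.
Local Open Scope ereal_scope.

(** As [f] may fail to be measurable, the scalar is moved across simple functions below
    [k%:E * f]. *)
Lemma lintegralZ_le (k : R) (f : T -> \bar R) : (0 < k)%R -> (forall x, 0 <= f x) ->
  \int[mu]_x (k%:E * f x) <= k%:E * \int[mu]_x f x.
Proof.
move=> k0 f0; rewrite [leLHS]ge0_integralTE => [|x]; last first.
  by rewrite mule_ge0// lee_fin ltW.
apply: ge_ereal_sup => _ [h hf <-]; rewrite -integralT_nnsfun.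
have mh : measurable_fun setT (EFin \o h) by apply/measurable_EFinP.
have h0 x : 0 <= (h x)%:E by rewrite lee_fin.
rewrite -[leLHS]mul1e -(@mulfV _ k) ?gt_eqF// EFinM -muleA.
apply: lee_wpmul2l; first by rewrite lee_fin ltW.
rewrite -ge0_integralZl//; last by rewrite lee_fin invr_ge0 ltW.
apply: ge0_le_lintegral => x _; first by rewrite mule_ge0// lee_fin invr_ge0 ltW.
by rewrite lee_pdivrMl// muleC; apply: (hf x).
Qed.

End lower_integral_scaling.

Section limn_einf_bounds.
Variable R : realType.
Local Open Scope ereal_scope.

Lemma limn_einf_le (F : (\bar R)^nat) M : (forall m, F m <= M) -> limn_einf F <= M.
Proof.
move=> FM; rewrite limn_einf_lim; apply: lime_le; first exact: is_cvg_einfs.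
by apply: nearW => m; apply: le_trans (FM m); apply: ereal_inf_lbound; exists m => /=.
Qed.

Lemma limn_einf_ge0 (F : (\bar R)^nat) : (forall m, 0 <= F m) -> 0 <= limn_einf F.
Proof.
move=> F0; rewrite limn_einf_lim; apply: lime_ge; first exact: is_cvg_einfs.
by apply: nearW => m; apply: le_ereal_inf_tmp => _ [k _ <-].
Qed.

End limn_einf_bounds.

Lemma measurable_limn_einf d (T : measurableType d) (R : realType)
    (F : nat -> T -> \bar R) : (forall m, measurable_fun setT (F m)) ->
  measurable_fun setT (fun x => limn_einf (fun m => F m x)).
Proof.
move=> mF; rewrite (_ : (fun x => _) =
    fun x => (- limn_esup (fun m => - F m x))%E); last first.
  by apply/funext => x; rewrite [X in (- X)%E](limn_esupN (fun m => F m x)) oppeK.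
apply: measurableT_comp => //; apply: measurable_fun_limn_esup => m.
by apply: measurableT_comp => //; exact: mF.
Qed.

(** * The vector-valued maximal bound *)

Section simple_representation.
Context (R : realType) dS (S : measurableType dS) d (Omega : measurableType d).
Variable mu : {measure set Omega -> \bar R}.

(* [u] is a simple function times the scalar function [gam], and [c] dominates
   its pointwise norm in [Z]. *)
Definition simple_rep (Z : fspace Omega R) (u : S -> Omega -> R) (c : S -> R) :=
  exists N (B : 'I_N -> set S) (gam : S -> R) (eta : 'I_N -> Omega -> R) (b : 'I_N -> R),
  [/\ (forall k, measurable (B k)) /\ trivIset setT B,
      measurable_fun setT gam /\ exists M, forall x, 0 <= gam x <= M,
      forall k, nnelt Z (eta k) (b k),
      forall x w, u x w = \sum_k \1_(B k) x * gam x * eta k w &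
      forall x, c x = \sum_k \1_(B k) x * gam x * b k].

Variable lam : {measure set S -> \bar R}.

Section avg.
Variables (N : nat) (B : 'I_N -> set S) (gam : S -> R) (M rho : R).
Hypotheses (mB : forall k, measurable (B k)) (tB : trivIset setT B).
Hypotheses (mgam : measurable_fun setT gam) (gamM : forall x, 0 <= gam x <= M).
Hypothesis rho0 : 0 < rho.
Variable cell : set S.
Hypotheses (mcell : measurable cell) (cell0 : (0 < lam cell < +oo)%E).

Definition cell_weight (k : 'I_N) : R :=
  fine ((lam cell)^-1 * \int[lam]_(x in cell) (\1_(B k) x * gam x `^ rho)%:E)%E.

Let m1 k : measurable_fun setT (fun x => (\1_(B k) x * gam x `^ rho)%:E).
Proof.
apply/measurable_EFinP; apply: measurable_funM; first exact: measurable_indic.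
exact: measurable_powR_comp.
Qed.

Let pos k x : 0 <= \1_(B k) x * gam x `^ rho.
Proof. by rewrite mulr_ge0// powR_ge0. Qed.

Lemma cell_weight_ge0 k : 0 <= cell_weight k.
Proof.
apply: fine_ge0; apply: mule_ge0; first by rewrite inve_ge0.
by apply: integral_ge0 => x _; rewrite lee_fin.
Qed.

Let weight_fin k :
  (\int[lam]_(x in cell) (\1_(B k) x * gam x `^ rho)%:E)%E \is a fin_num.
Proof.
have /andP[c0 coo] := cell0.
rewrite ge0_fin_numE; last by apply: integral_ge0 => x _; rewrite lee_fin.
apply: le_lt_trans (_ : (\int[lam]_(x in cell) (cst (M `^ rho)%:E x) < +oo)%E).
  apply: ge0_le_lintegral => x _; rewrite lee_fin// -[leRHS]mul1r.
  have /andP[g0 gM] := gamM x.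
  apply: ler_pM; rewrite ?powR_ge0//.
  by apply: ge0_ler_powR; rewrite ?nnegrE ?(ltW rho0)//; exact: le_trans gM.
by rewrite integral_cst// lte_mul_pinfty// ?lee_fin ?powR_ge0.
Qed.

(** The sets [B k] are disjoint, so the power [rho] of the sum is the sum of the powers. *)
Lemma avg_simple_rep (b : 'I_N -> R) : (forall k, 0 <= b k) ->
  avg lam rho cell (fun x => (\sum_k \1_(B k) x * gam x * b k)%:E) =
  ((\sum_k cell_weight k * b k `^ rho) `^ rho^-1)%:E.
Proof.
move=> b0; have /andP[c0 coo] := cell0.
rewrite /avg -poweR_EFin; congr (_ `^ _)%E.
rewrite (eq_integral (fun x => \sum_k (b k `^ rho)%:E * (\1_(B k) x * gam x `^ rho)%:E)%E).
  rewrite ge0_integral_sum//; last 2 first.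
  - by move=> k; apply: measurable_funTS; exact: measurable_funeM.
  - by move=> k x _; rewrite mule_ge0// lee_fin// powR_ge0.
  rewrite -sumEFin ge0_sume_distrr; last first.
    move=> k _; apply: integral_ge0 => x _.
    by rewrite mule_ge0// lee_fin// powR_ge0.
  apply: eq_bigr => k _; rewrite ge0_integralZl//; last 3 first.
  - exact: measurable_funTS.
  - by move=> x _; rewrite lee_fin.
  - by rewrite lee_fin powR_ge0.
  rewrite muleCA EFinM muleC /cell_weight fineK// fin_numM//.
  have : lam cell \is a fin_num by rewrite ge0_fin_numE// ltW.
  by move: c0; case: (lam cell) => // z; rewrite lte_fin => z0; rewrite inver gt_eqF.
move=> x _; have g0 : 0 <= gam x by have /andP[] := gamM x.
rewrite gee0_abs; last first.
  by rewrite lee_fin sumr_ge0// => k _; rewrite mulr_ge0// mulr_ge0.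
rewrite poweR_EFin.
have [/existsP[k /asboolP Bx]|] := boolP [exists k, `[< B k x >]].
  have out k' : k' != k -> (\1_(B k') x : R) = 0.
    move=> k'k; rewrite indicE memNset// => Bx'.
    move/trivIsetP : tB => /(_ k' k I I k'k)/seteqP[/(_ x) + _]; exact.
  rewrite (bigD1 k)//= big1 => [|k' /out ->]; last by rewrite !mul0r.
  rewrite [RHS](bigD1 k)//= [X in (_ + X)%E]big1 => [|k' /out ->]; last by rewrite mul0r mule0.
  rewrite indicE mem_set// !mul1r !addr0 powRM// -EFinM.
  by rewrite mulrC.
rewrite negb_exists => /forallP nB.
have out k' : (\1_(B k') x : R) = 0.
  by rewrite indicE memNset// => Bx; have := nB k'; rewrite asboolT.
rewrite big1 => [|k _]; last by rewrite out !mul0r.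
rewrite big1 => [|k _]; last by rewrite out mul0r mule0.
by rewrite powR0// gt_eqF.
Qed.

End avg.

Lemma simple_rep_measurable Z u c : quasi_banach_fs mu Z -> simple_rep Z u c ->
  [/\ forall w, measurable_fun setT (u^~ w), measurable_fun setT c,
      forall x w, 0 <= u x w & forall x, 0 <= c x].
Proof.
move=> qZ [N [B [gam [eta [b [[mB tB] [mgam [M gamM]] eb uE cE]]]]]].
have g0 x : 0 <= gam x by have /andP[] := gamM x.
have ms (e : 'I_N -> R) : measurable_fun setT (fun x => \sum_k \1_(B k) x * gam x * e k).
  apply: measurable_sum => k; apply: measurable_funM; last exact: measurable_cst.
  by apply: measurable_funM => //; exact: measurable_indic.
split=> [w||x w|x].
- by rewrite (_ : u^~ w = fun x => \sum_k \1_(B k) x * gam x * eta k w)//; exact/funext.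
- by rewrite (_ : c = fun x => \sum_k \1_(B k) x * gam x * b k)//; exact/funext.
- rewrite uE; apply: sumr_ge0 => k _; rewrite mulr_ge0// ?mulr_ge0//.
  by have [] := eb k.
- rewrite cE; apply: sumr_ge0 => k _; rewrite mulr_ge0// ?mulr_ge0//.
  exact: (nnelt_ge0 qZ (eb k)).
Qed.

(** The averages of [u] and of its majorant [c] are combinations with the same weights, so
    [nnelt_weighted] bounds the norm of the first by the second. *)
Lemma simple_rep_avg Z u c rho cell : quasi_banach_fs mu Z -> pconvex rho Z ->
  0 < rho -> measurable cell -> (0 < lam cell < +oo)%E -> simple_rep Z u c ->
  exists v a, [/\ nnelt Z v a,
    forall w, avg lam rho cell (fun x => (u x w)%:E) = (v w)%:E &
    avg lam rho cell (fun x => (c x)%:E) = a%:E].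
Proof.
move=> qZ cZ rho0 mcell cell0 [N [B [gam [eta [b [[mB tB] [mgam [M gamM]] eb uE cE]]]]]].
exists (fun w => (\sum_k cell_weight B gam rho cell k * eta k w `^ rho) `^ rho^-1).
exists ((\sum_k cell_weight B gam rho cell k * b k `^ rho) `^ rho^-1).
split=> [|w|].
- apply: (nnelt_weighted qZ rho0 cZ _ eb) => k; exact: cell_weight_ge0.
- under [X in avg _ _ _ X]eq_fun do rewrite uE.
  by apply: (avg_simple_rep mB tB mgam gamM rho0 mcell cell0) => k; have [] := eb k.
- under [X in avg _ _ _ X]eq_fun do rewrite cE.
  apply: (avg_simple_rep mB tB mgam gamM rho0 mcell cell0) => k.
  exact: (nnelt_ge0 qZ (eb k)).
Qed.

End simple_representation.

(* [Theta] replaces the inner integral, which need not be measurable. *)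
Definition vector_maximal_estimate (R : realType) d (Omega : measurableType d)
    (mu : {measure set Omega -> \bar R}) N (rho : 'I_N -> R) (Z : 'I_N -> fspace Omega R)
    n (K0 : R) : Prop :=
  let lam := lebesgue_Rd R n in
  forall (u : 'I_N -> Rd R n -> Omega -> R) (c : 'I_N -> Rd R n -> R),
    (forall j, simple_rep (Z j) (u j) (c j)) ->
  exists Theta : Omega -> \bar R,
  [/\ measurable_fun setT Theta, forall w, (0 <= Theta w)%E,
      forall w, (\int[lam]_x multi_maximal lam (@cubes R n) rho
         (fun j x => (u j x w)%:E) x <= Theta w)%E &
      (\int[mu]_w Theta w <= K0%:E * \int[lam]_x multi_maximal lam (@cubes R n) rho
         (fun j x => (c j x)%:E) x)%E].

Section vector_maximal_bound.
Context (R : realType) d (Omega : measurableType d).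
Variable mu : {sigma_finite_measure set Omega -> \bar R}.
Variable n : nat.
Hypothesis n0 : (0 < n)%N.
Local Notation lam := (lebesgue_Rd R n).
Variables (N : nat) (rho : 'I_N -> R) (Z : 'I_N -> fspace Omega R).
Hypotheses (rho0 : forall j, 0 < rho j).
Hypotheses (qZ : forall j, quasi_banach_fs mu (Z j)) (cZ : forall j, pconvex (rho j) (Z j)).
Variable B : R.
Hypothesis B0 : 0 <= B.
Hypothesis tree_dom : forall H i (v : 'I_N -> nat -> Omega -> R) (a : 'I_N -> nat -> R),
  (forall j l, (l %/ 2 ^ H = i)%N -> nnelt (Z j) (v j l) (a j l)) ->
  (\int[mu]_w (nodesum H i (fun l => vanc_max rho v 0 H l w))%:E <=
   (B * nodesum H i (anc_max rho a 0 H))%:E)%E.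
Local Notation uM u D w := (multi_maximal lam D rho (fun j x => (u j x w)%:E)).
Local Notation cM c D := (multi_maximal lam D rho (fun j x => (c j x)%:E)).

Section tree.
Variables (u : 'I_N -> Rd R n -> Omega -> R) (c : 'I_N -> Rd R n -> R).
Hypothesis rep : forall j, simple_rep (Z j) (u j) (c j).

Let mu_w j w : measurable_fun setT (fun x => (u j x w)%:E).
Proof.
by apply/measurable_EFinP; have [mu_ _ _ _] := simple_rep_measurable (qZ j) (rep j);
  exact: mu_.
Qed.

Let mc j : measurable_fun setT (fun x => (c j x)%:E).
Proof.
by apply/measurable_EFinP; have [_ mc _ _] := simple_rep_measurable (qZ j) (rep j).
Qed.

(** Once the functions are replaced by their averages over cells, both maximal functions are
    discrete and [tree_dom] applies; the cell volume cancels. *)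
Lemma tree_integral (cr : 'I_n -> R) S K : 0 < S ->
  [/\ forall w, measurable_fun setT (uM u (tree_family cr S K) w),
      measurable_fun setT (fun w => \int[lam]_x uM u (tree_family cr S K) w x)%E &
      (\int[mu]_w \int[lam]_x uM u (tree_family cr S K) w x <=
        B%:E * \int[lam]_x cM c (tree_family cr S K) x)%E].
Proof.
move=> S0; pose box := tree_box cr S K; pose H := (K * n)%N.
have mbox k i : below_root H 0 k i -> measurable (box k i).
  by move=> _; exact: measurable_tree_box.
have boxS k i : below_root H 0 k.+1 i -> box k.+1 i = box k i.*2 `|` box k i.*2.+1.
  by move=> /below_top; exact: tree_boxS.
have boxD k i : below_root H 0 k.+1 i -> box k i.*2 `&` box k i.*2.+1 = set0.
  by move=> /below_top; exact: tree_box_disj.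
have box0 l : below_root H 0 0 l -> lam (box 0%N l) = (cell_volume n S K)%:E.
  by move=> _; exact: measure_tree_box0.
have V0 := cell_volume_gt0 n K S0.
have /choice[va vaP] : forall jl : 'I_N * nat, exists va : (Omega -> R) * R,
    [/\ nnelt (Z jl.1) va.1 va.2,
     forall w, avg lam (rho jl.1) (box 0%N jl.2) (fun x => (u jl.1 x w)%:E) = (va.1 w)%:E &
     avg lam (rho jl.1) (box 0%N jl.2) (fun x => (c jl.1 x)%:E) = (va.2)%:E].
  move=> [j l] /=.
  have cell0 : (0 < lam (box 0%N l) < +oo)%E.
    by rewrite /box measure_tree_box0// lte_fin V0 ltry.
  have [v [a [h1 h2 h3]]] := simple_rep_avg (qZ j) (@cZ j) (rho0 j)
    (measurable_tree_box cr S K 0%N l) cell0 (rep j).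
  by exists (v, a).
pose v j l := (va (j, l)).1; pose a j l := (va (j, l)).2.
have nva j l : nnelt (Z j) (v j l) (a j l) by have [] := vaP (j, l).
have v0 j l w : 0 <= v j l w by have [_] := nva j l.
have a0 j l : 0 <= a j l := nnelt_ge0 (qZ j) (nva j l).
have uE w x : uM u (tree_family cr S K) w x =
    (cell_step H 0 box (anc_max rho (fun j l => v j l w) 0 H) x)%:E.
  apply: (multi_maximal_boxE V0 mbox boxS boxD box0 rho0) => //.
  by move=> j l _; have [_ h _] := vaP (j, l); exact: h.
have cE x : cM c (tree_family cr S K) x = (cell_step H 0 box (anc_max rho a 0 H) x)%:E.
  apply: (multi_maximal_boxE V0 mbox boxS boxD box0 rho0) => //.
  by move=> j l _; have [_ _ h] := vaP (j, l); exact: h.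
have intE w : (\int[lam]_x uM u (tree_family cr S K) w x =
   (cell_volume n S K * nodesum H 0 (fun l => vanc_max rho v 0 H l w))%:E)%E.
  under eq_integral do rewrite uE.
  by rewrite (integral_cell_step mbox boxS boxD box0)// => l; exact: anc_max_ge0.
have mnode : measurable_fun setT (fun w => nodesum H 0 (fun l => vanc_max rho v 0 H l w)).
  apply: measurable_sum => l.
  apply: (@measurable_vanc_max _ _ _ _ _ (fun j => nnelt (Z j)) _ _ H 0 v a) => //.
  - by move=> j v1 a1 [].
  - by move=> j k i v1 a1; exact: (nnelt_nodemean (qZ j)).
  - by rewrite mul0n add0n divn_small.
split=> [w||].
- rewrite (_ : uM u _ w = EFin \o cell_step H 0 box (anc_max rho (fun j l => v j l w) 0 H)).
    by apply/measurable_EFinP; exact: measurable_cell_step.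
  exact/funext/uE.
- rewrite (_ : (fun w => _) = fun w => (cell_volume n S K *
      nodesum H 0 (fun l => vanc_max rho v 0 H l w))%:E); last exact/funext/intE.
  by apply/measurable_EFinP; apply: measurable_funM => //; exact: measurable_cst.
under eq_integral do rewrite intE EFinM.
rewrite ge0_integralZl//; last 3 first.
- exact/measurable_EFinP.
- by move=> w _; rewrite lee_fin nodesum_ge0// => l _; exact: anc_max_ge0.
- by rewrite lee_fin ltW.
under [in leRHS]eq_integral do rewrite cE.
rewrite (integral_cell_step mbox boxS boxD box0); last first.
  by move=> l; exact: anc_max_ge0.
rewrite -EFinM mulrCA EFinM; apply: lee_wpmul2l; first by rewrite lee_fin ltW.
by apply: tree_dom => j l _.
Qed.

End tree.

(** The factor with [6 ^+ n] comes from covering cubes by tree boxes, [2 ^ n] counts the shifted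
    grids, and the factor with [2 ^+ n] comes from enlarging tree boxes to cubes. *)
Theorem vector_maximal_bound : vector_maximal_estimate mu rho Z n
  ((\prod_j ((6 ^+ n) `^ (rho j)^-1)) *
   ((2 ^ n)%:R * (B * \prod_j ((2 ^+ n) `^ (rho j)^-1)))).
Proof.
move=> /= u c rep.
pose C6 : R := \prod_j ((6 ^+ n) `^ (rho j)^-1).
pose C2 : R := \prod_j ((2 ^+ n) `^ (rho j)^-1).
have C60 : 0 <= C6 by apply: prodr_ge0 => j _; exact: powR_ge0.
have C20 : 0 <= C2 by apply: prodr_ge0 => j _; exact: powR_ge0.
pose D (m : nat) (alpha : {ffun 'I_n -> bool}) :=
  tree_family (shifted_corner (2 ^+ m : R) alpha) (2 ^+ m) (2 * m).
have S0 (m : nat) : 0 < 2 ^+ m :> R by rewrite exprn_gt0.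
have uM0 A w x : (0 <= uM u A w x)%E by exact: multi_maximal_ge0.
have cM0 A x : (0 <= cM c A x)%E by exact: multi_maximal_ge0.
have Dint m alpha := tree_integral rep (shifted_corner (2 ^+ m) alpha) (2 * m) (S0 m).
have mD m alpha w : measurable_fun setT (uM u (D m alpha) w) by have [h _ _] := Dint m alpha.
have mDint m alpha : measurable_fun setT (fun w => \int[lam]_x uM u (D m alpha) w x)%E.
  by have [_ h _] := Dint m alpha.
have mgrid m w : measurable_fun setT (grid_maximal rho (fun j x => (u j x w)%:E) m).
  by apply: emeasurable_sum => alpha; exact: mD.
have J0 m alpha w : (0 <= \int[lam]_x uM u (D m alpha) w x)%E.
  by apply: integral_ge0 => x _.
pose J m w := (C6%:E * \sum_alpha \int[lam]_x uM u (D m alpha) w x)%E.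
have mJ m : measurable_fun setT (J m).
  by apply: measurable_funeM; exact: emeasurable_sum.
have Jpos m w : (0 <= J m w)%E by rewrite mule_ge0 ?lee_fin// sume_ge0.
have msum m w : measurable_fun setT
    (fun x => C6%:E * grid_maximal rho (fun j x => (u j x w)%:E) m x)%E.
  exact: measurable_funeM.
have sum0 m w x : (0 <= C6%:E * grid_maximal rho (fun j x => (u j x w)%:E) m x)%E.
  by rewrite mule_ge0 ?lee_fin// sume_ge0// => alpha _; exact: multi_maximal_ge0.
(* Each [J m] is measurable in [w], hence so is the lower limit. Fatou's lemma in x bounds the inner
   integral by it, and Fatou's lemma in w bounds its integral. *)
exists (fun w => limn_einf (fun m => J m w)); split.
- exact: measurable_limn_einf.
- by move=> w; exact: limn_einf_ge0.
- move=> w; apply: (@le_trans _ _ (\int[lam]_x limn_einf (fun m =>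
      C6%:E * grid_maximal rho (fun j x => (u j x w)%:E) m x))%E).
    by apply: ge0_le_lintegral => x _; [exact: uM0|exact: cubes_le_grids].
  apply: le_trans (fatou lam measurableT (fun m => msum m w) (fun m x _ => sum0 m w x)) _.
  rewrite le_eqVlt; apply/orP; left; apply/eqP; congr limn_einf; apply/funext => m.
  rewrite ge0_integralZl//; last first.
    by move=> x _; apply: sume_ge0 => alpha _; exact: multi_maximal_ge0.
  congr (_ * _)%E; rewrite ge0_integral_sum// => alpha; exact: mD.
apply: le_trans (fatou mu measurableT mJ (fun m w _ => Jpos m w)) _.
apply: limn_einf_le => m.
rewrite ge0_integralZl//; last 2 first.
- exact: emeasurable_sum.
- by move=> w _; apply: sume_ge0.
rewrite EFinM -muleA; apply: lee_wpmul2l; first by rewrite lee_fin.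
rewrite ge0_integral_sum//.
apply: (@le_trans _ _ (\sum_(alpha : {ffun 'I_n -> bool})
    (B * C2)%:E * \int[lam]_x cM c (@cubes R n) x)%E).
  apply: lee_sum => alpha _.
  have [_ _ h] := Dint m alpha; apply: le_trans h _; rewrite EFinM -muleA; apply: lee_wpmul2l; first by rewrite lee_fin.
  apply: (@le_trans _ _ (\int[lam]_x (C2%:E * cM c (@cubes R n) x))%E).
    by apply: ge0_le_lintegral => x _; [exact: cM0|exact: tree_le_cubes].
  apply: lintegralZ_le => //; apply: prodr_gt0 => j _; exact: powR_gt0.
rewrite -ge0_sume_distrl => [|alpha _]; last by rewrite lee_fin mulr_ge0.
rewrite sumEFin sumr_const card_ffun card_bool card_ord.
by rewrite mulr_natl.
Qed.

End vector_maximal_bound.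

(** * The extension theorem *)

Section powers_of_averages.
Context d (T : measurableType d) (R : realType).
Variable lam : {measure set T -> \bar R}.
Local Open Scope ereal_scope.

Lemma avg_poweR (rho q : R) (Q : set T) (h : T -> \bar R) : (0 < q)%R ->
  (forall x, 0 <= h x) -> avg lam (rho / q) Q (fun x => h x `^ q) = avg lam rho Q h `^ q.
Proof.
move=> q0 h0; rewrite /avg -poweRrM invf_div [(q / rho)%R]mulrC; congr ((_ * _) `^ _).
apply: eq_integral => x _; rewrite gee0_abs ?poweR_ge0// gee0_abs//.
by rewrite -poweRrM mulrCA mulfV ?gt_eqF// mulr1.
Qed.

Lemma prod_poweR n (x : 'I_n -> \bar R) (p : R) : (forall j, 0 <= x j) ->
  (\prod_j x j) `^ p = \prod_j x j `^ p.
Proof.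
move=> x0; suff : 0 <= \prod_j x j /\ (\prod_j x j) `^ p = \prod_j x j `^ p by case.
elim/big_ind2 : _ => [|a b c e [a0 <-] [c0 <-]|j _]; last by [].
  by rewrite lee01 poweR1r.
by rewrite mule_ge0// poweRM.
Qed.

Lemma ge0_poweR_le (q : R) (a b : \bar R) : (0 <= q)%R -> 0 <= a -> a <= b ->
  a `^ q <= b `^ q.
Proof.
move=> q0 a0 ab; apply: gt0_ler_poweR => //; rewrite in_itv/= leey andbT//.
exact: le_trans ab.
Qed.

Lemma ge0_poweRK (q : R) (a : \bar R) : (0 < q)%R -> 0 <= a -> (a `^ q) `^ q^-1 = a.
Proof. by move=> q0 a0; rewrite -poweRrM mulfV ?gt_eqF// poweRe1. Qed.

Lemma ge0_poweRVK (q : R) (a : \bar R) : (0 < q)%R -> 0 <= a -> (a `^ q^-1) `^ q = a.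
Proof. by move=> q0 a0; rewrite -poweRrM mulVf ?gt_eqF// poweRe1. Qed.

(** Turns the L^q bound for exponents [r] into an L^1 bound for exponents [r / q], the form in which
    the spaces [Y j] are used. *)
Lemma multi_maximal_poweR (D : set (set T)) n (r : 'I_n -> R) (q : R)
    (h : 'I_n -> T -> \bar R) x : (0 < q)%R -> (forall j x, 0 <= h j x) ->
  multi_maximal lam D (fun j => r j / q)%R (fun j x => h j x `^ q) x =
  multi_maximal lam D r h x `^ q.
Proof.
move=> q0 h0; have avgE Q : \prod_j avg lam (r j / q)%R Q (fun x => h j x `^ q) =
    (\prod_j avg lam (r j) Q (h j)) `^ q.
  rewrite prod_poweR => [|j]; last exact: avg_ge0.
  by apply: eq_bigr => j _; rewrite avg_poweR.
have P0 Q : 0 <= \prod_j avg lam (r j) Q (h j).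
  by apply: prode_ge0 => j _; exact: avg_ge0.
apply/eqP; rewrite eq_le; apply/andP; split.
  apply: multi_maximal_le => [|Q DQ Qx]; first exact: poweR_ge0.
  rewrite avgE; apply: ge0_poweR_le; rewrite ?(ltW q0)//.
  by have := multi_maximal_ubound lam r h x DQ; rewrite indicE mem_set// mule1.
rewrite -[leRHS](@ge0_poweRVK q)// ?multi_maximal_ge0//.
apply: ge0_poweR_le; rewrite ?(ltW q0) ?multi_maximal_ge0//.
apply: multi_maximal_le => [|Q DQ Qx]; first exact: poweR_ge0.
rewrite -[leLHS](@ge0_poweRK q)//; apply: ge0_poweR_le; rewrite ?invr_ge0 ?(ltW q0) ?poweR_ge0//.
rewrite -avgE; have := multi_maximal_ubound lam (fun j => r j / q)%R (fun j x => h j x `^ q) x DQ.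
by rewrite indicE mem_set// mule1.
Qed.

Lemma LnormE (q : R) (F : T -> \bar R) : (0 < q)%R ->
  Lnorm lam q%:E F = (\int[lam]_x `|F x| `^ q) `^ q^-1.
Proof.
by move=> q0; rewrite -poweR_Lnorm ?gt_eqF// ge0_poweRK// Lnorm_ge0.
Qed.

End powers_of_averages.

(** Matches the exponent of [g] in the scalar hypothesis with the dual exponent in the [UMD]
    condition of the concavified spaces. *)
Lemma conj_exp_div (R : realType) (q : R) (s : \bar R) : 0 < q -> (q%:E < s)%E ->
  conj_exp (s / q%:E)%E = (q^-1 - fine (s^-1)%E)^-1 / q.
Proof.
move=> q0; rewrite /conj_exp inver gt_eqF//; case: s => [s| |]//; last first.
  by rewrite gt0_mulye ?lte_fin ?invr_gt0// invey /= !subr0 invr1 invrK mulfV ?gt_eqF.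
rewrite lte_fin => qs; have s0 : 0 < s by exact: lt_trans qs.
rewrite -EFinM !inver !gt_eqF ?divr_gt0//= invf_div.
rewrite -invfM; congr (_^-1); rewrite mulrBl mulVf ?gt_eqF//.
by rewrite [q / s]mulrC.
Qed.

Section simple_values.
Context (R : realType) dS (S : measurableType dS) d (Omega : measurableType d).
Variable mu : {measure set Omega -> \bar R}.

Lemma simple_on_values (G : set (set S)) (X : fspace Omega R) f :
  quasi_banach_fs mu X -> simple_on G X f ->
  exists N (B : 'I_N -> set S) (zeta : 'I_N -> Omega -> R[i]),
  [/\ forall k, measurable (B k), trivIset setT B, forall k, X (zeta k) &
      forall x, exists k, B k x /\ f x = zeta k].
Proof.
move=> qX [M [A [xi [mA Xxi fE]]]].
(* The atoms generated by the sets [A k], indexed by the set of those [k] whose [A k] contains the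
   point. *)
pose B (sg : {set 'I_M}) := \bigcap_(k : 'I_M) (if k \in sg then A k else ~` A k).
have mB sg : measurable (B sg).
  apply: fin_bigcap_measurable => // k _; case: ifP => _; first by have [] := mA k.
  by apply: measurableC; have [] := mA k.
have Bsg sg x : B sg x -> sg = [set k | x \in A k]%SET.
  move=> Bx; apply/setP => k; rewrite inE; have := Bx k I; case: ifP => _ /=.
    by move=> Ax; rewrite mem_set.
  by move=> Ax; rewrite memNset.
exists #|{set 'I_M}|, (fun k => B (enum_val k)).
exists (fun k w => \sum_(l in (enum_val k : {set 'I_M})) xi l w); split=> [//||k|x].
- apply/trivIsetP => k l _ _ kl; apply/seteqP; split=> // x [/Bsg h1 /Bsg h2].
  by move/eqP : kl; apply; apply: enum_val_inj; rewrite h1 h2.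
- rewrite (_ : (fun w => _) = fun w => \sum_(l <- enum (enum_val k : {set 'I_M})) xi l w).
    exact: (mem_sum _ qX).
  by apply/funext => w; rewrite big_enum.
exists (enum_rank [set k | x \in A k]%SET); rewrite enum_rankK; split.
  by move=> k _; rewrite inE; case: ifPn => [/set_mem|/negP h] //= Ax; apply: h; exact: mem_set.
apply/funext => w; rewrite fE [RHS]big_mkcond/=; apply: eq_bigr => k _.
by rewrite inE indicE; case: (_ \in _); rewrite ?mul1r ?mul0r.
Qed.

End simple_values.

Lemma powR_quasi_add (R : realType) (q a b : R) : 0 <= q -> 0 <= a -> 0 <= b ->
  (a + b) `^ q <= 2 `^ q * (a `^ q + b `^ q).
Proof.
move=> q0 a0 b0; wlog ab : a b a0 b0 / a <= b.
  by move=> h; case/orP: (le_total a b) => ?; [|rewrite addrC [in leRHS]addrC]; exact: h.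
apply: (@le_trans _ _ ((2 * b) `^ q)).
  apply: ge0_ler_powR; rewrite ?nnegrE ?addr_ge0 ?mulr_ge0//.
  by rewrite mulr_natl mulr2n lerD2r.
by rewrite powRM// ler_wpM2l ?powR_ge0// lerDr powR_ge0.
Qed.

(** * A countable norming family for a strongly measurable function *)

Section countable_norming.
Context (R : realType) dS (S : measurableType dS) d (Omega : measurableType d).
Variables (lam : {measure set S -> \bar R}).
Variable mu : {sigma_finite_measure set Omega -> \bar R}.
Variables (PX PY : fspace Omega R) (q : R).
Hypotheses (q0 : 0 < q) (qPX : quasi_banach_fs mu PX).
Hypotheses (bPY : banach_fs mu PY) (ocPY : order_continuous mu PY).
Hypothesis pow_mem : forall z, PX z -> PY (real_fun (cpow q z)).
Hypothesis pow_norm : forall z, PX z ->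
  fnorm PY (real_fun (cpow q z)) = fnorm PX z `^ q.

Let qPY : quasi_banach_fs mu PY := bPY.1.

Let cpow_ge0 (z : Omega -> R[i]) w : 0 <= cpow q z w.
Proof. exact: powR_ge0. Qed.

Let cpow_add (z z' : Omega -> R[i]) w :
  cpow q (fun w => z w + z' w) w <= 2 `^ q * (cpow q z w + cpow q z' w).
Proof.
apply: le_trans (powR_quasi_add (ltW q0) (cabs_ge0 _) (cabs_ge0 _)).
by apply: ge0_ler_powR; rewrite ?nnegrE ?addr_ge0 ?cabs_ge0 ?(ltW q0)//; exact: cabsD.
Qed.

Let mcpow z : PX z -> measurable_fun setT (cpow q z).
Proof. by move=> /(qb_L0 qPX) /L0_cabs; exact: measurable_powR_comp. Qed.

(** [PX] is only quasi-normed; the triangle inequality of [PY] for powers provides the explicit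
    constant. *)
Let norm_add a z z' : PX a -> PX z -> PX z' -> a = (fun w => z w + z' w) ->
  fnorm PX a `^ q <= 2 `^ q * (fnorm PX z `^ q + fnorm PX z' `^ q).
Proof.
move=> Xa Xz Xz' aE; rewrite -!pow_norm//.
pose v w := cpow q z w + cpow q z' w.
have Yv : PY (real_fun v) by rewrite real_funD; apply: (qb_add qPY); exact: pow_mem.
apply: (@le_trans _ _ (fnorm PY (real_fun (fun w => 2 `^ q * v w)))).
  apply: (solid_real qPY _ _ _).2; first exact: mcpow.
    by rewrite real_funZ; exact: (qb_scale qPY).
  apply: nearW => w; rewrite !ger0_norm ?mulr_ge0 ?powR_ge0 ?addr_ge0 ?cpow_ge0//.
  by rewrite aE; exact: cpow_add.
rewrite real_funZ (qb_normZ qPY)// cabs_real ger0_norm ?powR_ge0//.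
rewrite ler_wpM2l ?powR_ge0// real_funD; apply: bPY.2; exact: pow_mem.
Qed.

Let pairing_bound e h : PX e -> nnelt (fs_dual mu PY) h 1 ->
  (\int[mu]_w (cpow q e w * h w)%:E <= (fnorm PX e `^ q)%:E)%E.
Proof.
move=> Xe [mh h0 Dh hn]; rewrite -pow_norm//.
rewrite (eq_integral (fun w => (`|cpow q e w| * `|h w|)%:E)); last first.
  by move=> w _; rewrite !ger0_norm.
apply: le_trans (dual_pairing_le qPY (pow_mem Xe) Dh _) _; first exact: nearW.
rewrite lee_fin ler_piMr//; apply: (qb_norm_ge0 qPY); exact: pow_mem.
Qed.

Lemma approximate_norming a z e h : PX a -> PX z -> PX e ->
  a = (fun w => z w + e w) -> z = (fun w => a w + (- e w)) ->
  nnelt (fs_dual mu PY) h 1 ->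
  (\int[mu]_w (cpow q z w * h w)%:E)%E = (fnorm PY (real_fun (cpow q z)))%:E ->
  ((fnorm PX a `^ q)%:E <=
   (2 `^ q * 2 `^ q)%:E * \int[mu]_w (cpow q a w * h w)%:E +
   ((2 `^ q * 2 `^ q + 2 `^ q) * fnorm PX e `^ q)%:E)%E.
Proof.
move=> Xa Xz Xe aE zE nh hz.
have [mh h0 Dh hn] := nh.
set A := (\int[mu]_w (cpow q a w * h w)%:E)%E.
have A0 : (0 <= A)%E by apply: integral_ge0 => w _; rewrite lee_fin mulr_ge0.
have mA b : PX b -> measurable_fun setT (fun w => (cpow q b w * h w)%:E).
  by move=> Xb; apply/measurable_EFinP; apply: measurable_funM => //; exact: mcpow.
have zA : ((fnorm PX z `^ q)%:E <= (2 `^ q)%:E * (A + (fnorm PX e `^ q)%:E))%E.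
  rewrite -pow_norm// -hz.
  apply: (@le_trans _ _ (\int[mu]_w ((2 `^ q)%:E *
      ((cpow q a w * h w)%:E + (cpow q e w * h w)%:E)))%E).
    apply: ge0_le_lintegral => w _; first by rewrite lee_fin mulr_ge0.
    rewrite -EFinD -EFinM lee_fin -mulrDl mulrA ler_wpM2r//.
    have -> : cpow q e w = cpow q (fun w => - e w) w by rewrite /cpow /cabs normcN.
    by rewrite {1}zE; exact: cpow_add.
  rewrite ge0_integralZl//; last 2 first.
  - by apply: emeasurable_funD; exact: mA.
  - by move=> w _; rewrite -EFinD lee_fin addr_ge0// mulr_ge0.
  apply: lee_wpmul2l; first by rewrite lee_fin powR_ge0.
  rewrite ge0_integralD//; last 4 first.
  - by move=> w _; rewrite lee_fin mulr_ge0.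
  - exact: mA.
  - by move=> w _; rewrite lee_fin mulr_ge0.
  - exact: mA.
  by apply: leeD2l; exact: pairing_bound.
have aN := norm_add Xa Xz Xe aE.
apply: (@le_trans _ _ ((2 `^ q * (fnorm PX z `^ q + fnorm PX e `^ q))%:E)).
  by rewrite lee_fin.
move: zA; have [->|Aoo] := eqVneq A +oo%E.
  by move=> _; rewrite gt0_muley ?lte_fin ?mulr_gt0 ?powR_gt0// addye// leey.
have : A \is a fin_num by rewrite ge0_fin_numE// lt_neqAle Aoo leey.
case: (A) => // y _; rewrite !lee_fin => zA.
have P0 : 0 <= 2 `^ q :> R by exact: powR_ge0.
have := ler_wpM2l P0 zA.
by move=> {}zA; rewrite mulrDr; lra.
Qed.

(** [F] is a limit of simple functions, which together have countably many values; a norming element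
    for each value works for all nearby [F x]. *)
Lemma countable_norming F : strongly_measurable lam PX F ->
  exists2 h : nat -> Omega -> R, (forall k, nnelt (fs_dual mu PY) (h k) 1) &
  {ae lam, forall x, PX (F x) /\ exists k, ((fnorm PX (F x) `^ q)%:E <=
     (2 * (2 `^ q * 2 `^ q))%:E * \int[mu]_w (cpow q (F x) w * h k w)%:E)%E}.
Proof.
move=> [_ [phi [sphi cphi]]].
have /choice[zeta zetaP] : forall N, exists zeta : nat -> Omega -> R[i],
    (forall k, PX (zeta k)) /\ forall x, exists k, phi N x = zeta k.
  move=> N; have [M [B [zeta [_ _ Xz fz]]]] := simple_on_values qPX (sphi N).
  (* The finitely many values of [phi N] are padded with zeros to a sequence. *)
  exists (fun k => oapp zeta (fun=> 0) (insub k)); split=> [k|x].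
    by case: insubP => [i _ _|_] /=; [exact: Xz|exact: (mem_zero qPX)].
  by have [k [_ ->]] := fz x; exists k; rewrite valK.
have /choice[h hP] : forall Nk : nat * nat, exists h : Omega -> R,
    nnelt (fs_dual mu PY) h 1 /\ (\int[mu]_w (cpow q (zeta Nk.1 Nk.2) w * h w)%:E)%E =
    (fnorm PY (real_fun (cpow q (zeta Nk.1 Nk.2))))%:E.
  move=> [N k] /=; have [h h1 h2] := norming_dual_element bPY ocPY
    (pow_mem ((zetaP N).1 k)) (cpow_ge0 _).
  by exists h.
exists (fun k => h (odflt (0, 0)%N (unpickle k))) => [k|]; first by have [] := hP (odflt (0, 0)%N (unpickle k)).
apply: filterS cphi => x [XF cF]; split=> //.
set A := fnorm PX (F x) `^ q; have A0 : 0 <= A by exact: powR_ge0.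
have [A_0|Agt] := eqVneq A 0.
  exists 0%N; rewrite A_0; apply: mule_ge0; first by rewrite lee_fin !mulr_ge0// powR_ge0.
  apply: integral_ge0 => w _; rewrite lee_fin mulr_ge0//.
  by have [[_ h0 _ _] _] := hP (odflt (0, 0)%N (unpickle 0)); exact: h0.
have {}Agt : 0 < A by rewrite lt_neqAle eq_sym Agt A0.
pose C : R := 2 `^ q * 2 `^ q + 2 `^ q.
have C0 : 0 < C by rewrite addr_gt0 ?mulr_gt0 ?powR_gt0.
pose eps := (A / (2 * C)) `^ q^-1.
have eps0 : 0 < eps by rewrite powR_gt0// divr_gt0// mulr_gt0.
move/cvgrPdist_lt : cF => /(_ eps eps0)[N _ /(_ N (leqnn _)) Neps].
rewrite /= sub0r normrN in Neps.
have [Xz /(_ x)[k phik]] := zetaP N.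
exists (pickle (N, k)); rewrite pickleK /=; have [nh hz] := hP (N, k).
pose e w := F x w - zeta N k w.
pose e' w := zeta N k w - F x w.
have Xe' : PX e'.
  rewrite (_ : e' = fun w => zeta N k w + (-1) * F x w).
    by apply: (qb_add qPX) => //; exact: (qb_scale qPX).
  by apply/funext => w; rewrite mulN1r.
have eE : e = fun w => (-1) * e' w by apply/funext => w; rewrite mulN1r opprB.
have Xe : PX e by rewrite eE; exact: (qb_scale qPX).
have ne : fnorm PX e = fnorm PX e'.
  by rewrite eE (qb_normZ qPX)// (_ : cabs (-1) = 1) ?mul1r// /cabs normcN -[Normc.normc _]/(cabs (1%:C)%C) cabs_real normr1.
have en : fnorm PX e `^ q <= A / (2 * C).
  rewrite ne -[leRHS](@powRVK _ _ q)//; last by rewrite divr_ge0 ?mulr_ge0 ?(ltW C0).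
  apply: ge0_ler_powR; rewrite ?nnegrE ?powR_ge0 ?(ltW q0)//.
    exact: (qb_norm_ge0 qPX).
  rewrite -/eps; apply/ltW; apply: le_lt_trans Neps; rewrite phik; exact: ler_norm.
have := @approximate_norming (F x) (zeta N k) e (h (N, k)) XF (Xz k) Xe _ _ nh hz.
have E1 : F x = fun w => zeta N k w + e w by apply/funext => w; rewrite /e addrC subrK.
have E2 : zeta N k = fun w => F x w + (- e w) by apply/funext => w; rewrite /e opprB addrC subrK.
move=> /(_ E1 E2); rewrite -/A -/C.
set I := (\int[mu]_w _)%E => AI.
have I0 : (0 <= I)%E.
  apply: integral_ge0 => w _; rewrite lee_fin mulr_ge0//.
  by have [_ h0 _ _] := nh; exact: h0.
have P0 : 0 < 2 `^ q * 2 `^ q :> R by rewrite mulr_gt0 ?powR_gt0.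
move: AI; have [->|Ioo] := eqVneq I +oo%E.
  by move=> _; rewrite gt0_muley ?leey// lte_fin mulr_gt0.
have : I \is a fin_num by rewrite ge0_fin_numE// lt_neqAle Ioo leey.
case: (I) => // y _; rewrite !lee_fin => Ay.
have : C * fnorm PX e `^ q <= A / 2.
  apply: le_trans (ler_wpM2l (ltW C0) en) _.
  by rewrite invfM mulrCA [C * (2^-1 * _)]mulrCA mulfV ?gt_eqF// mulr1.
by lra.
Qed.

End countable_norming.

Section argmax.
Context (R : realType) dS (S : measurableType dS).
Variables (K : nat) (Phi : nat -> S -> \bar R).

(** Ties go to the smallest index, so that the cells are disjoint and still cover. *)
Definition argmax_cell (k : 'I_K.+1) : set S :=
  [set x | (forall l : 'I_K.+1, (Phi l x <= Phi k x)%E) /\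
           forall l : 'I_K.+1, (l < k)%N -> (Phi l x < Phi k x)%E].

Lemma measurable_argmax_cell k : (forall l, measurable_fun setT (Phi l)) ->
  measurable (argmax_cell k).
Proof.
move=> mPhi; rewrite (_ : argmax_cell k =
    (\bigcap_(l : 'I_K.+1) [set x | (Phi l x <= Phi k x)%E]) `&`
    (\bigcap_(l : 'I_K.+1) (if (l < k)%N then [set x | (Phi l x < Phi k x)%E] else setT))).
  apply: measurableI; apply: fin_bigcap_measurable => // l _.
    by rewrite -[X in measurable X]setTI; exact: measurable_lee.
  case: ifP => // _.
  by rewrite -[X in measurable X]setTI; exact: measurable_lte.
apply/seteqP; split=> x [h1 h2]; split=> l.
- by move=> _; exact: h1.
- by move=> _; case: ifP => // lk; exact: h2.
- exact: (h1 l).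
- by move=> lk; have := h2 l I; rewrite lk.
Qed.

Lemma trivIset_argmax_cell : trivIset setT argmax_cell.
Proof.
apply/trivIsetP => k l _ _ kl; apply/seteqP; split=> // x [[k1 k2] [l1 l2]].
have /orP[h|h] : (k < l)%N || (l < k)%N by rewrite -neq_ltn.
- by have := lt_le_trans (l2 k h) (k1 l); rewrite ltxx.
- by have := lt_le_trans (k2 l h) (l1 k); rewrite ltxx.
Qed.

Lemma argmax_cell_cover x : exists k, argmax_cell k x.
Proof.
suff : forall k : nat, (k <= K)%N -> exists k0 : 'I_K.+1,
    (forall l : nat, (l <= k)%N -> (Phi l x <= Phi k0 x)%E) /\
    forall l : 'I_K.+1, (l < k0)%N -> (Phi l x < Phi k0 x)%E.
  move=> /(_ K (leqnn K))[k0 [h1 h2]]; exists k0; split=> // l.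
  by apply: h1; rewrite -ltnS.
elim=> [_|k IH kK].
  by exists ord0; split=> // l; rewrite leqn0 => /eqP ->.
have [k0 [h1 h2]] := IH (ltnW kK).
have [lt|ge] := ltP (Phi k0 x) (Phi k.+1 x).
  exists (Ordinal (kK : (k.+1 < K.+1)%N)); split=> /= l; last first.
    by rewrite ltnS => /h1 h; exact: le_lt_trans lt.
  rewrite leq_eqVlt => /orP[/eqP ->//|]; rewrite ltnS => /h1 h.
  exact: le_trans h (ltW lt).
exists k0; split=> // l; rewrite leq_eqVlt => /orP[/eqP ->//|].
by rewrite ltnS => /h1.
Qed.

End argmax.

Section representations.
Context (R : realType) d (Omega : measurableType d).
Variable mu : {measure set Omega -> \bar R}.

Lemma simple_rep_cpow dS (S : measurableType dS) (G : set (set S))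
    (X : fspace Omega R) (q : R) f :
  0 < q -> quasi_banach_fs mu X -> simple_on G X f ->
  simple_rep (concavification q X) (fun x => cpow q (f x)) (fun x => fnorm X (f x) `^ q).
Proof.
move=> q0 qX sf; have [N [B [zeta [mB tB Xz fz]]]] := simple_on_values qX sf.
have out (e : 'I_N -> R) x k : B k x -> \sum_l \1_(B l) x * 1 * e l = e k.
  move=> Bk; rewrite (bigD1 k)//= big1 => [|l lk]; first by rewrite indicE mem_set// !mul1r addr0.
  rewrite indicE memNset ?mul0r// => Bl.
  by move/trivIsetP : tB => /(_ l k I I lk)/seteqP[/(_ x) + _]; exact.
exists N, B, (cst 1), (fun k => cpow q (zeta k)), (fun k => fnorm X (zeta k) `^ q); split.
- by [].
- by split; [exact: measurable_cst|exists 1 => x /=; rewrite ler01 lexx].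
- move=> k; have L0z : L0 (zeta k) := qb_L0 qX (Xz k).
  have mz : measurable_fun setT (cpow q (zeta k)).
    by apply: measurable_powR_comp; exact: L0_cabs.
  have rE : real_fun (fun w => cabs (real_fun (cpow q (zeta k)) w) `^ q^-1) =
      real_fun (fun w => cabs (zeta k w)).
    apply/funext => w; rewrite /real_fun cabs_real ger0_norm ?powR_ge0//.
    by rewrite powRK// cabs_ge0.
  have [Xa na] : X (real_fun (fun w => cabs (zeta k w))) /\
      fnorm X (real_fun (fun w => cabs (zeta k w))) <= fnorm X (zeta k).
    apply: (qb_solid qX) => //; first by apply/L0_real; exact: L0_cabs.
    by apply: nearW => w; rewrite cabs_real ger0_norm// cabs_ge0.
  split=> //; first by move=> w; exact: powR_ge0.
    by split; [exact/L0_real|rewrite rE].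
  rewrite /= rE; apply: ge0_ler_powR; rewrite ?nnegrE ?(ltW q0)//; exact: (qb_norm_ge0 qX).
- by move=> x w; have [k [Bk ->]] := fz x; rewrite (out (fun k => cpow q (zeta k) w) x k).
- by move=> x; have [k [Bk ->]] := fz x; rewrite (out (fun k => fnorm X (zeta k) `^ q) x k).
Qed.

Lemma simple_on_slice n (X : fspace Omega R) (f : Rd R n -> Omega -> R[i]) w :
  simple_on (@bounded_Rd R n) X f -> Linfty_c (fun x => f x w).
Proof.
move=> [N [A [xi [mA Xxi fE]]]]; split.
- rewrite (_ : (fun x => _) = fun x => \sum_k (\1_(A k) x)%:C%C * xi k w).
    apply: L0_sum => k; apply: L0_mul; last exact: L0_cst.
    by apply: L0_indic; have [] := mA k.
  exact/funext.
- exists (\sum_k cabs (xi k w)) => x; rewrite fE; apply: le_trans (cabs_sum _ _ _) _.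
  apply: ler_sum => k _; rewrite cabsM cabs_real ger0_norm// ler_piMl ?cabs_ge0//.
have /choice[B BP] : forall k, exists B : R, forall t, A k t -> forall i, `|tnth t i : R| <= B.
  by move=> k; have [_] := mA k.
exists (\sum_k `|B k|) => t /= ft i.
have [/existsP[k /asboolP At]|] := boolP [exists k, `[< A k t >]].
  apply: le_trans (BP k t At i) _; rewrite (bigD1 k)//=.
  by apply: le_trans (ler_norm _) _; rewrite lerDl sumr_ge0.
rewrite negb_exists => /forallP nA; move: ft; rewrite fE big1 ?eqxx// => k _.
rewrite indicE memNset ?mul0r// => At; have := nA k; by rewrite asboolT.
Qed.

End representations.

Section scalar_bound.
Variables (R : realType) (n m : nat) (r : 'I_m -> R) (q rhos : R).
Hypothesis q0 : 0 < q.
Local Notation lam := (lebesgue_Rd R n).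
Variables (T : ('I_m -> Rd R n -> R[i]) -> Rd R n -> R[i]) (CT : R).
Hypothesis CT0 : 0 < CT.
Hypothesis hT : forall f g, (forall j, Linfty_c (f j)) -> Linfty_c g ->
  (Lnorm lam q%:E (fun x => (cabs (T f x * g x)%R)%:E) <=
   CT%:E * Lnorm lam q%:E
     (multi_maximal lam (@cubes R n) (snoc r rhos)
        (snoc (fun j x => (cabs (f j x))%:E) (fun x => (cabs (g x))%:E))))%E.

Lemma scalar_power_bound f (v : Rd R n -> R) (M : R) : (forall j, Linfty_c (f j)) ->
  measurable_fun setT v -> (forall x, 0 <= v x <= M) ->
  bounded_Rd [set x | v x != 0] ->
  (\int[lam]_x (cabs (T f x) `^ q * v x)%:E <= (CT `^ q)%:E * \int[lam]_x
     multi_maximal lam (@cubes R n) (fun j => snoc r rhos j / q)%R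
       (fun j x => (snoc (fun i x => cabs (f i x) `^ q) v j x)%:E) x)%E.
Proof.
move=> lf mv vM bv; pose g := real_fun (fun x => v x `^ q^-1).
have v0 x : 0 <= v x by have /andP[] := vM x.
have gE x : cabs (g x) = v x `^ q^-1 by rewrite cabs_real ger0_norm// powR_ge0.
have lg : Linfty_c g.
  split; first by apply/L0_real; exact: measurable_powR_comp.
    exists (M `^ q^-1) => x; rewrite gE; have /andP[_ h] := vM x.
    by apply: ge0_ler_powR; rewrite ?nnegrE ?invr_ge0 ?(ltW q0) ?(le_trans (v0 x) h).
  have [B hB] := bv; exists B => t /= gt; apply: hB => /=; apply: contra gt => /eqP vt.
  by rewrite /g /real_fun vt powR0 // invr_neq0// gt_eqF.
pose H := snoc (fun j x => (cabs (f j x))%:E) (fun x => (cabs (g x))%:E).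
have := hT lf lg; rewrite -/H.
have H0 j x : (0 <= H j x)%E.
  by rewrite /H /snoc; case: unlift => [i|]; rewrite /oapp lee_fin; exact: cabs_ge0.
move=> /(@ge0_poweR_le _ q _ _ (ltW q0) (Lnorm_ge0 _ _ _)).
rewrite poweRM ?lee_fin ?(ltW CT0) ?Lnorm_ge0// poweR_EFin !poweR_Lnorm ?gt_eqF//.
rewrite (_ : (\int[lam]_x (`|(cabs (T f x * g x))%:E| `^ q))%E =
    (\int[lam]_x (cabs (T f x) `^ q * v x)%:E)%E); last first.
  apply: eq_integral => x _; rewrite gee0_abs ?lee_fin ?cabs_ge0// poweR_EFin.
  by rewrite cabsM gE powRM ?cabs_ge0 ?powR_ge0// powRVK.
rewrite (_ : (\int[lam]_x (`|multi_maximal lam (@cubes R n) (snoc r rhos) H x| `^ q))%E =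
    (\int[lam]_x multi_maximal lam (@cubes R n) (fun j => snoc r rhos j / q)%R
       (fun j x => (snoc (fun i x => cabs (f i x) `^ q) v j x)%:E) x)%E)//.
apply: eq_integral => x _; rewrite gee0_abs ?multi_maximal_ge0//.
rewrite -(multi_maximal_poweR _ _ _ _ q0 H0); congr (multi_maximal _ _ _ _ _).
apply/funext => j; apply/funext => y; rewrite /H /snoc; case: unlift => [i|]; rewrite /oapp.
  by rewrite poweR_EFin.
by rewrite poweR_EFin gE powRVK.
Qed.

End scalar_bound.

Section UMD_bound.
Context (R : realType) d (Omega : measurableType d).
Variable mu : {sigma_finite_measure set Omega -> \bar R}.
Variables (n m : nat) (r : 'I_m -> R) (q : R) (s : \bar R) (Y : 'I_m -> fspace Omega R).
Hypotheses (n0 : (0 < n)%N) (q0 : 0 < q) (qs : (q%:E < s)%E).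
Hypothesis umd : UMD mu (fun j => r j / q) (s / q%:E)%E Y.
Local Notation lam := (lebesgue_Rd R n).
Local Notation rhos := ((q^-1 - fine (s^-1)%E)^-1).
Local Notation D := (fs_dual mu (fs_product mu Y)).

Let rho_eq : snoc (fun j => r j / q) (conj_exp (s / q%:E)%E) = fun j => snoc r rhos j / q.
Proof. by apply/funext => j; rewrite conj_exp_div// /snoc; case: unlift. Qed.

Lemma UMD_quasi_banach : (forall j, quasi_banach_fs mu (snoc Y D j)) /\
  forall j, quasi_banach_fs mu (Y j).
Proof.
have [_ _ _ _ [[qZ _] _ _ _]] := umd; split=> // j.
by have := qZ (lift ord_max j); rewrite snoc_lift.
Qed.

Lemma UMD_vector_maximal_bound : exists2 K0 : R, 0 <= K0 &
  vector_maximal_estimate mu (fun j => snoc r rhos j / q) (snoc Y D) n K0.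
Proof.
have [_ _ [qPY _] _ hHL] := umd; have [qZ qY] := UMD_quasi_banach.
rewrite rho_eq in hHL; have [_ rho0 cZ _] := hHL.
have [B B0 treeB] := HL_tree_domination hHL (int_le_enorm_dual qY qPY qZ).
eexists; last by move=> u c rep; exact: (vector_maximal_bound n0 rho0 qZ cZ B0 treeB rep).
rewrite !mulr_ge0//; apply: prodr_ge0 => j _; exact: powR_ge0.
Qed.

End UMD_bound.

(** * Linearised suprema and the scalar hypothesis *)

Section partial_suprema.
Context (R : realType) d (Omega : measurableType d).
Variable mu : {sigma_finite_measure set Omega -> \bar R}.
Variables (n m : nat) (X : 'I_m -> fspace Omega R) (r : 'I_m -> R) (q rhos K0 CT : R).
Local Notation lam := (lebesgue_Rd R n).
Let Y j := concavification q (X j).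
Local Notation D := (fs_dual mu (fs_product mu Y)).
Hypotheses (q0 : 0 < q) (CT0 : 0 < CT) (K00 : 0 <= K0).
Hypothesis qX : forall j, quasi_banach_fs mu (X j).
Hypothesis vector_bound :
  vector_maximal_estimate mu (fun j => snoc r rhos j / q) (snoc Y D) n K0.
Variable T : ('I_m -> Rd R n -> R[i]) -> Rd R n -> R[i].
Hypothesis T_L0 : forall f, (forall j, Linfty_c (f j)) -> L0 (T f).
Hypothesis hT : forall f g, (forall j, Linfty_c (f j)) -> Linfty_c g ->
  (Lnorm lam q%:E (fun x => (cabs (T f x * g x)%R)%:E) <=
   CT%:E * Lnorm lam q%:E
     (multi_maximal lam (@cubes R n) (snoc r rhos)
        (snoc (fun j x => (cabs (f j x))%:E) (fun x => (cabs (g x))%:E))))%E.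
Variables (f : 'I_m -> Rd R n -> Omega -> R[i]) (F : Rd R n -> Omega -> R[i]).
Hypothesis sf : forall j, simple_on (@bounded_Rd R n) (X j) (f j).
Hypothesis L0F : L0 (fun xw : Rd R n * Omega => F xw.1 xw.2).
Hypothesis FT : {ae mu, forall w, {ae lam, forall x, F x w = T (fun j y => f j y w) x}}.
Variables (G : Rd R n -> R) (M : R).
Hypotheses (mG : measurable_fun setT G) (GM : forall x, 0 <= G x <= M).
Hypothesis bG : bounded_Rd [set x | G x != 0].
Variable h : nat -> Omega -> R.
Hypothesis hD : forall k, nnelt D (h k) 1.

Let U (x : Rd R n) w := cpow q (F x) w.

Let mU : measurable_fun setT (fun xw : Rd R n * Omega => U xw.1 xw.2).
Proof. exact: (measurable_powR_comp _ (L0_cabs L0F)). Qed.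

Let U0 x w : 0 <= U x w. Proof. exact: powR_ge0. Qed.
Let G0 x : 0 <= G x. Proof. by have /andP[] := GM x. Qed.
Let h0 k w : 0 <= h k w. Proof. by have [_ ? _ _] := hD k. Qed.
Let mh k : measurable_fun setT (h k). Proof. by have [? _ _ _] := hD k. Qed.

Definition norming_value (k : nat) (x : Rd R n) : \bar R :=
  (\int[mu]_w (cpow q (F x) w * h k w)%:E)%E.

Let Phi := norming_value.

Let mPhi k : measurable_fun setT (Phi k).
Proof.
apply: (measurable_fun_fubini_tonelli_F (fun xw : Rd R n * Omega => (U xw.1 xw.2 * h k xw.2)%:E)).
  apply/measurable_EFinP; apply: measurable_funM => //.
  by apply: measurableT_comp => //; exact: measurable_snd.
by move=> x; rewrite lee_fin mulr_ge0.
Qed.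

(** The supremum over the norming elements sits inside the x-integral. A selection measurable in x
    replaces it by a single weight depending on (x, w), after which the order of integration can be
    exchanged. *)
Lemma partial_supremum_bound K : exists W : Rd R n -> \bar R,
  [/\ measurable_fun setT W, forall x, (0 <= W x)%E,
      forall k x, (k <= K)%N -> ((G x)%:E * norming_value k x <= W x)%E &
      (\int[lam]_x W x <= (CT `^ q * K0)%:E * \int[lam]_x multi_maximal lam (@cubes R n)
         (fun j => (snoc r rhos j / q)%R)
         (fun j x => (snoc (fun i x => fnorm (X i) (f i x) `^ q) G j x)%:E) x)%E].
Proof.
pose E := @argmax_cell R _ (Rd R n) K Phi.
have mE k : measurable (E k) by exact: measurable_argmax_cell.
have tE := @trivIset_argmax_cell R _ (Rd R n) K Phi; rewrite -/E in tE.
(* On [E k] the weight is [G x * h k w], so integrating it against [U x] gives [G x] times the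
   largest of the first norming values. *)
pose v x w := \sum_(k < K.+1) \1_(E k) x * G x * h k w.
have vE k x w : E k x -> v x w = G x * h k w.
  move=> Ek; rewrite /v (bigD1 k)//= big1 => [|l lk]; first by rewrite indicE mem_set// mul1r addr0.
  rewrite indicE memNset ?mul0r// => El.
  by move/trivIsetP : tE => /(_ l k I I lk)/seteqP[/(_ x) + _]; exact.
have v0 x w : 0 <= v x w by rewrite sumr_ge0// => k _; rewrite !mulr_ge0.
pose V (xw : Rd R n * Omega) := (U xw.1 xw.2 * v xw.1 xw.2)%:E.
have V0 xw : (0 <= V xw)%E by rewrite lee_fin mulr_ge0.
have mV : measurable_fun setT V.
  apply/measurable_EFinP; apply: measurable_funM => //.
  apply: measurable_sum => k; apply: measurable_funM; last first.
    by apply: measurableT_comp => //; exact: measurable_snd.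
  apply: (@measurableT_comp _ _ _ _ _ _ (fun x => \1_(E k) x * G x) _ fst) => //.
    by apply: measurable_funM => //; exact: measurable_indic.
exists (fubini_F mu V); split.
- exact: measurable_fun_fubini_tonelli_F.
- by move=> x; apply: integral_ge0 => w _; exact: V0.
- move=> k x kK; have [k1 Ek1] := argmax_cell_cover K Phi x.
  rewrite /fubini_F (eq_integral (fun w => (G x)%:E * (cpow q (F x) w * h k1 w)%:E)%E); last first.
    by move=> w _; rewrite /V (vE k1)// -EFinM mulrCA.
  have mUx : measurable_fun setT (U x).
    exact: (measurableT_comp mU (pair1_measurable x)).
  rewrite ge0_integralZl//; last 3 first.
  + by apply/measurable_EFinP; apply: measurable_funM.
  + by move=> w _; rewrite lee_fin mulr_ge0 ?powR_ge0.
  + by rewrite lee_fin.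
  apply: lee_wpmul2l; first by rewrite lee_fin.
  by have [/(_ (Ordinal (kK : (k < K.+1)%N)))] := Ek1.
pose u := snoc (fun i x w => cpow q (f i x) w) v.
pose c := snoc (fun i x => fnorm (X i) (f i x) `^ q) G.
have rep j : simple_rep (snoc Y D j) (u j) (c j).
  case: (unliftP ord_max j) => [i ->|->]; rewrite /u /c ?snoc_lift ?snoc_last.
    exact: simple_rep_cpow.
  (* The last function is simple up to the scalar factor [G]; as the [h k] have norm at most 1 and
     the cells cover, its majorant is [G] itself. *)
  exists K.+1, E, G, (fun k => h k), (fun=> 1); split => //.
  - by split => //; exists M.
  - move=> x; have [k1 Ek1] := argmax_cell_cover K Phi x.
    rewrite (bigD1 k1)//= big1 => [|l lk]; first by rewrite indicE mem_set// mul1r mulr1 addr0.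
    rewrite indicE memNset ?mul0r// => El.
    by move/trivIsetP : tE => /(_ l k1 I I lk)/seteqP[/(_ x) + _]; exact.
have [theta [mtheta theta0 utheta inttheta]] := vector_bound rep.
rewrite [leLHS](fubini_tonelli V mV V0).
apply: (@le_trans _ _ (\int[mu]_w ((CT `^ q)%:E * theta w))%E); last first.
  rewrite ge0_integralZl//; last by rewrite lee_fin powR_ge0.
  by rewrite EFinM -muleA; apply: lee_wpmul2l; rewrite ?lee_fin ?powR_ge0.
apply: ae_le_lintegral => [w|w||].
- by apply: integral_ge0 => x _.
- by rewrite mule_ge0// lee_fin powR_ge0.
- exact: measurable_funeM.
apply: filterS FT => w FTw.
have mvw : measurable_fun setT (v^~ w).
  apply: measurable_sum => k; apply: measurable_funM; last exact: measurable_cst.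
  by apply: measurable_funM => //; exact: measurable_indic.
(* The scalar hypothesis requires a bounded weight; the bound may depend on the fixed [w]. *)
have vM x : 0 <= v x w <= M * \sum_(k < K.+1) h k w.
  rewrite v0 /= mulr_sumr; apply: ler_sum => k _; apply: ler_wpM2r => //.
  have /andP[_ GMx] := GM x; apply: le_trans GMx; rewrite ler_piMl//.
have bv : bounded_Rd [set x | v x w != 0].
  have [B hB] := bG; exists B => t /= vt; apply: hB => /=; apply: contra vt => /eqP Gt.
  by rewrite /v big1// => k _; rewrite Gt mulr0 mul0r.
have lf j : Linfty_c (fun y => f j y w) by exact: simple_on_slice (sf j).
have := scalar_power_bound q0 CT0 hT lf mvw vM bv => bnd.
apply: (@le_trans _ _ (\int[lam]_x (cabs (T (fun j y => f j y w) x) `^ q * v x w)%:E)%E).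
  apply: ae_le_lintegral => [x|x||].
  - exact: V0.
  - by rewrite lee_fin mulr_ge0// powR_ge0.
  - apply/measurable_EFinP; apply: measurable_funM => //.
    exact: (measurable_powR_comp _ (L0_cabs (T_L0 lf))).
  by apply: filterS FTw => x FTx; rewrite /V /U /cpow /= FTx.
apply: le_trans bnd _; apply: lee_wpmul2l; first by rewrite lee_fin powR_ge0.
have uE : (fun j x => (u j x w)%:E) = (fun j (x : Rd R n) =>
    (snoc (fun i x => cabs (f i x w) `^ q) (v^~ w) j x)%:E).
  by apply/funext => j; apply/funext => y; rewrite /u /snoc; case: unlift.
by rewrite -uE; exact: utheta.
Qed.

End partial_suprema.

Lemma simple_on_mem (R : realType) dS (S : measurableType dS) d (Omega : measurableType d)
    (mu : {measure set Omega -> \bar R}) (G : set (set S)) (X : fspace Omega R) f x :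
  quasi_banach_fs mu X -> simple_on G X f -> X (f x).
Proof.
move=> qX sf; have [N [B [zeta [_ _ Xz fz]]]] := simple_on_values qX sf.
by have [k [_ ->]] := fz x.
Qed.

Theorem theorem5p1 (R : realType) (n m : nat)
    (d : measure_display) (Omega : measurableType d)
    (mu : {sigma_finite_measure set Omega -> \bar R})
    (X : 'I_m -> fspace Omega R) (r : 'I_m -> R) (q : R) (s : \bar R) :
  (0 < n)%N -> (0 < m)%N ->
  (forall j, 0 < r j) -> 0 < q -> (q%:E < s)%E ->
  qbfs_tuple mu X ->
  UMD mu (fun j => r j / q) (s / q%:E)%E (fun j => concavification q (X j)) ->
  exists2 K : R, 0 < K &
  forall (T : ('I_m -> Rd R n -> R[i]) -> Rd R n -> R[i]) (CT : R),
    0 < CT ->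
    (forall f, (forall j, Linfty_c (f j)) -> L0 (T f)) ->
    (forall f g, (forall j, Linfty_c (f j)) -> Linfty_c g ->
      (Lnorm (lebesgue_Rd R n) q%:E (fun x => (cabs (T f x * g x)%R)%:E) <=
       CT%:E * Lnorm (lebesgue_Rd R n) q%:E
         (multi_maximal (lebesgue_Rd R n) (@cubes R n)
            (snoc r ((q^-1 - fine (s^-1)%E)^-1)%R)
            (snoc (fun j x => (cabs (f j x))%:E) (fun x => (cabs (g x))%:E))))%E) ->
  forall Ttilde : ('I_m -> Rd R n -> Omega -> R[i]) -> Rd R n -> Omega -> R[i],
    (forall f,
      (forall j, simple_on (@bounded_Rd R n) (X j) (f j)) ->
      vector_extension mu (fs_product mu X) T f (Ttilde f)) ->
  forall (f : 'I_m -> Rd R n -> Omega -> R[i]) (g : Rd R n -> R[i]),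
    (forall j, simple_on (@bounded_Rd R n) (X j) (f j)) -> Linfty_c g ->
    (Lnorm (lebesgue_Rd R n) q%:E
       (fun x => vnorm (fs_product mu X) (Ttilde f x) * (cabs (g x))%:E) <=
     (K * CT)%R%:E * Lnorm (lebesgue_Rd R n) q%:E
       (multi_maximal (lebesgue_Rd R n) (@cubes R n)
          (snoc r ((q^-1 - fine (s^-1)%E)^-1)%R)
          (snoc (fun j x => vnorm (X j) (f j x)) (fun x => (cabs (g x))%:E))))%E.
Proof.
move=> n0 _ _ q0 qs [qX qPX] umd; have [_ _ bPY ocPY _] := umd.
have [_ qY] := UMD_quasi_banach umd.
have [K0 K00 vbound] := UMD_vector_maximal_bound n0 q0 qs umd.
pose C : R := 2 * (2 `^ q * 2 `^ q).
have C0 : 0 < C by rewrite !mulr_gt0 ?powR_gt0.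
have CK : 0 <= C * K0 by rewrite mulr_ge0 ?(ltW C0).
(* The summand 1 only makes the constant positive. *)
exists ((C * K0 + 1) `^ q^-1); first by rewrite powR_gt0// ltr_wpDl.
move=> T CT CT0 T_L0 hT Tt hTt f g sf lg.
have [smF FT] := hTt f sf; set F := Tt f in smF FT *.
have [h hD normF] := countable_norming q0 qPX bPY ocPY
  (concavification_product_mem q0 qX) (concavification_product_norm q0 qX qY) smF.
pose G x := cabs (g x) `^ q.
have [L0g [B gB] [B' bg]] := lg.
have mG : measurable_fun setT G := measurable_powR_comp _ (L0_cabs L0g).
have GM x : 0 <= G x <= B `^ q.
  rewrite powR_ge0/=; apply: ge0_ler_powR; rewrite ?nnegrE ?cabs_ge0 ?(ltW q0)//.
  exact: le_trans (cabs_ge0 (g x)) (gB x).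
have bG : bounded_Rd [set x | G x != 0].
  exists B' => t /= Gt; apply: bg => /=; apply: contra Gt => /eqP g0.
  by rewrite /G g0 cabs0 powR0// gt_eqF.
have /choice[W WP] := partial_supremum_bound q0 CT0 qX vbound T_L0 hT sf smF.1 FT
  mG GM bG hD.
set I := (\int[_]_x _)%E in WP.
have mW K : measurable_fun setT (W K) by have [] := WP K.
have W0 K x : (0 <= W K x)%E by have [] := WP K.
rewrite !LnormE//.
have -> : (\int[lebesgue_Rd R n]_x (`|multi_maximal (lebesgue_Rd R n) (@cubes R n)
    (snoc r ((q^-1 - fine (s^-1)%E)^-1)%R)
    (snoc (fun j x => vnorm (X j) (f j x)) (fun x => (cabs (g x))%:E)) x| `^ q) = I)%E.
  pose H := snoc (fun j x => vnorm (X j) (f j x)) (fun x => (cabs (g x))%:E).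
  have fE j x : vnorm (X j) (f j x) = (fnorm (X j) (f j x))%:E.
    by rewrite /vnorm asboolT//; exact: simple_on_mem (qX j) (sf j).
  have H0 j x : (0 <= H j x)%E.
    rewrite /H /snoc; case: unlift => [i|]; rewrite /oapp ?fE lee_fin; last exact: cabs_ge0.
    by apply: (qb_norm_ge0 (qX i)); exact: simple_on_mem (qX i) (sf i).
  have HE : (fun j x => (H j x `^ q)%E) = (fun j (x : Rd R n) =>
      (snoc (fun i x => fnorm (X i) (f i x) `^ q) G j x)%:E).
    apply/funext => j; apply/funext => x; rewrite /H /snoc; case: unlift => [i|];
      by rewrite /oapp ?fE poweR_EFin.
  rewrite /I -HE; apply: eq_integral => x _.
  by rewrite gee0_abs ?multi_maximal_ge0// (multi_maximal_poweR _ _ _ _ q0 H0).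
have I0 : (0 <= I)%E by apply: integral_ge0 => x _; exact: multi_maximal_ge0.
have CK1 : 0 <= C * K0 + 1 by rewrite addr_ge0.
have CTE : CT%:E = ((CT `^ q)%:E `^ q^-1)%E by rewrite poweR_EFin powRK// ltW.
rewrite EFinM -poweR_EFin -muleA CTE -!poweRM ?lee_fin//; last 2 first.
- by rewrite mule_ge0// lee_fin powR_ge0.
- exact: powR_ge0.
apply: ge0_poweR_le; rewrite ?invr_ge0 ?(ltW q0)//.
  by apply: integral_ge0 => x _; exact: poweR_ge0.
(* For almost every x some index k norms [F x], and [W K x] dominates the corresponding value for
   all K from k on; so the lower limit of the [W K] majorises the integrand up to [C]. *)
apply: (@le_trans _ _ (\int[lebesgue_Rd R n]_x (C%:E * limn_einf (fun K => W K x)))%E).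
  apply: ae_le_lintegral => [x|x||].
  - exact: poweR_ge0.
  - by rewrite mule_ge0 ?lee_fin ?(ltW C0)//; exact: limn_einf_ge0.
  - by apply: measurable_funeM; exact: measurable_limn_einf.
  apply: filterS normF => x [PXF [k Fk]].
  rewrite /vnorm asboolT// gee0_abs; last first.
    by rewrite mule_ge0 ?lee_fin ?cabs_ge0//; exact: (qb_norm_ge0 qPX).
  rewrite poweRM ?lee_fin ?cabs_ge0//; last exact: (qb_norm_ge0 qPX).
  rewrite !poweR_EFin -/(G x) muleC.
  have G0 : (0 <= (G x)%:E)%E by rewrite lee_fin; have /andP[] := GM x.
  apply: le_trans (lee_wpmul2l G0 Fk) _; rewrite muleCA.
  apply: lee_wpmul2l; first by rewrite lee_fin ltW.
  rewrite limn_einf_lim; apply: lime_ge; first exact: is_cvg_einfs.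
  exists k => // K /= kK; apply: le_ereal_inf_tmp => _ [K' /= KK' <-].
  have [_ _ WK _] := WP K'; apply: (WK k x); exact: leq_trans kK KK'.
rewrite ge0_integralZl//; last 3 first.
- exact: measurable_limn_einf.
- by move=> x _; exact: limn_einf_ge0.
- by rewrite lee_fin ltW.
apply: (@le_trans _ _ (C%:E * ((CT `^ q * K0)%:E * I))%E).
  apply: lee_wpmul2l; first by rewrite lee_fin ltW.
  apply: le_trans (fatou (lebesgue_Rd R n) measurableT mW (fun K x _ => W0 K x)) _.
  by apply: limn_einf_le => K; have [_ _ _] := WP K.
rewrite muleA [leRHS]muleA -!EFinM; apply: lee_wpmul2r => //.
rewrite lee_fin mulrDl mul1r [CT `^ q * K0]mulrC mulrA lerDl; exact: powR_ge0.
Qed.
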